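(* Let $G$ be a finite solvable group and $p$ a prime dividing $|G|$. Then $\pi_1(\mathcal{A}_p(G))$ is a free group.
   Context: For a finite group $G$ and a prime $p$, $\mathcal{A}_p(G)$ is the poset of non-trivial elementary abelian $p$-subgroups of $G$ ordered by inclusion. Topological notions for a finite poset refer to the geometric realization of its order complex, whose simplices are the non-empty chains. If $\mathcal{A}_p(G)$ is disconnected, $\pi_1(\mathcal{A}_p(G))$ means the fundamental group of any connected component (they are all isomorphic, since $G$ permutes the components transitively by conjugation). *)

(* Defs.v *)
From HB Require Import structures.
From mathcomp Require Import all_boot all_order all_algebra all_fingroup all_solvable.
From mathcomp Require Import generic_quotient.
From mathcomp Require Import all_classical reals topology normedtype homotopy.
From mathcomp Require Import ring lra.

Set Implicit Arguments.
Unset Strict Implicit.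
Unset Printing Implicit Defensive.

Import Order.TTheory GRing.Theory Num.Theory.
Import numFieldTopology.Exports numFieldNormedType.Exports.

Local Open Scope classical_set_scope.
Local Open Scope ring_scope.

Section Ap.
Context (gT : finGroupType) (p : nat) (G : {group gT}).

Definition Ap : Type := {E : {group gT} | ((E \in 'E_p(G)) && (E :!=: 1))%g}.

HB.instance Definition _ := SubType.on Ap.
HB.instance Definition _ := [Finite of Ap by <:].

Definition Ap_le : rel Ap := fun E F => val E \subset val F.

Fact Ap_le_refl : reflexive Ap_le.
Proof. by move=> E; exact: subxx. Qed.

Fact Ap_le_anti : antisymmetric Ap_le.
Proof.
move=> E F /andP[EF FE]; apply/val_inj/val_inj/eqP.
by rewrite finset.eqEsubset; apply/andP.
Qed.

Fact Ap_le_trans : transitive Ap_le.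
Proof. by move=> F E H EF FH; exact: fintype.subset_trans EF FH. Qed.

Fact Ap_display : Order.disp_t. Proof. exact: Order.Disp tt tt. Qed.

HB.instance Definition _ := Order.Le_isPOrder.Build Ap_display Ap
  Ap_le_refl Ap_le_anti Ap_le_trans.

Lemma Ap_leE (E F : Ap) : (E <= F)%O = (val E \subset val F).
Proof. by []. Qed.

End Ap.

Definition order_complex d (P : finPOrderType d) : {set {set P}} :=
  [set s : {set P} | (s != finset.set0)
     && [forall x in s, forall y in s, (x >=< y)%O]]%SET.

(* The points of the realization are the barycentric coordinate functions on
   the vertices, with the topology induced by the product topology of R^V; as V
   is finite this is the usual (weak) topology. *)
Definition realization (R : realType) (V : finType) (K : {set {set V}}) :
    set {ptws V -> R} :=
  [set a | [/\ forall v, 0 <= a v, \sum_v a v = 1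
             & [set v | a v != 0]%SET \in K]].
Arguments realization : clear implicits.

Definition poset_space (R : realType) d (P : finPOrderType d) :
    topologicalType :=
  set_type (realization R P (order_complex P)).

Section unit_interval.
Context (R : realType).

Definition unit_itv : Type := set_type `[0, 1 : R]%classic.

HB.instance Definition _ := Topological.on unit_itv.

Definition clamp_val (r : R) : R := Num.max 0 (Num.min 1 r).

Fact clamp_subproof (r : R) : clamp_val r \in `[0, 1 : R]%classic.
Proof.
rewrite mem_setE /= in_itv /= /clamp_val le_max lexx /=.
by rewrite ge_max ler01 /= ge_min lexx.
Qed.

Definition clamp_itv (r : R) : unit_itv := SigSub (clamp_subproof r).

Fact clamp_itv01 : clamp_itv 0 != clamp_itv 1.
Proof.
apply/eqP => /(congr1 val) /=; rewrite /clamp_val.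
rewrite min_r ?ler01// maxxx minxx max_r ?ler01// => /esym/eqP.
by rewrite oner_eq0.
Qed.

HB.instance Definition _ := isBiPointed.Build unit_itv clamp_itv01.

Definition unit_interval : bpTopologicalType := unit_itv.

Definition clamp (r : R) : unit_interval := clamp_itv r.

Definition uval (t : unit_interval) : R := \val (t : unit_itv).

Lemma uval_itv t : 0 <= uval t <= 1.
Proof.
by case: t => r r01; have := set_mem r01; rewrite /= in_itv.
Qed.

Lemma clampK r : 0 <= r <= 1 -> uval (clamp r) = r.
Proof.
case/andP=> r0 r1; rewrite /uval /= /clamp_val.
by rewrite (min_idPr r1) (max_idPr r0).
Qed.

Lemma uvalK t : clamp (uval t) = t.
Proof. by apply: val_inj; exact: (clampK (uval_itv t)). Qed.

End unit_interval.

Lemma clamp0 (R : realType) : clamp 0 = zero :> unit_interval R.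
Proof. by []. Qed.

Lemma clamp1 (R : realType) : clamp 1 = one :> unit_interval R.
Proof. by []. Qed.

Lemma uval0 (R : realType) : uval (zero : unit_interval R) = 0.
Proof. by rewrite -clamp0 clampK// lexx ler01. Qed.

Lemma uval1 (R : realType) : uval (one : unit_interval R) = 1.
Proof. by rewrite -clamp1 clampK// lexx ler01. Qed.

Lemma uval_continuous (R : realType) : continuous (@uval R).
Proof. exact: initial_continuous. Qed.

Lemma continuous_uval_lift (R : realType) (X : topologicalType)
  (f : X -> unit_interval R) :
  continuous (fun x => uval (f x)) -> continuous f.
Proof. by move=> cf; apply/continuous_comp_initial. Qed.

Lemma clamp_continuous (R : realType) : continuous (@clamp R).
Proof.
apply: continuous_uval_lift => x.
by apply: continuous_max; [exact: cvg_cst|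
  apply: continuous_min; [exact: cvg_cst|exact: cvg_id]].
Qed.

Lemma paste_continuous (R : realType) (X T : topologicalType) (u : X -> R)
    (c : R) (f g : X -> T) :
  continuous u -> continuous f -> continuous g ->
  (forall x, u x = c -> f x = g x) ->
  continuous (fun x => if u x <= c then f x else g x).
Proof.
move=> cu cf cg fg.
have cA : closed (u @^-1` [set y | y <= c]).
  by apply: (preimage_closed _ (@closed_le R c)) => x _; exact: cu.
have cB : closed (u @^-1` [set y | c <= y]).
  by apply: (preimage_closed _ (@closed_ge R c)) => x _; exact: cu.
apply/continuous_subspace_setT.
have -> : [set: X] = (u @^-1` [set y | y <= c]) `|` (u @^-1` [set y | c <= y]).
  by apply/seteqP; split=> // x _ /=; apply/orP; exact: le_total.
apply: withinU_continuous => //.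
- apply: (@subspace_eq_continuous _ _ _ f); last exact: continuous_subspaceT.
  by move=> x /set_mem /= uxc; rewrite /from_subspace uxc.
- apply: (@subspace_eq_continuous _ _ _ g); last exact: continuous_subspaceT.
  move=> x /set_mem /= cux; rewrite /from_subspace; case: ifPn => // uxc.
  by rewrite fg//; apply/eqP; rewrite eq_le uxc.
Qed.

Lemma pair_continuous (X Y Z : topologicalType) (f : X -> Y) (g : X -> Z) :
  continuous f -> continuous g -> continuous (fun x => (f x, g x)).
Proof. by move=> cf cg x; apply: cvg_pair; [exact: cf|exact: cg]. Qed.

Lemma clamp_comp_continuous (R : realType) (X : topologicalType) (u : X -> R) :
  continuous u -> continuous (fun x => clamp (u x)).
Proof.
by move=> cu x; apply: continuous_comp; [exact: cu|exact: clamp_continuous].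
Qed.

Section continuous_real.
Context (R : realType) (X : topologicalType).
Implicit Types u v : X -> R.

Lemma real_cst_continuous (c : R) : continuous (fun _ : X => c).
Proof. by move=> x; exact: cvg_cst. Qed.

Lemma real_addr_continuous u v :
  continuous u -> continuous v -> continuous (fun x => u x + v x).
Proof. by move=> cu cv x; apply: cvgD; [exact: cu|exact: cv]. Qed.

Lemma real_subr_continuous u v :
  continuous u -> continuous v -> continuous (fun x => u x - v x).
Proof. by move=> cu cv x; apply: cvgB; [exact: cu|exact: cv]. Qed.

Lemma real_mulr_continuous u v :
  continuous u -> continuous v -> continuous (fun x => u x * v x).
Proof. by move=> cu cv x; apply: cvgM; [exact: cu|exact: cv]. Qed.

Lemma real_max_continuous u v :
  continuous u -> continuous v -> continuous (fun x => Num.max (u x) (v x)).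
Proof. by move=> cu cv x; apply: continuous_max; [exact: cu|exact: cv]. Qed.

Lemma real_min_continuous u v :
  continuous u -> continuous v -> continuous (fun x => Num.min (u x) (v x)).
Proof. by move=> cu cv x; apply: continuous_min; [exact: cu|exact: cv]. Qed.

Lemma real_norm_continuous u :
  continuous u -> continuous (fun x => `|u x|).
Proof.
by move=> cu x; apply: continuous_comp; [exact: cu|exact: norm_continuous].
Qed.

Lemma real_comp_continuous (Y : topologicalType) (f : X -> Y) (w : Y -> R) :
  continuous w -> continuous f -> continuous (fun x => w (f x)).
Proof. by move=> cw cf x; apply: continuous_comp; [exact: cf|exact: cw]. Qed.

End continuous_real.

Ltac real_continuity :=
  repeat first
    [ assumption
    | exact: real_cst_continuous
    | exact: uval_continuous
    | (move=> ?; exact: cvg_fst)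
    | (move=> ?; exact: cvg_snd)
    | apply: real_subr_continuous
    | apply: real_addr_continuous
    | apply: real_mulr_continuous
    | apply: real_max_continuous
    | apply: real_min_continuous
    | apply: real_norm_continuous
    | apply: (real_comp_continuous (@uval_continuous _)) ].

(* Homotopy relative to the endpoints; the second coordinate is the homotopy
   parameter. *)
Definition path_homotopic (R : realType) (T : topologicalType) (x y : T)
    (p q : {path unit_interval R from x to y in T}) : Prop :=
  exists H : unit_interval R * unit_interval R -> T,
    [/\ continuous H,
        forall t, H (t, zero) = p t, forall t, H (t, one) = q t,
        forall s, H (zero, s) = x & forall s, H (one, s) = y].

Section path_operations.
Context (R : realType) (T : topologicalType).
Local Notation I := (unit_interval R).
Implicit Types x y z w : T.

Definition rev_fun (p : I -> T) (t : I) : T := p (clamp (1 - uval t)).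

(* clamp only serves to re-enter the subtype [0, 1]: its arguments below lie in
   [0, 1] already, on the relevant branch. *)
Definition concat_fun (p q : I -> T) (t : I) : T :=
  if uval t <= 2^-1 then p (clamp (2 * uval t))
  else q (clamp (2 * uval t - 1)).

Lemma path_clamp_continuous (X : topologicalType) (p : I -> T) (u : X -> R) :
  continuous p -> continuous u -> continuous (fun a => p (clamp (u a))).
Proof.
move=> cp cu a; apply: continuous_comp; last exact: cp.
by apply: continuous_comp; [exact: cu|exact: clamp_continuous].
Qed.

Section rev.
Context x y (p : {path I from x to y in T}).

Fact rev_continuous : continuous (rev_fun p).
Proof.
apply: (@path_clamp_continuous _ p (fun t => 1 - uval t)).
  exact: (@cts_fun _ _ p).
by real_continuity.
Qed.

Fact rev_zero : rev_fun p zero = y.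
Proof. by rewrite /rev_fun uval0 subr0 clamp1 path_one. Qed.

Fact rev_one : rev_fun p one = x.
Proof. by rewrite /rev_fun uval1 subrr clamp0 path_zero. Qed.

Definition rev_path : {path I from y to x in T} :=
  mk_path rev_continuous rev_zero rev_one.

End rev.

Section concat.
Context x y z (p : {path I from x to y in T}) (q : {path I from y to z in T}).

Fact concat_continuous : continuous (concat_fun p q).
Proof.
apply: paste_continuous.
- exact: uval_continuous.
- apply: (@path_clamp_continuous _ p (fun t => 2 * uval t)).
    exact: (@cts_fun _ _ p).
  by real_continuity.
- apply: (@path_clamp_continuous _ q (fun t => 2 * uval t - 1)).
    exact: (@cts_fun _ _ q).
  by real_continuity.
- move=> t ->; rewrite mulfV ?pnatr_eq0// subrr.
  by rewrite clamp1 clamp0 path_one path_zero.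
Qed.

Fact concat_zero : concat_fun p q zero = x.
Proof.
by rewrite /concat_fun uval0 invr_ge0 ler0n mulr0 clamp0 path_zero.
Qed.

Fact concat_one : concat_fun p q one = z.
Proof.
rewrite /concat_fun uval1 mulr1 ifF; last by apply/negbTE; rewrite -ltNge; lra.
by rewrite (_ : 2 - 1 = 1) ?clamp1 ?path_one//; lra.
Qed.

Definition concat_path : {path I from x to z in T} :=
  mk_path concat_continuous concat_zero concat_one.

End concat.

Definition const_path x : {path I from x to x in T} := cst x.

End path_operations.

Section homotopy_theory.
Context (R : realType) (T : topologicalType).
Local Notation I := (unit_interval R).
Implicit Types x y z w : T.

Lemma path_homotopic_refl x y (p : {path I from x to y in T}) :
  path_homotopic p p.
Proof.
exists (fun a => p a.1); split => //= [a|s|s].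
- apply: (@continuous_comp _ _ _ fst p); first exact: cvg_fst.
  exact: (@cts_fun _ _ p).
- by rewrite path_zero.
- by rewrite path_one.
Qed.

Lemma path_homotopic_sym x y (p q : {path I from x to y in T}) :
  path_homotopic p q -> path_homotopic q p.
Proof.
move=> [H [cH H0 H1 Hx Hy]].
exists (fun a => H (a.1, clamp (1 - uval a.2))); split => //= [a|t|t].
- apply: (@continuous_comp _ _ _ (fun a => (a.1, clamp (1 - uval a.2))) H);
    last exact: cH.
  apply: pair_continuous; first by move=> ?; exact: cvg_fst.
  by apply: clamp_comp_continuous; real_continuity.
- by rewrite uval0 subr0 clamp1.
- by rewrite uval1 subrr clamp0.
Qed.

Lemma path_homotopic_trans x y (q p r : {path I from x to y in T}) :
  path_homotopic p q -> path_homotopic q r -> path_homotopic p r.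
Proof.
move=> [H [cH H0 H1 Hx Hy]] [K [cK K0 K1 Kx Ky]].
have cpair (u : I * I -> R) : continuous u ->
    continuous (fun a : I * I => (a.1, clamp (u a))).
  move=> cu; apply: pair_continuous; first by move=> ?; exact: cvg_fst.
  exact: clamp_comp_continuous.
exists (fun a => if uval a.2 <= 2^-1 then H (a.1, clamp (2 * uval a.2))
                 else K (a.1, clamp (2 * uval a.2 - 1))); split=> [|t|t|s|s].
- apply: (@paste_continuous R _ _ (fun a : I * I => uval a.2) 2^-1
    (fun a => H (a.1, clamp (2 * uval a.2)))
    (fun a => K (a.1, clamp (2 * uval a.2 - 1)))).
  + by real_continuity.
  + move=> a; apply: (@continuous_comp _ _ _
      (fun a => (a.1, clamp (2 * uval a.2))) H); last exact: cH.
    by apply: cpair; real_continuity.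
  + move=> a; apply: (@continuous_comp _ _ _
      (fun a => (a.1, clamp (2 * uval a.2 - 1))) K); last exact: cK.
    by apply: cpair; real_continuity.
  + by move=> a ->; rewrite mulfV ?pnatr_eq0// subrr clamp1 clamp0 H1 K0.
- by rewrite /= uval0 invr_ge0 ler0n mulr0 clamp0 H0.
- rewrite /= uval1 mulr1 ifF; last by apply/negbTE; rewrite -ltNge; lra.
  by rewrite (_ : 2 - 1 = 1) ?clamp1 ?K1//; lra.
- by rewrite /= Hx Kx if_same.
- by rewrite /= Hy Ky if_same.
Qed.

Lemma path_homotopic_concat x y z (p p' : {path I from x to y in T})
    (q q' : {path I from y to z in T}) :
  path_homotopic p p' -> path_homotopic q q' ->
  path_homotopic (concat_path p q) (concat_path p' q').
Proof.
move=> [H [cH H0 H1 Hx Hy]] [K [cK K0 K1 Kx Ky]].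
have cpair (u : I * I -> R) : continuous u ->
    continuous (fun a : I * I => (clamp (u a), a.2)).
  move=> cu; apply: pair_continuous; last by move=> ?; exact: cvg_snd.
  exact: clamp_comp_continuous.
exists (fun a => if uval a.1 <= 2^-1 then H (clamp (2 * uval a.1), a.2)
                 else K (clamp (2 * uval a.1 - 1), a.2)); split=> [|t|t|s|s].
- apply: (@paste_continuous R _ _ (fun a : I * I => uval a.1) 2^-1
    (fun a => H (clamp (2 * uval a.1), a.2))
    (fun a => K (clamp (2 * uval a.1 - 1), a.2))).
  + by real_continuity.
  + move=> a; apply: (@continuous_comp _ _ _
      (fun a => (clamp (2 * uval a.1), a.2)) H); last exact: cH.
    by apply: cpair; real_continuity.
  + move=> a; apply: (@continuous_comp _ _ _
      (fun a => (clamp (2 * uval a.1 - 1), a.2)) K); last exact: cK.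
    by apply: cpair; real_continuity.
  + by move=> a ->; rewrite mulfV ?pnatr_eq0// subrr clamp1 clamp0 Hy Kx.
- by rewrite /= H0 K0.
- by rewrite /= H1 K1.
- by rewrite /= uval0 invr_ge0 ler0n mulr0 clamp0 Hx.
- rewrite /= uval1 mulr1 ifF; last by apply/negbTE; rewrite -ltNge; lra.
  by rewrite (_ : 2 - 1 = 1) ?clamp1 ?Ky//; lra.
Qed.

Lemma path_homotopic_rev x y (p q : {path I from x to y in T}) :
  path_homotopic p q -> path_homotopic (rev_path p) (rev_path q).
Proof.
move=> [H [cH H0 H1 Hx Hy]].
exists (fun a => H (clamp (1 - uval a.1), a.2)); split=> [a|t|t|s|s].
- apply: (@continuous_comp _ _ _ (fun a => (clamp (1 - uval a.1), a.2)) H);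
    last exact: cH.
  apply: pair_continuous; last by move=> ?; exact: cvg_snd.
  by apply: clamp_comp_continuous; real_continuity.
- by rewrite /= H0.
- by rewrite /= H1.
- by rewrite /= uval0 subr0 clamp1 Hy.
- by rewrite /= uval1 subrr clamp0 Hx.
Qed.

(* The homotopy is f composed with the straight line from u to v. *)
Lemma path_homotopic_reparam x y (p q : {path I from x to y in T})
    (f : I -> T) (u v : I -> R) :
  continuous f -> continuous u -> continuous v ->
  u zero = v zero -> u one = v one ->
  (forall t, p t = f (clamp (u t))) -> (forall t, q t = f (clamp (v t))) ->
  path_homotopic p q.
Proof.
move=> cf cu cv u0 u1 pE qE.
exists (fun a => f (clamp ((1 - uval a.2) * u a.1 + uval a.2 * v a.1))).
split=> [|t|t|s|s].
- apply: (@path_clamp_continuous _ _ _ _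
    (fun a : I * I => (1 - uval a.2) * u a.1 + uval a.2 * v a.1)) => //.
  by real_continuity; apply: real_comp_continuous => // ?; exact: cvg_fst.
- by rewrite /= uval0 subr0 mul1r mul0r addr0 pE.
- by rewrite /= uval1 subrr mul1r mul0r add0r qE.
- by rewrite /= -u0 -mulrDl subrK mul1r -pE path_zero.
- by rewrite /= -u1 -mulrDl subrK mul1r -pE path_one.
Qed.

Lemma path_homotopic_concat1p x y (p : {path I from x to y in T}) :
  path_homotopic (concat_path (const_path R x) p) p.
Proof.
apply: (@path_homotopic_reparam _ _ _ _ p
  (fun t => Num.max 0 (2 * uval t - 1)) (@uval R)).
- exact: (@cts_fun _ _ p).
- by real_continuity.
- by real_continuity.
- by rewrite uval0; apply/max_idPl; lra.
- by rewrite uval1; rewrite max_r; lra.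
- move=> t; rewrite /= /mk_path /concat_fun; case: ifPn => [t2|].
    by rewrite max_l; [rewrite clamp0 path_zero|lra].
  by rewrite -ltNge => t2; rewrite max_r//; lra.
- by move=> t; rewrite uvalK.
Qed.

Lemma path_homotopic_concatp1 x y (p : {path I from x to y in T}) :
  path_homotopic (concat_path p (const_path R y)) p.
Proof.
apply: (@path_homotopic_reparam _ _ _ _ p
  (fun t => Num.min 1 (2 * uval t)) (@uval R)).
- exact: (@cts_fun _ _ p).
- by real_continuity.
- by real_continuity.
- by rewrite uval0 mulr0 min_r.
- by rewrite uval1 min_l; lra.
- move=> t; rewrite /= /mk_path /concat_fun; case: ifPn => [t2|].
    by rewrite min_r//; lra.
  by rewrite -ltNge => t2; rewrite min_l; [rewrite clamp1 path_one|lra].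
- by move=> t; rewrite uvalK.
Qed.

Lemma path_homotopic_concatVp x y (p : {path I from x to y in T}) :
  path_homotopic (concat_path (rev_path p) p) (const_path R y).
Proof.
apply: (@path_homotopic_reparam _ _ _ _ p
  (fun t => `|1 - 2 * uval t|) (fun=> 1)).
- exact: (@cts_fun _ _ p).
- by real_continuity.
- by real_continuity.
- by rewrite uval0 mulr0 subr0 normr1.
- by rewrite uval1 ler0_norm; lra.
- move=> t; have /andP[t0 t1] := uval_itv t.
  rewrite /= /mk_path /concat_fun /rev_fun; case: ifPn => [t2|].
    by rewrite clampK ?ger0_norm//; lra.
  by rewrite -ltNge => t2; rewrite ler0_norm ?opprB//; lra.
- by move=> t; rewrite clamp1 path_one.
Qed.

Lemma path_homotopic_concatpV x y (p : {path I from x to y in T}) :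
  path_homotopic (concat_path p (rev_path p)) (const_path R x).
Proof.
apply: (@path_homotopic_reparam _ _ _ _ p
  (fun t => 1 - `|1 - 2 * uval t|) (fun=> 0)).
- exact: (@cts_fun _ _ p).
- by real_continuity.
- by real_continuity.
- by rewrite uval0 mulr0 subr0 normr1 subrr.
- by rewrite uval1 ler0_norm; lra.
- move=> t; have /andP[t0 t1] := uval_itv t.
  rewrite /= /mk_path /concat_fun /rev_fun; case: ifPn => [t2|].
    by rewrite ger0_norm ?subKr//; lra.
  by rewrite -ltNge => t2; rewrite clampK ?ler0_norm ?opprB//; lra.
- by move=> t; rewrite clamp0 path_zero.
Qed.

Lemma path_homotopic_concatA x y z w (p : {path I from x to y in T})
    (q : {path I from y to z in T}) (r : {path I from z to w in T}) :
  path_homotopic (concat_path p (concat_path q r))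
                 (concat_path (concat_path p q) r).
Proof.
apply: path_homotopic_sym.
apply: (@path_homotopic_reparam _ _ _ _ (concat_path p (concat_path q r))
  (fun t => Num.min (2 * uval t)
              (Num.min (uval t + 4^-1) (2^-1 * uval t + 2^-1))) (@uval R)).
- exact: concat_continuous.
- by real_continuity.
- by real_continuity.
- by rewrite uval0 !mulr0 !add0r min_l// !le_min; lra.
- by rewrite uval1 (@min_r _ _ (1 + 4^-1)) ?min_r; lra.
- move=> t; have /andP[t0 t1] := uval_itv t.
  rewrite /= /mk_path /concat_fun; case: (lerP (uval t) 2^-1) => t2.
    rewrite clampK; last lra.
    rewrite (@min_l _ _ (uval t + 4^-1)); last lra.
    case: (lerP (2 * uval t) 2^-1) => t4.
      rewrite min_l; last lra.
      by rewrite clampK ?t4//; lra.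
    rewrite min_r; last lra.
    rewrite clampK; last lra.
    rewrite ifF; last by apply/negbTE; rewrite -ltNge; lra.
    rewrite clampK; last lra.
    rewrite ifT; last lra.
    by congr (q (clamp _)); lra.
  rewrite (@min_r _ _ (uval t + 4^-1)); last lra.
  rewrite min_r; last lra.
  rewrite clampK; last lra.
  rewrite ifF; last by apply/negbTE; rewrite -ltNge; lra.
  rewrite clampK; last lra.
  rewrite ifF; last by apply/negbTE; rewrite -ltNge; lra.
  by congr (r (clamp _)); lra.
- by move=> t; rewrite uvalK.
Qed.

End homotopy_theory.

Section fundamental_group.
Context (R : realType) (T : topologicalType) (x : T).
Local Open Scope quotient_scope.

Definition loop : choiceType :=
  {path unit_interval R from x to x in T}.

Definition loop_homotopicb : rel loop := fun p q => `[< path_homotopic p q >].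

Fact loop_homotopicb_equiv : equiv_class_of loop_homotopicb.
Proof.
split.
- by move=> p; apply/asboolP; exact: path_homotopic_refl.
- by move=> p q; apply/asboolP/asboolP; exact: path_homotopic_sym.
- move=> q p r /asboolP pq /asboolP qr; apply/asboolP.
  exact: path_homotopic_trans pq qr.
Qed.

Canonical loop_homotopic_equiv := EquivRelPack loop_homotopicb_equiv.

Definition pi1 : Type := {eq_quot loop_homotopicb}.

HB.instance Definition _ := Choice.on pi1.
HB.instance Definition _ := EqQuotient.on pi1.

Lemma pi1_eqP (p q : loop) : path_homotopic p q <-> \pi_pi1 p = \pi_pi1 q.
Proof.
split=> [pq|/eqquotP/asboolP//].
by apply/eqquotP/asboolP.
Qed.

Definition pi1_one : pi1 := \pi_pi1 (const_path R x : loop).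

Definition pi1_mul (a b : pi1) : pi1 :=
  \pi_pi1 (concat_path (repr a) (repr b) : loop).

Definition pi1_inv (a : pi1) : pi1 := \pi_pi1 (rev_path (repr a) : loop).

Lemma pi1_mulE (p q : loop) :
  pi1_mul (\pi_pi1 p) (\pi_pi1 q) = \pi_pi1 (concat_path p q : loop).
Proof.
by apply/pi1_eqP/path_homotopic_concat; apply/pi1_eqP; rewrite reprK.
Qed.

Lemma pi1_invE (p : loop) : pi1_inv (\pi_pi1 p) = \pi_pi1 (rev_path p : loop).
Proof. by apply/pi1_eqP/path_homotopic_rev/pi1_eqP; rewrite reprK. Qed.

Fact pi1_mulA : associative pi1_mul.
Proof.
elim/quotW=> p; elim/quotW=> q; elim/quotW=> r.
rewrite (pi1_mulE q r) (pi1_mulE p q) (pi1_mulE p) (pi1_mulE _ r).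
by apply/pi1_eqP; exact: path_homotopic_concatA.
Qed.

Fact pi1_mul1g : left_id pi1_one pi1_mul.
Proof.
elim/quotW=> p; rewrite pi1_mulE; apply/pi1_eqP.
exact: path_homotopic_concat1p.
Qed.

Fact pi1_mulg1 : right_id pi1_one pi1_mul.
Proof.
elim/quotW=> p; rewrite pi1_mulE; apply/pi1_eqP.
exact: path_homotopic_concatp1.
Qed.

Fact pi1_mulVg : left_inverse pi1_one pi1_inv pi1_mul.
Proof.
elim/quotW=> p; rewrite pi1_invE pi1_mulE; apply/pi1_eqP.
exact: path_homotopic_concatVp.
Qed.

Fact pi1_mulgV : right_inverse pi1_one pi1_inv pi1_mul.
Proof.
elim/quotW=> p; rewrite pi1_invE pi1_mulE; apply/pi1_eqP.
exact: path_homotopic_concatpV.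
Qed.

HB.instance Definition _ := isGroup.Build pi1
  pi1_mulA pi1_mul1g pi1_mulg1 pi1_mulVg pi1_mulgV.

End fundamental_group.

Definition group_hom (F H : groupType) (phi : F -> H) : Prop :=
  {morph phi : a b / (a * b)%g}.

(* The universal property of the free group on the basis B. *)
Definition free_basis (F : groupType) (B : set F) : Prop :=
  forall (H : groupType) (f : B -> H),
    exists! phi : F -> H, group_hom phi /\ forall b : B, phi (\val b) = f b.

Definition is_free_group (F : groupType) : Prop :=
  exists B : set F, free_basis B.

(* Main.v *)
(* Let M = O_p'(G) and map E in A_p(G) to EM/M in A_p(G/M). The target is simply
   connected, because O_p(G/M) <> 1 (Quillen). The fibre under y = BM/M is
   A_p(MB), which is connected if B has rank at least 2 and simply connected if
   B has rank at least 3; both follow by induction along a chief series of MB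
   below M. Put X = A_p(G) and Y = A_p(G/M) into one complex and pass from Y to X:
   delete the maximal elements of rank 2 of Y, which keeps the components simply
   connected because their links are discrete; replace the elements of rank 1 by
   their fibres; add the other elements of X, with a contractible or a discrete
   link; finally delete the other elements of Y, whose links are simply connected
   joins of a fibre with an upper interval. An added vertex whose link is carried
   by simply connected pieces only multiplies the fundamental group by a free
   group, and the last deletions do not change it.

   Fundamental groups of clique complexes are handled through cocycles, that is,
   edge labellings c by a group H with c x y * c y z = c x z on triangles: a
   homomorphism from the fundamental group to H is the holonomy of a cocycle. The
   holonomy of a continuous path is read off by subdividing it into pieces that
   lie in open stars of vertices. *)

Require Import Defs.
From mathcomp Require Import all_boot all_order all_algebra all_fingroup all_solvable.
From mathcomp Require Import all_classical reals topology.
From mathcomp Require Import generic_quotient ring lra normedtype homotopy.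
From mathcomp Require Import mxrepresentation mxabelem fintype finset.

Set Implicit Arguments.
Unset Strict Implicit.
Unset Printing Implicit Defensive.

(** * Cocycles on clique complexes *)

(** Freeness is expressed by cocycles with values in an arbitrary group, so that gluing a vertex
    means extending labels and comparing potentials on its link. The obstacle is rank two: a fibre
    over a subgroup of rank two is only known to be connected, and its vertex has a simply connected
    link only if the fibre is joined with something above. Hence the maximal elements of rank two
    leave before the passage, and the elements of [X] over them later enter with discrete links.
    These are one source of free generators; the extra points of the fibres over rank one are the
    other. The passage is done once for an abstract property [Q] of vertex sets. With [Q] simple
    connectivity it drives the induction for fibres of rank at least three, where upper intervals
    over rank one are connected and nothing is deleted beforehand; with [Q] freeness it gives the
    theorem. The posets carry a central lower bound [D], because the interval above [y] is the poset
    of [C_L(y)] with lower bound [y]. *)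

Section Clique.
Local Open Scope group_scope.

Section Cocycles.
Context (V : finType) (e : rel V).
Hypotheses (e_refl : reflexive e) (e_sym : symmetric e).
Implicit Types (A B D L : {set V}) (x y z v w : V) (s t : seq V).

Definition adj A x y := [&& x \in A, y \in A & e x y].

Definition conn A := forall x y, x \in A -> y \in A -> connect (adj A) x y.

Definition cocycle (H : groupType) A (c : V -> V -> H) :=
  forall x y z, x \in A -> y \in A -> z \in A ->
    e x y -> e y z -> e x z -> c x y * c y z = c x z.

Definition coboundary (H : groupType) A (c : V -> V -> H) :=
  exists g : V -> H, forall x y, x \in A -> y \in A -> e x y ->
    c x y = (g x)^-1 * g y.

(* Equivalently, every component of the clique complex on A is simply connected. *)
Definition acyclic A :=
  forall (H : groupType) (c : V -> V -> H), cocycle A c -> coboundary A c.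

Definition link A x := [set y in A | e x y].

(** Weaker than [acyclic (link A x)]: only cocycles that extend to all of [A] are tested, so the
    link may have any shape when a vertex of [A] cones it off. *)
Definition trivial_on_link A x := forall (H : groupType) (c : V -> V -> H),
  cocycle A c -> coboundary (link A x) c.

Lemma adj_sym A : symmetric (adj A).
Proof. by move=> x y; rewrite /adj e_sym andbCA. Qed.

Lemma adj_csym A : connect_sym (adj A).
Proof. exact: sym_connect_sym (@adj_sym A). Qed.

Lemma adjS A B : A \subset B -> subrel (adj A) (adj B).
Proof.
by move/subsetP=> AB x y /and3P[xA yA exy]; apply/and3P; split=> //; exact: AB.
Qed.

Lemma connectS A B : A \subset B -> subrel (connect (adj A)) (connect (adj B)).
Proof.
by move=> AB; apply: connect_sub => x y /(adjS AB); exact: connect1.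
Qed.

Lemma path_in A x s : path (adj A) x s -> x \in A -> last x s \in A.
Proof. by elim: s x => //= y s IH x /andP[/and3P[_ yA _]] /IH-> //. Qed.

Lemma connect_in A x y : connect (adj A) x y -> x \in A -> y \in A.
Proof. by case/connectP=> s ps ->; exact: path_in. Qed.

(** Boolean test functions suffice, since reachability from [x] is one of them. *)
Lemma connI A : (forall k : V -> bool,
  (forall x y, x \in A -> y \in A -> e x y -> k x = k y) ->
  forall x y, x \in A -> y \in A -> k x = k y) -> conn A.
Proof.
move=> ek x y xA yA; rewrite -(ek (connect (adj A) x) _ x y) ?connect0//.
move=> u w uA wA euw; apply: same_connect_r; first exact: adj_csym.
by apply: connect1; apply/and3P.
Qed.

Lemma conn_const (T : Type) A (k : V -> T) : conn A ->
  (forall x y, x \in A -> y \in A -> e x y -> k x = k y) ->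
  forall x y, x \in A -> y \in A -> k x = k y.
Proof.
move=> cA ek x y xA yA; have /connectP[s + ->] := cA x y xA yA.
elim: s x {xA yA} => //= z s IH x /andP[/and3P[xA zA exz] /IH <-].
exact: ek.
Qed.

Section OneCocycle.
Context (H : groupType) (c : V -> V -> H).

Lemma cocycleS A B : A \subset B -> cocycle B c -> cocycle A c.
Proof. by move=> /subsetP AB cB x y z xA yA zA; apply: cB; exact: AB. Qed.

Lemma cocycle1 A x : cocycle A c -> x \in A -> c x x = 1.
Proof.
by move=> cA xA; apply: (mulgI (c x x)); rewrite mulg1; apply: cA.
Qed.

Lemma cocycleV A x y : cocycle A c -> x \in A -> y \in A -> e x y ->
  c y x = (c x y)^-1.
Proof.
move=> cA xA yA exy; apply: (mulgI (c x y)).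
by rewrite mulgV cA ?(cocycle1 cA) // e_sym.
Qed.

Fixpoint hol x s : H := if s is y :: s' then c x y * hol y s' else 1.

Lemma hol_cat x s t : hol x (s ++ t) = hol x s * hol (last x s) t.
Proof. by elim: s x => /= [|y s IH] x; rewrite ?mul1g// IH mulgA. Qed.

Lemma hol_rcons x s y : hol x (rcons s y) = hol x s * c (last x s) y.
Proof. by rewrite -cats1 hol_cat /= mulg1. Qed.

End OneCocycle.

(** The reversed path is produced before the group and the cocycle, so one reversal serves when two
    cocycles are compared. *)
Lemma path_rev A x s : x \in A -> path (adj A) x s ->
  exists t, [/\ path (adj A) (last x s) t, last (last x s) t = x &
    forall (H : groupType) (c : V -> V -> H), cocycle A c ->
      hol c (last x s) t = (hol c x s)^-1].
Proof.
elim: s x => [|y s IH] x xA /=.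
  by move=> _; exists [::]; split=> // H c _; rewrite /= invg1.
case/andP=> /and3P[_ yA exy] /(IH _ yA)[t [pt lt ht]].
exists (rcons t x); rewrite rcons_path last_rcons pt lt /= /adj xA yA e_sym exy.
by split=> // H c cA; rewrite hol_rcons lt ht// (cocycleV cA xA)// invgM.
Qed.

Definition edge_loop A v s := path (adj A) v s && (last v s == v).

(* The loops l freely generate the edge-path group at v: homomorphisms out of that
   group are the holonomies of cocycles. *)
Definition free_loops A v := exists (B : Type) (l : B -> seq V),
  [/\ forall b, edge_loop A v (l b),
      forall (H : groupType) (f : B -> H), exists c : V -> V -> H,
        cocycle A c /\ forall b, hol c v (l b) = f b
    & forall (H : groupType) (c c' : V -> V -> H),
        cocycle A c -> cocycle A c' ->
        (forall b, hol c v (l b) = hol c' v (l b)) ->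
        forall s, edge_loop A v s -> hol c v s = hol c' v s].

Definition pi1_free A := forall v, v \in A -> free_loops A v.

Lemma coboundary_hol (H : groupType) A (c : V -> V -> H) (g : V -> H) x s :
  (forall x y, x \in A -> y \in A -> e x y -> c x y = (g x)^-1 * g y) ->
  path (adj A) x s -> hol c x s = (g x)^-1 * g (last x s).
Proof.
move=> cg; elim: s x => [|y s IH] x /=; first by rewrite mulVg.
by case/andP=> /and3P[xA yA exy] /IH->; rewrite cg// !mulgA mulgK.
Qed.

(** A coboundary has trivial holonomy around loops, so the empty family is a basis. *)
Lemma acyclic_pi1_free A : acyclic A -> pi1_free A.
Proof.
move=> aA v vA; exists void, (fun b : void => match b with end); split=> [[]|H f|].
  by exists (fun _ _ => 1); split=> [x y z|[]]; rewrite ?mulg1.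
move=> H c c' /aA[g gP] /aA[g' gP'] _ s /andP[ps /eqP ls].
by rewrite (coboundary_hol gP ps) (coboundary_hol gP' ps) ls !mulVg.
Qed.

(** Extends a cocycle to a new vertex [x], the edge from [x] to [z] getting the label [h z]. The
    rule on a triangle [x y z] says precisely that [h] is a potential of [c] on the link. *)
Definition ext (H : groupType) (c : V -> V -> H) x (h : V -> H) y z : H :=
  if y == x then (if z == x then 1 else h z)
  else if z == x then (h y)^-1 else c y z.

Lemma ext_cocycle (H : groupType) A (c : V -> V -> H) x (h : V -> H) :
  (forall y z, y \in link A x -> z \in link A x -> e y z ->
     c y z = (h y)^-1 * h z) ->
  cocycle A c -> cocycle (x |: A) (ext c x h).
Proof.
move=> ch cA y z w; rewrite !in_setU1 /ext.
case: (eqVneq y x) => [yx|yx] /=; case: (eqVneq z x) => [zx|zx] /=;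
  case: (eqVneq w x) => [wx|wx] /= => yA zA wA;
  rewrite ?yx ?zx ?wx ?mulg1 ?mul1g ?mulgV ?mulVg// => eyz ezw eyw.
- by rewrite ch ?inE ?zA ?wA// mulKVg.
- by rewrite ch ?inE ?yA ?wA// e_sym.
- by rewrite ch ?inE ?yA ?zA ?(e_sym x) ?mulgK.
- exact: cA.
Qed.

Lemma trivial_on_link_ext (H : groupType) A (c : V -> V -> H) x :
  x \notin A -> trivial_on_link A x -> cocycle A c ->
  exists2 c', cocycle (x |: A) c' &
    forall y z, y \in A -> z \in A -> c' y z = c y z.
Proof.
move=> xA gA cA; have [h hP] := gA H c cA.
exists (ext c x h); first exact: ext_cocycle.
move=> y z yA zA; rewrite /ext; have [yx|_] := eqVneq y x.
  by rewrite -yx yA in xA.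
by have [zx|//] := eqVneq z x; rewrite -zx zA in xA.
Qed.

Lemma eq_hol (H : groupType) A (c c' : V -> V -> H) x s :
  (forall y z, y \in A -> z \in A -> c' y z = c y z) ->
  path (adj A) x s -> hol c' x s = hol c x s.
Proof.
move=> cc; elim: s x => //= y s IH x /andP[/and3P[xA yA _] /IH->].
by rewrite cc.
Qed.

(** For a potential [g] on [A], the element [g y * c y x] does not change along edges of the link;
    connectedness makes it a constant, which is the potential at [x]. *)
Lemma acyclic_attach A x :
  trivial_on_link A x -> conn (link A x) -> acyclic A -> acyclic (x |: A).
Proof.
move=> gA cL aA H c cxA.
have cA : cocycle A c by apply: cocycleS cxA; exact: subsetUr.
have xxA : x \in x |: A by exact: setU11.
have AxA y : y \in A -> y \in x |: A by exact: setU1r.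
have [g gP] := aA H c cA.
have kP y z : y \in link A x -> z \in link A x -> e y z ->
    g y * c y x = g z * c z x.
  rewrite !inE => /andP[yA exy] /andP[zA exz] eyz.
  rewrite -(cxA y z x (AxA _ yA) (AxA _ zA) xxA eyz) 1?[e _ x]e_sym//.
  by rewrite gP// !mulgA mulgV mul1g.
pose k : H := if [pick y in link A x] is Some y then g y * c y x else 1.
have kE y : y \in link A x -> g y * c y x = k.
  move=> yL; rewrite /k; case: pickP => [z zL|/(_ y)]; last by rewrite yL.
  exact: (conn_const cL kP).
have eK y : y \in A -> e x y -> c y x = (g y)^-1 * k.
  by move=> yA exy; rewrite -(kE y) ?inE ?yA// mulKg.
exists (fun y => if y \in A then g y else k) => y z.
rewrite !in_setU1; case yA: (y \in A); case zA: (z \in A); rewrite ?orbT ?orbF.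
- by move=> _ _; exact: gP.
- by move=> _ /eqP->; rewrite e_sym; exact: eK.
- move=> /eqP-> _ exz; rewrite (cocycleV cxA _ xxA) ?AxA// 1?e_sym//.
  by rewrite eK// invgM invgK.
- by move=> /eqP-> /eqP-> _; rewrite (cocycle1 cxA)// mulVg.
Qed.

Lemma acyclic_remove A x :
  x \notin A -> trivial_on_link A x -> acyclic (x |: A) -> acyclic A.
Proof.
move=> xA gA axA H c cA; have [c' c'xA cc'] := trivial_on_link_ext xA gA cA.
have [g gP] := axA H c' c'xA; exists g => y z yA zA eyz.
by rewrite -cc'// gP// setU1r.
Qed.

(** Conjugating all labels by one element gives a cocycle again; conjugation by the holonomy of a
    path from [v] to [w] relates holonomies at the two base points. *)
Lemma free_loops_base A v w :
  connect (adj A) v w -> v \in A -> free_loops A v -> free_loops A w.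
Proof.
case/connectP=> p pp -> vA [B [l [ll lE lU]]].
have [q [pq lq hq]] := path_rev vA pp.
have hl (H : groupType) (c : V -> V -> H) b : cocycle A c ->
    hol c (last v p) (q ++ l b ++ p) = (hol c v p)^-1 * hol c v (l b) * hol c v p.
  move=> cA; have /andP[_ /eqP lb] := ll b.
  by rewrite !hol_cat lq lb hq// mulgA.
exists B, (fun b => q ++ l b ++ p); split.
- move=> b; have /andP[pb /eqP lb] := ll b.
  by rewrite /edge_loop !cat_path !last_cat lq lb pq pb pp eqxx.
- move=> H f; have [c [cA cf]] := lE H f.
  exists (fun y z => (hol c v p) * c y z * (hol c v p)^-1).
  have hc u s : hol (fun y z => (hol c v p) * c y z * (hol c v p)^-1) u s =
     (hol c v p) * hol c u s * (hol c v p)^-1.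
    elim: s u => [|y s IH] u /=; first by rewrite mulg1 mulgV.
    by rewrite IH !mulgA mulgKV.
  split=> [y z u *|b]; first by rewrite !mulgA mulgKV -(mulgA _ (c y z)) cA.
  rewrite hc hl// cf.
  by rewrite !mulgA mulgV mul1g mulgK.
- move=> H c c' cA c'A cc' s /andP[ps /eqP ls].
  pose d := hol c v p; pose d' := hol c' v p.
  pose C (c : V -> V -> H) (d : H) := fun y z => d^-1 * c y z * d.
  have CA c0 d0 : cocycle A c0 -> cocycle A (C c0 d0).
    by move=> c0A y z u *; rewrite /C !mulgA mulgK -(mulgA _ (c0 y z)) c0A.
  have hC c0 d0 u t : hol (C c0 d0) u t = d0^-1 * hol c0 u t * d0.
    elim: t u => [|y t IH] u /=; first by rewrite mulg1 mulVg.
    by rewrite IH /C !mulgA mulgK.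
  have := lU H (C c d) (C c' d') (CA _ _ cA) (CA _ _ c'A).
  have E b : hol (C c d) v (l b) = hol (C c' d') v (l b).
    by have := cc' b; rewrite !hl// !hC.
  move/(_ E (p ++ s ++ q)).
  rewrite /edge_loop !cat_path !last_cat ls lq pp ps pq eqxx => /(_ isT).
  rewrite !hC !hol_cat ls (hq _ c)// (hq _ c')//.
  by rewrite -/d -/d' !mulgA !mulVg !mul1g !mulgKV.
Qed.

(** Telescoping over the triangles with apex [x]. *)
Lemma link_hol (H : groupType) A (c : V -> V -> H) x l q :
  cocycle (x |: A) c -> l \in link A x -> path (adj (link A x)) l q ->
  c x l * hol c l q = c x (last l q).
Proof.
move=> cA; elim: q l => [|y q IH] l lL /=; first by rewrite mulg1.
case/andP=> /and3P[_ yL ely] /(IH _ yL) <-; rewrite mulgA; congr (_ * _).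
move: lL yL; rewrite !inE => /andP[lA exl] /andP[yA exy].
by apply: cA; rewrite ?setU11 ?setU1r.
Qed.

Lemma link_subset A x : link A x \subset A.
Proof. by apply/subsetP=> y; rewrite inE => /andP[]. Qed.

(* A path through x is pushed off x along the link. *)
Lemma reroute A x w s u : x \notin A -> conn (link A x) -> w \in A ->
  path (adj (x |: A)) u s -> last u s = w ->
  (u \in A -> exists t, [/\ path (adj A) u t, last u t = w &
     forall (H : groupType) (c : V -> V -> H), cocycle (x |: A) c ->
       hol c u t = hol c u s]) /\
  (u = x -> forall l, l \in link A x ->
     exists t, [/\ path (adj A) l t, last l t = w &
     forall (H : groupType) (c : V -> V -> H), cocycle (x |: A) c ->
       c x l * hol c l t = hol c x s]).
Proof.
move=> xA cL wA; elim: s u => [|y s IH] u /=.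
  move=> _ ->; split=> [_|wx]; first by exists [::].
  by rewrite -wx wA in xA.
case/andP=> /and3P[uxA yxA euy] ps ls; have [IH1 IH2] := IH _ ps ls.
have xxA : x \in x |: A by exact: setU11.
split=> [uA|ux l lL].
  move: yxA; rewrite in_setU1 => /orP[/eqP yx|yA]; last first.
    have [t [pt lt ht]] := IH1 yA; exists (y :: t); rewrite /= pt lt.
    by split=> // [|H c cA]; [rewrite /adj uA yA euy|rewrite ht].
  have uL : u \in link A x by rewrite inE uA -yx e_sym.
  have [t [pt lt ht]] := IH2 yx u uL; exists t; split=> // H c cA.
  by rewrite yx -ht// (cocycleV cA xxA) ?mulKg// -yx e_sym.
move: yxA; rewrite in_setU1 => /orP[/eqP yx|yA].
  have [t [pt lt ht]] := IH2 yx l lL; exists t; split=> // H c cA.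
  by rewrite yx -ht// (cocycle1 cA)// mul1g.
have yL : y \in link A x by rewrite inE yA -ux.
have [t [pt lt ht]] := IH1 yA.
have /connectP[q pq lq] := cL l y lL yL.
exists (q ++ t); rewrite cat_path last_cat -lq pt lt andbT; split=> //.
  by apply: sub_path pq; exact: adjS (link_subset _ _).
move=> H c cA; rewrite hol_cat mulgA -lq ht//.
by rewrite (link_hol cA lL pq) -lq.
Qed.

(** The basis loops are pushed off [x] with unchanged holonomy, and cocycles on [A] extend over [x],
    so both halves of the universal property carry over. *)
Lemma pi1_free_remove A x : x \notin A -> trivial_on_link A x -> conn (link A x) ->
  pi1_free (x |: A) -> pi1_free A.
Proof.
move=> xA gA cL fA v vA.
have /fA[B [l [ll lE lU]]] : v \in x |: A by exact: setU1r.
have /choice[l' l'P] : forall b, exists t, edge_loop A v t /\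
    forall (H : groupType) (c : V -> V -> H), cocycle (x |: A) c ->
       hol c v t = hol c v (l b).
  move=> b; have /andP[pb /eqP lb] := ll b.
  have [/(_ vA)[t [pt lt ht]] _] := reroute xA cL vA pb lb.
  by exists t; rewrite /edge_loop pt lt eqxx.
exists B, l'; split=> [b|H f|H c c' cA c'A cc' s /andP[ps ls]].
- by have [] := l'P b.
- have [c [cA cf]] := lE H f; exists c; split.
    by apply: cocycleS cA; exact: subsetUr.
  by move=> b; rewrite (l'P b).2.
have [d dA dc] := trivial_on_link_ext xA gA cA.
have [d' d'A d'c] := trivial_on_link_ext xA gA c'A.
rewrite -(eq_hol dc ps) -(eq_hol d'c ps); apply: lU => // [b|].
  have [/andP[pb _] hb] := l'P b.
  by rewrite -(hb _ d)// -(hb _ d')// (eq_hol dc pb) (eq_hol d'c pb).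
rewrite /edge_loop ls andbT; apply: sub_path ps; apply: adjS; exact: subsetUr.
Qed.

Lemma path_avoid A x v s : ~~ connect (adj (x |: A)) x v ->
  path (adj (x |: A)) v s -> path (adj A) v s.
Proof.
elim: s v => //= y s IH v xv /andP[/[dup] vy /and3P[vA yA evy] ps].
have xy : ~~ connect (adj (x |: A)) x y.
  by rewrite -(same_connect_r (@adj_csym _) (connect1 vy)).
rewrite IH// andbT /adj evy andbT.
move: vA yA; rewrite !in_setU1 => /orP[/eqP vx|->].
  by rewrite vx connect0 in xv.
by case/orP=> [/eqP yx|//]; rewrite yx connect0 in xy.
Qed.

(** * Attaching one vertex to a complex with free edge-path groups *)

Section Attach.
Context (A : {set V}) (x : V).
Hypotheses (xA : x \notin A) (gA : trivial_on_link A x) (fA : pi1_free A).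
Let L := link A x.
Let LA : L \subset A := link_subset A x.
Let xxA : x \in x |: A := setU11 x A.

(* Canonical representatives of the components of the link, and a selected one
   of them in each component of A meeting the link. *)
Let rho l := fingraph.root (adj L) l.
Let kap u := [pick k | [&& k \in L, rho k == k & connect (adj A) k u]].

Let rhoP l : connect (adj L) l (rho l).
Proof. exact: connect_root. Qed.

Let rho_in l : l \in L -> rho l \in L.
Proof. by move=> lL; apply: connect_in lL; exact: rhoP. Qed.

Let rho_id l : rho (rho l) = rho l.
Proof. by apply: root_root; exact: adj_csym. Qed.

Let kap_eq u w : connect (adj A) u w -> kap u = kap w.
Proof.
move=> uw; apply: eq_pick => k; congr [&& _, _ & _].
exact: (same_connect_r (@adj_csym A) uw).
Qed.

Let kap_in u k : kap u = Some k ->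
  [/\ k \in L, rho k = k, connect (adj A) k u & kap k = Some k].
Proof.
move=> ku; have := ku; rewrite {1}/kap.
case: pickP => // k' /and3P[k'L /eqP k'r k'u] [kk]; rewrite -{}kk in ku *.
by split=> //; rewrite (kap_eq k'u).
Qed.

Let kap_some l : l \in L -> exists k, kap l = Some k.
Proof.
move=> lL; rewrite /kap; case: pickP => [k _|/(_ (rho l))]; first by exists k.
rewrite rho_in// rho_id eqxx adj_csym/=.
by rewrite (connectS LA (rhoP l)).
Qed.

Let exists_tau : exists tau : V -> seq V, forall u k, kap u = Some k ->
  path (adj A) k (tau u) /\ last k (tau u) = u.
Proof.
suff /choice[tau tauP] : forall u, exists t, forall k, kap u = Some k ->
  path (adj A) k t /\ last k t = u by exists tau.
move=> u; case E: (kap u) => [k|]; last by exists [::].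
have [_ _ /connectP[t pt ->] _] := kap_in E.
by exists t => _ [<-].
Qed.

(** The group at [x] is the free product of the groups of those components of [A] that meet the
    link, based at their selected representatives, and of a free group with one generator per
    unselected link component: leave [x] through the selected representative, follow [tau], return
    through the other one. *)
Let free_loops_attach_base : free_loops (x |: A) x.
Proof.
have [tau tauP] := exists_tau.
have /choice[Bl BlP] : forall k, exists Bl : {B : Type & B -> seq V}, k \in A ->
   [/\ forall b, edge_loop A k (projT2 Bl b),
      forall (H : groupType) (f : projT1 Bl -> H), exists c : V -> V -> H,
        cocycle A c /\ forall b, hol c k (projT2 Bl b) = f b
    & forall (H : groupType) (c c' : V -> V -> H),
        cocycle A c -> cocycle A c' ->
        (forall b, hol c k (projT2 Bl b) = hol c' k (projT2 Bl b)) ->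
        forall s, edge_loop A k s -> hol c k s = hol c' k s].
  move=> k; case kA: (k \in A); last first.
    by exists (existT (fun B : Type => B -> seq V) (void : Type)
      (fun b : void => match b with end)).
  by have [B [l lP]] := fA kA; exists (existT (fun B : Type => B -> seq V) B l) => _.
pose K := {k | kap k == Some k}.
pose N := {r | [&& r \in L, rho r == r & kap r != Some r]}.
(* The default is never met: every link vertex has a selected representative in its component of
   [A]. *)
pose base r := odflt x (kap r).
pose l (b : {k : K & projT1 (Bl (val k))} + N) : seq V :=
  match b with
  | inl b => val (projT1 b) :: rcons (projT2 (Bl (val (projT1 b))) (projT2 b)) x
  | inr r => base (val r) :: rcons (tau (val r)) x
  end.
have KA k : kap k = Some k -> k \in A.
  by case/kap_in=> kL _ _ _; exact: (subsetP LA).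
have Le k : k \in L -> e x k by rewrite inE => /andP[].
have pathA u s : path (adj A) u s -> path (adj (x |: A)) u s.
  by apply: sub_path; apply: adjS; exact: subsetUr.
have llP k s w : k \in L -> path (adj A) k s -> last k s = w -> w \in L ->
    edge_loop (x |: A) x (k :: rcons s x).
  move=> kL ps ls wL; rewrite /edge_loop /= last_rcons eqxx andbT rcons_path.
  rewrite ls (pathA _ _ ps) /adj xxA Le// e_sym Le//.
  by rewrite !setU1r// (subsetP LA).
exists ({k : K & projT1 (Bl (val k))} + N)%type, l; split.
- case=> [[[k /= /eqP kk] b]|[r /= /and3P[rL rr rk]]] /=.
    have [kL _ _ _] := kap_in kk.
    have [ll _ _] := BlP k (KA k kk); have /andP[pb /eqP lb] := ll b.
    exact: (llP _ _ _ kL pb lb kL).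
  have [k rk'] := kap_some rL; rewrite /base rk' /=.
  have [kL _ _ _] := kap_in rk'; have [pt lt] := tauP _ _ rk'.
  exact: (llP _ _ _ kL pt lt rL).
- move=> H f.
  have /choice[cs csP] : forall k, exists c : V -> V -> H, k \in A ->
      cocycle A c /\ forall (Hk : kap k == Some k) b,
        hol c k (projT2 (Bl k) b) = f (inl (existT _ (exist _ k Hk) b)).
    move=> k; case kA: (k \in A); last by exists (fun _ _ => 1).
    have [_ lE _] := BlP k kA.
    have /orP[kk|nk] := orbN (kap k == Some k); last first.
      have [c [cA _]] := lE H (fun => 1).
      by exists c => _; split=> // Hk; move: nk; rewrite Hk.
    have [c [cA cb]] := lE H (fun b => f (inl (existT _ (exist _ k kk) b))).
    exists c => _; split=> // Hk b; rewrite cb; congr (f (inl (existT _ (exist _ k _) b))).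
    exact: eq_irrelevance.
  (* Components of [A] share no edge, so their cocycles can be used side by side; components missing
     the link get trivial labels. *)
  pose c0 u w : H := if kap u is Some k then cs k u w else 1.
  have c0A : cocycle A c0.
    move=> u w z uA wA zA euw ewz euz; rewrite /c0.
    rewrite -(kap_eq (connect1 _ : connect (adj A) u w)); last exact/and3P.
    case E: (kap u) => [k|]; last by rewrite mulg1.
    have [_ _ _ /KA kA] := kap_in E; have [ck _] := csP k kA.
    exact: ck.
  have hol0 k u s : kap u = Some k -> path (adj A) u s ->
      hol c0 u s = hol (cs k) u s.
    elim: s u => //= w s IH u uk /andP[uw ps].
    by rewrite {1}/c0 uk IH// -(kap_eq (connect1 uw)).
  have [g gP] := gA c0A.
  (* On each link component the potential is free up to a left factor. It is made 1 at selected
     representatives; at the others it solves the equation that prescribes the holonomy of the new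
     generator. *)
  have /choice[h0 h0P] : forall r, exists h0 : H, (kap r = Some r -> h0 = 1) /\
      forall Hr : [&& r \in L, rho r == r & kap r != Some r],
        hol c0 (base r) (tau r) * h0^-1 = f (inr (exist _ r Hr)).
    move=> r.
    have /orP[Hr|nr] := orbN [&& r \in L, rho r == r & kap r != Some r]; last first.
      by exists 1; split=> // Hr'; move: nr; rewrite Hr'.
    exists ((f (inr (exist _ r Hr)))^-1 * hol c0 (base r) (tau r)); split.
      by move=> kr; have /and3P[_ _] := Hr; rewrite kr eqxx.
    move=> Hr'; rewrite invgM invgK mulKVg; congr (f (inr (exist _ r _))).
    exact: eq_irrelevance.
  pose h y := h0 (rho y) * (g (rho y))^-1 * g y.
  have hr r : rho r = r -> h r = h0 r by move=> rr; rewrite /h rr mulgKV.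
  have hP y z : y \in L -> z \in L -> e y z -> c0 y z = (h y)^-1 * h z.
    move=> yL zL eyz; rewrite gP// /h.
    have <- : rho y = rho z.
      by apply/(fingraph.rootP (@adj_csym _))/connect1/and3P.
    by rewrite !invgM !invgK !mulgA mulgKV mulgK.
  have hext u s : u \in A -> path (adj A) u s -> hol (ext c0 x h) u s = hol c0 u s.
    move=> uA ps; apply: (eq_hol _ ps) => y z yA zA; rewrite /ext.
    case: eqP => [yx|_]; first by move: xA; rewrite -yx yA.
    by case: eqP => // zx; move: xA; rewrite -zx zA.
  have extl k s w : k \in L -> path (adj A) k s -> last k s = w -> w \in L ->
      hol (ext c0 x h) x (k :: rcons s x) = h k * hol c0 k s * (h w)^-1.
    move=> kL ps ls wL /=; rewrite hol_rcons hext ?(subsetP LA)// ls.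
    have kx : k != x by apply: contraNneq xA => <-; exact: (subsetP LA).
    have wx : w != x by apply: contraNneq xA => <-; exact: (subsetP LA).
    by rewrite /ext !eqxx (negbTE kx) (negbTE wx) mulgA.
  exists (ext c0 x h); split; first exact: ext_cocycle.
  case=> [[[k /= Hk] b]|[r /= Hr]].
    have kk := eqP Hk; have [kL kr _ _] := kap_in kk; have kA := KA k kk.
    have [ll _ _] := BlP k kA; have /andP[pb /eqP lb] := ll b.
    have := extl _ _ _ kL pb lb kL; rewrite /= => ->; rewrite (hol0 k)//.
    by rewrite hr// (h0P k).1// invg1 mul1g mulg1 (csP k kA).2.
  have /and3P[rL /eqP rr rk] := Hr; have [_ hf] := h0P r.
  have [k rk'] := kap_some rL; have [pt lt] := tauP _ _ rk'.
  have [kL kr _ kk] := kap_in rk'.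
  rewrite -(hf Hr) /base rk' /=.
  have := extl _ _ _ kL pt lt rL; rewrite /= => ->.
  by rewrite (hr r)// (hr k)// (h0P k).1// mul1g.
move=> H c c' cA c'A cc' s /andP[ps /eqP ls].
have AsxA : A \subset x |: A by exact: subsetUr.
have cAA := cocycleS AsxA cA; have c'AA := cocycleS AsxA c'A.
have cV (d : V -> V -> H) k : cocycle (x |: A) d -> k \in L -> d k x = (d x k)^-1.
  move=> dA kL; apply: (cocycleV dA xxA) (Le _ kL).
  by rewrite setU1r// (subsetP LA).
(* Conjugating by the label from [x] to [k] turns loops through [x] into loops at [k], where
   uniqueness is known. *)
have loopK k t : kap k = Some k -> edge_loop A k t ->
    c x k * hol c k t * c k x = c' x k * hol c' k t * c' k x.
  move=> kk lt; have [kL kr _ _] := kap_in kk.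
  pose C (d : V -> V -> H) y z := d x k * d y z * (d x k)^-1.
  have CA d : cocycle A d -> cocycle A (C d).
    by move=> dA y z u *; rewrite /C !mulgA mulgKV -(mulgA _ (d y z)) dA.
  have hC d u q : hol (C d) u q = d x k * hol d u q * (d x k)^-1.
    elim: q u => [|y q IH] u /=; first by rewrite mulg1 mulgV.
    by rewrite IH /C !mulgA mulgKV.
  have [ll _ lU] := BlP k (KA k kk).
  rewrite (cV c)// (cV c')// -!hC; apply: lU => //; [exact: CA|exact: CA|].
  move=> b; have := cc' (inl (existT _ (exist _ k (introT eqP kk)) b)).
  have /andP[_ /eqP lb] := ll b.
  by rewrite /= !hol_rcons lb !hC (cV c)// (cV c')// !mulgA.
(* For each link vertex one return route is exhibited: along a new generator to the representative
   of its link component, then inside the link. *)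
have linkP w k : w \in L -> kap w = Some k -> exists t,
    [/\ path (adj A) k t, last k t = w &
      c x k * hol c k t * c w x = c' x k * hol c' k t * c' w x].
  move=> wL wk; have [kL kr kw kk] := kap_in wk.
  have rL := rho_in wL.
  have rk : kap (rho w) = Some k by rewrite -(kap_eq (connectS LA (rhoP w))).
  have [t [pt lt ht]] : exists t, [/\ path (adj A) k t, last k t = rho w &
      c x k * hol c k t * c (rho w) x = c' x k * hol c' k t * c' (rho w) x].
    have [kw'|kw'] := eqVneq k (rho w).
      exists [::]; split=> //=; rewrite -kw' !mulg1.
      by rewrite (cV c)// (cV c')// !mulgV.
    have Hr : [&& rho w \in L, rho (rho w) == rho w & kap (rho w) != Some (rho w)].
      rewrite rL rho_id eqxx rk /=.
      by apply: contraNneq kw' => -[->].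
    have [pt lt] := tauP _ _ rk; exists (tau (rho w)); split=> //.
    have := cc' (inr (exist _ (rho w) Hr : N)).
    by rewrite /l /base rk /= !hol_rcons lt !mulgA.
  have : connect (adj L) (rho w) w by rewrite adj_csym.
  case/connectP=> q pq lq.
  have pq' := sub_path (adjS LA) pq.
  exists (t ++ q); rewrite cat_path last_cat lt pt -lq; split=> //.
  have lh (d : V -> V -> H) : cocycle (x |: A) d ->
      d x k * hol d k (t ++ q) * d w x = d x k * hol d k t * d (rho w) x.
    move=> dA; rewrite hol_cat lt (cV d w)// {2}lq -(link_hol dA rL pq).
    by rewrite invgM (cV d (rho w))// !mulgA mulgK.
  by rewrite !lh.
have anyP w k t : w \in L -> kap w = Some k -> path (adj A) k t ->
    last k t = w -> c x k * hol c k t * c w x = c' x k * hol c' k t * c' w x.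
  move=> wL wk pt lt; have [q [pq lq hq]] := linkP w k wL wk.
  have [kL kr kw kk] := kap_in wk; have kA := KA k kk.
  have [q' [pq' lq' hq']] := path_rev kA pq.
  have := loopK k (t ++ q') kk.
  rewrite /edge_loop cat_path last_cat lt -{1 2}lq pt pq' lq' eqxx => /(_ isT).
  move=> /(congr1 (fun z : H => z * (c x k * hol c k q * c w x))).
  rewrite {2}hq !hol_cat lt -lq hq' // hq'//.
  rewrite (cV c k)// (cV c' k)// !mulgA !mulgKV.
  by rewrite lq.
(* Invariant for a prefix that ends in [A]: closed up by any path back to the selected
   representative and then by the edge to [x], it has the same holonomy for both cocycles. *)
have agree p : path (adj (x |: A)) x p ->
    (last x p = x -> hol c x p = hol c' x p) /\
    (last x p \in A -> forall k t, kap (last x p) = Some k ->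
       path (adj A) k t -> last k t = last x p ->
       hol c x p * (hol c k t)^-1 * (c x k)^-1 =
       hol c' x p * (hol c' k t)^-1 * (c' x k)^-1).
  elim/last_ind: p => [|p y IH]; first by split=> //= xA'; move: xA; rewrite xA'.
  rewrite rcons_path last_rcons => /andP[/IH[IH1 IH2] /and3P[wA yA ewy]].
  move: IH1 IH2 wA ewy; set w := last x p => IH1 IH2 wA ewy.
  rewrite !hol_rcons -/w; split=> [yx|{}yA k t yk pt lt].
    rewrite yx in ewy *; move: wA; rewrite in_setU1 => /orP[/eqP wx|wA].
      by rewrite IH1// wx (cocycle1 cA)// (cocycle1 c'A)// !mulg1.
    have wL : w \in L by rewrite inE wA e_sym.
    have [k wk] := kap_some wL; have [t [pt lt ht]] := linkP w k wL wk.
    have := IH2 wA k t wk pt lt.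
    move=> /(congr1 (fun z : H => z * (c x k * hol c k t * c w x))).
    by rewrite {2}ht !mulgA !mulgKV.
  have [kL kr ky kk] := kap_in yk; have kA := KA k kk.
  move: wA; rewrite in_setU1 => /orP[/eqP wx|wA].
    have yL : y \in L by rewrite inE yA -wx.
    have := anyP y k t yL yk pt lt; rewrite (cV c y)// (cV c' y)//.
    move/(congr1 (fun z : H => z^-1)); rewrite !invgM !invgK !mulgA => E.
    by rewrite IH1// wx -!mulgA; congr (_ * _); rewrite !mulgA.
  have ywA : adj A y w by rewrite /adj yA wA e_sym.
  have wk : kap w = Some k by rewrite -(kap_eq (connect1 ywA)).
  have := IH2 wA k (rcons t w) wk; rewrite rcons_path last_rcons pt lt.
  move=> /(_ ywA erefl); rewrite !hol_rcons lt !invgM.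
  by rewrite (cocycleV cAA wA)// (cocycleV c'AA wA)// !invgK !mulgA.
have [agr _] := agree s ps; exact: agr.
Qed.

(** In the component of [x] the base point is moved to [x]. Loops in the other components never meet
    [x], and their cocycles extend over it. *)
Lemma pi1_free_attach : pi1_free (x |: A).
Proof.
move=> v vxA; have [xv|xv] := boolP (connect (adj (x |: A)) x v).
  exact: free_loops_base xv xxA free_loops_attach_base.
have vA : v \in A.
  by move: vxA; rewrite in_setU1 => /orP[/eqP vx|//]; rewrite vx connect0 in xv.
have [B [l [ll lE lU]]] := fA vA.
exists B, l; split=> [b|H f|H c c' cA c'A cc' s /andP[ps ls]].
- have /andP[pb lb] := ll b; rewrite /edge_loop lb andbT.
  by apply: sub_path pb; apply: adjS; exact: subsetUr.
- have [c [cA cf]] := lE H f; have [d dA dc] := trivial_on_link_ext xA gA cA.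
  exists d; split=> // b; have /andP[pb _] := ll b.
  by rewrite (eq_hol dc pb).
apply: lU => //; [by apply: cocycleS cA; exact: subsetUr|..].
  by apply: cocycleS c'A; exact: subsetUr.
by rewrite /edge_loop ls (path_avoid xv).
Qed.

End Attach.

(** * Cones, joins and ordered attachment of vertices *)

Lemma acyclic_trivial_on_link A x : acyclic (link A x) -> trivial_on_link A x.
Proof. by move=> aL H c cA; apply: aL; apply: cocycleS cA; exact: link_subset. Qed.

Lemma cone_acyclic A a : a \in A -> (forall y, y \in A -> e a y) -> acyclic A.
Proof.
move=> aA ea H c cA; exists (c a) => x y xA yA exy.
by rewrite -(cA a x y) ?mulKg ?ea.
Qed.

(** The cone point may lie outside the link: the labels from [a] are a potential because cocycles on
    all of [A] are tested. *)
Lemma cone_trivial_on_link A x a : a \in A -> (forall y, y \in link A x -> e a y) ->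
  trivial_on_link A x.
Proof.
move=> aA ea H c cA; exists (c a) => y z yL zL eyz.
have /subsetP LA := link_subset A x.
by rewrite -(cA a y z) ?mulKg// ?LA ?ea.
Qed.

Lemma discrete_trivial_on_link A x :
  (forall y z, y \in link A x -> z \in link A x -> e y z -> y = z) -> trivial_on_link A x.
Proof.
move=> dL H c cA; exists (fun => 1) => y z yL zL eyz.
have yA : y \in A by exact: (subsetP (link_subset A x)).
by rewrite -(dL y z)// (cocycle1 cA)// invg1 mulg1.
Qed.

Lemma cone_conn A a : a \in A -> (forall y, y \in A -> e a y) -> conn A.
Proof.
move=> aA ea; apply: connI => k kP x y xA yA.
by rewrite -(kP a x) ?ea// (kP a y) ?ea.
Qed.

Lemma join_conn A B a b : a \in A -> b \in B ->
  (forall x y, x \in A -> y \in B -> e x y) -> conn (A :|: B).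
Proof.
move=> aA bB eAB; apply: connI => k kP.
have kAB x y : x \in A -> y \in B -> k x = k y.
  by move=> xA yB; rewrite (kP x y) ?inE ?xA ?yB ?orbT ?eAB.
suff kb x : x \in A :|: B -> k x = k b by move=> x y /kb-> /kb->.
by rewrite inE => /orP[xA|xB]; [exact: kAB|rewrite -(kAB a)// (kAB a b)].
Qed.

(** For [z] in [B], the element [c b x * c x z] does not depend on [x] in the connected part [A].
    This is a potential on [B] that fits with [c b] on [A]. *)
Lemma join_acyclic A B a b : a \in A -> b \in B -> conn A ->
  (forall x y, x \in A -> y \in B -> e x y) -> acyclic (A :|: B).
Proof.
move=> aA bB cA eAB H c cAB.
have inA x : x \in A -> x \in A :|: B by move=> xA; rewrite inE xA.
have inB x : x \in B -> x \in A :|: B by move=> xB; rewrite inE xB orbT.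
have eBA x y : x \in B -> y \in A -> e x y by move=> xB yA; rewrite e_sym eAB.
have bA x y : x \in A -> y \in A -> e x y -> c b x * c x y = c b y.
  move=> xA yA exy; apply: cAB => //.
  - exact: inB.
  - exact: inA.
  - exact: inA.
  - exact: eBA.
  - exact: eBA.
have aB x y : x \in B -> y \in B -> e x y -> c a x * c x y = c a y.
  move=> xB yB exy; apply: cAB => //.
  - exact: inA.
  - exact: inB.
  - exact: inB.
  - exact: eAB.
  - exact: eAB.
have kP z : z \in B -> forall x, x \in A -> c b x * c x z = c b a * c a z.
  move=> zB x xA; apply: (conn_const (k := fun x => c b x * c x z)) cA _ _ _ xA aA.
  move=> x1 x2 x1A x2A e12; rewrite -(bA x1 x2)// -mulgA.
  by rewrite (cAB x1 x2 z (inA _ x1A) (inA _ x2A) (inB _ zB) e12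
    (eAB _ _ x2A zB) (eAB _ _ x1A zB)).
exists (fun x => if x \in A then c b x else c b a * c a x) => x y.
rewrite !inE; case xA: (x \in A); case yA: (y \in A) => /=.
- by move=> _ _ exy; rewrite -(bA x y)// mulKg.
- by move=> _ yB _; rewrite -(kP y yB x xA) mulKg.
- move=> xB _ exy; rewrite -(kP x xB y yA) invgM.
  by rewrite (cocycleV cAB (inA _ yA) (inB _ xB)) ?mulgKV// e_sym.
- by move=> xB yB exy; rewrite -(aB x y)// invgM -!mulgA mulKg mulKg.
Qed.

(** Vertices enter by increasing [rk]. Distinct ones of equal rank are not adjacent, so at its turn
    a vertex sees only [A] and the vertices of smaller rank. *)
Lemma attach_all (Q : {set V} -> Prop) (rk : V -> nat) A D :
  (forall x, x \in D -> x \notin A) ->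
  (forall x y, x \in D -> y \in D -> e x y -> rk x = rk y -> x = y) ->
  (forall x (S : {set V}), x \in D -> A \subset S -> S \subset A :|: D -> x \notin S ->
     link S x = link (A :|: [set y in D | rk y < rk x]) x -> Q S -> Q (x |: S)) ->
  Q A -> Q (A :|: D).
Proof.
move=> + + + QA; elim: {D}#|D| {-2}D (leqnn #|D|) => [|n IH] D nD DA Drk DQ.
  by move: nD; rewrite leqn0 cards_eq0 => /eqP->; rewrite setU0.
have [->|[x0 x0D]] := set_0Vmem D; first by rewrite setU0.
pose x := [arg max_(y > x0 in D) rk y].
have [xD xmax] : x \in D /\ forall y, y \in D -> rk y <= rk x.
  by rewrite /x; case: arg_maxnP.
have DE : A :|: D = x |: (A :|: D :\ x) by rewrite setUCA setD1K.
have DxD : D :\ x \subset D by exact: subD1set.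
rewrite DE; apply: (DQ x) => //.
- exact: subsetUl.
- exact: setUS.
- by rewrite !inE eqxx orbF DA.
- apply/setP=> y; rewrite !inE; case exy: (e x y); rewrite ?andbF ?andbT//.
  congr (_ || _); have [->|yx] := eqVneq y x; first by rewrite ltnn andbF.
  case yD: (y \in D) => //=; rewrite ltn_neqAle xmax// andbT; apply/esym.
  by apply: contra_neq yx => /esym rxy; rewrite (Drk x y).
apply: IH => //.
- by rewrite (cardsD1 x) xD in nD.
- by move=> y /(subsetP DxD); exact: DA.
- by move=> y z /(subsetP DxD) yD /(subsetP DxD); exact: Drk.
move=> y S yDx AS SD yS lS QS; have yD := subsetP DxD _ yDx.
apply: (DQ y) => //; first by apply: subset_trans SD _; exact: setUS.
rewrite lS; apply/setP=> z; rewrite !inE; congr ((_ || _) && _).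
by have [->|//] := eqVneq z x; rewrite ltnNge xmax//= andbF.
Qed.

(** Vertices leave by increasing [rk], so the one being deleted still sees [A] and exactly the
    vertices of larger rank. *)
Lemma remove_all (Q : {set V} -> Prop) (rk : V -> nat) A D :
  (forall x, x \in D -> x \notin A) ->
  (forall x y, x \in D -> y \in D -> e x y -> rk x = rk y -> x = y) ->
  (forall x (S : {set V}), x \in D -> A \subset S -> S \subset A :|: D -> x \notin S ->
     link S x = link (A :|: [set y in D | rk x < rk y]) x -> Q (x |: S) -> Q S) ->
  Q (A :|: D) -> Q A.
Proof.
elim: {D}#|D| {-2}D (leqnn #|D|) => [|n IH] D nD DA Drk DQ.
  by move: nD; rewrite leqn0 cards_eq0 => /eqP->; rewrite setU0.
have [->|[x0 x0D]] := set_0Vmem D; first by rewrite setU0.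
pose x := [arg min_(y < x0 in D) rk y].
have [xD xmin] : x \in D /\ forall y, y \in D -> rk x <= rk y.
  by rewrite /x; case: arg_minnP.
have DE : A :|: D = x |: (A :|: D :\ x) by rewrite setUCA setD1K.
have DxD : D :\ x \subset D by exact: subD1set.
rewrite DE => QD; apply: (IH (D :\ x)).
- by rewrite (cardsD1 x) xD in nD.
- by move=> y /(subsetP DxD); exact: DA.
- by move=> y z /(subsetP DxD) yD /(subsetP DxD); exact: Drk.
- move=> y S yDx AS SD yS lS QS; have yD := subsetP DxD _ yDx.
  apply: (DQ y) => //; first by apply: subset_trans SD _; exact: setUS.
  rewrite lS; apply/setP=> z; rewrite !inE; congr ((_ || _) && _).
  by have [->|//] := eqVneq z x; rewrite ltnNge xmin//= andbF.
apply: (DQ x) => //.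
- exact: subsetUl.
- exact: setUS.
- by rewrite !inE eqxx orbF DA.
apply/setP=> y; rewrite !inE; case exy: (e x y); rewrite ?andbF ?andbT//.
congr (_ || _); have [->|yx] := eqVneq y x; first by rewrite ltnn andbF.
case yD: (y \in D) => //=; rewrite ltn_neqAle xmin// andbT; apply/esym.
by apply: contra_neq yx => rxy; rewrite (Drk x y).
Qed.

End Cocycles.

End Clique.

(** * Gluing along a poset map *)

Section PosetMap.
Local Open Scope group_scope.

Section Transport.
Context (U V : finType) (eU : rel U) (eV : rel V) (j : U -> V).

Lemma conn_imset (A : {set U}) : (forall x y, eU x y -> eV (j x) (j y)) ->
  conn eU A -> conn eV (j @: A).
Proof.
move=> ej cA _ _ /imsetP[x xA ->] /imsetP[y yA ->].
have /connectP[s + ->] := cA x y xA yA.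
elim: s x {xA} => //= z s IH x /andP[/and3P[xA zA xz] /IH].
apply: connect_trans; apply: connect1.
by rewrite /adj !imset_f// ej.
Qed.

Lemma acyclic_imset (h : V -> U) (A : {set U}) : {in A, cancel j h} ->
  {in A &, forall x y, eV (j x) (j y) = eU x y} ->
  acyclic eU A -> acyclic eV (j @: A).
Proof.
move=> jh ej aA H c cA.
have [|g gP] := aA H (fun x y => c (j x) (j y)).
  by move=> x y z xA yA zA xy yz xz; apply: cA; rewrite ?imset_f ?ej.
exists (g \o h) => _ _ /imsetP[x xA ->] /imsetP[y yA ->].
by rewrite /= !jh// ej// => xy; exact: gP.
Qed.

Lemma pi1_free_imset : injective j -> (forall x y, eV (j x) (j y) = eU x y) ->
  pi1_free eV (j @: [set: U]) -> pi1_free eU [set: U].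
Proof.
move=> j_inj ej fV v _; have jT x : j x \in j @: [set: U] by rewrite imset_f.
have [B [l [ll lE lU]]] := fV (j v) (jT v).
have jP x s : path (adj eV (j @: [set: U])) (j x) s ->
    exists2 t, s = map j t & path (adj eU [set: U]) x t.
  elim: s x => [|z s IH] x /=; first by exists [::].
  case/andP=> /and3P[_ /imsetP[y _ ->] xy] /IH[t -> pt].
  by exists (y :: t) => //=; rewrite pt /adj !inE -ej xy.
have pj x t : path (adj eU [set: U]) x t ->
    path (adj eV (j @: [set: U])) (j x) (map j t).
  rewrite path_map; apply: sub_path => y z /and3P[_ _ yz].
  by rewrite /= /adj !jT ej.
have /choice[l' l'P] : forall b, exists t, l b = map j t /\
    edge_loop eU [set: U] v t.
  move=> b; have /andP[/jP[t lt pt] /eqP lb] := ll b; exists t; split=> //.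
  by rewrite /edge_loop pt; apply/eqP/j_inj; rewrite -last_map -lt.
(* A left inverse of [j]; off the image the base point is a dummy value. *)
pose h y := odflt v [pick x | j x == y].
have jK : cancel j h.
  move=> x; rewrite /h; case: pickP => [z /eqP/j_inj//|/(_ x)].
  by rewrite eqxx.
have holj (H : groupType) (c : V -> V -> H) x t :
    hol (fun x y => c (j x) (j y)) x t = hol c (j x) (map j t).
  by elim: t x => //= y t IH x; rewrite IH.
have holh (H : groupType) (c : U -> U -> H) x t :
    hol (fun x y => c (h x) (h y)) (j x) (map j t) = hol c x t.
  by elim: t x => //= y t IH x; rewrite IH !jK.
have ch (H : groupType) (c : U -> U -> H) : cocycle eU [set: U] c ->
    cocycle eV (j @: [set: U]) (fun x y => c (h x) (h y)).
  move=> cU _ _ _ /imsetP[x _ ->] /imsetP[y _ ->] /imsetP[z _ ->].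
  by rewrite !ej !jK; apply: cU; rewrite inE.
exists B, l'; split=> [b|H f|H c c' cU c'U cc' s /andP[ps /eqP ls]].
- by have [] := l'P b.
- have [c [cV cf]] := lE H f; exists (fun x y => c (j x) (j y)); split=> [|b].
    by move=> x y z _ _ _ xy yz xz; apply: cV; rewrite ?jT ?ej.
  by rewrite holj -(l'P b).1.
have := lU H _ _ (ch _ _ cU) (ch _ _ c'U).
have E b : hol (fun x y => c (h x) (h y)) (j v) (l b) =
    hol (fun x y => c' (h x) (h y)) (j v) (l b).
  by rewrite (l'P b).1 !holh.
by move=> /(_ E (map j s)); rewrite /edge_loop pj// last_map ls eqxx !holh; exact.
Qed.

End Transport.

Section Fibration.
Context (U W : finType) (leU : rel U) (leW : rel W).
Hypothesis (leU_refl : reflexive leU).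
Hypotheses (leW_refl : reflexive leW) (leW_trans : transitive leW).
Context (X : {set U}) (Y : {set W}) (f : U -> W) (rU : U -> nat) (rW : W -> nat)
  (s : W -> U).

Definition cmp (T : Type) (le : rel T) : rel T := fun x y => le x y || le y x.

Lemma cmp_refl (T : Type) (le : rel T) : reflexive le -> reflexive (cmp le).
Proof. by move=> ler x; rewrite /cmp ler. Qed.

Lemma cmp_sym (T : Type) (le : rel T) : symmetric (cmp le).
Proof. by move=> x y; rewrite /cmp orbC. Qed.

Hypotheses
  (fX : forall a, a \in X -> f a \in Y)
  (f_mono : forall a b, a \in X -> b \in X -> leU a b -> leW (f a) (f b))
  (rf : forall a, a \in X -> rW (f a) = rU a)
  (rU_mono : forall a b, a \in X -> b \in X -> leU a b -> rU a <= rU b)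
  (rU_inj : forall a b, a \in X -> b \in X -> leU a b -> rU a = rU b -> a = b)
  (rW_mono : forall y z, y \in Y -> z \in Y -> leW y z -> rW y <= rW z)
  (rW_inj : forall y z, y \in Y -> z \in Y -> leW y z -> rW y = rW z -> y = z)
  (rW_gt0 : forall y, y \in Y -> 0 < rW y)
  (sY : forall y, y \in Y -> s y \in X /\ f (s y) = y).

Definition fibre y := [set a in X | leW (f a) y].

Definition above (A : {set W}) y := [set z in A | leW y z & z != y].

(** The section [s] need not be monotone. If [y] lies strictly below [z], both [s y] and [s z] are
    in the connected fibre over [z]; a rank-one element has something above it, so its fibre is
    absorbed in such a fibre too. *)
Lemma fibration_conn :
  (forall y, y \in Y -> 1 < rW y -> conn (cmp leU) (fibre y)) ->
  (forall y, y \in Y -> rW y = 1%N -> above Y y != set0) ->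
  conn (cmp leW) Y -> conn (cmp leU) X.
Proof.
move=> cF aY cY; apply: connI => [|k kP]; first exact: cmp_sym.
have kF y a b : y \in Y -> 1 < rW y -> a \in fibre y -> b \in fibre y -> k a = k b.
  move=> yY y1 aF bF; apply: (conn_const (cF y yY y1)) => // a' b'.
  by rewrite !inE => /andP[a'X _] /andP[b'X _]; exact: kP.
have sF y z : y \in Y -> leW y z -> s y \in fibre z.
  by move=> yY yz; rewrite inE; have [-> ->] := sY yY.
have ks a : a \in X -> k a = k (s (f a)).
  move=> aX; have faY := fX aX.
  have [r1|r1] := eqVneq (rW (f a)) 1%N.
    have /set0Pn[z] := aY _ faY r1; rewrite inE => /and3P[zY az zna].
    apply: (kF z) => //; rewrite ?sF ?inE ?aX//.
    rewrite ltn_neqAle rW_gt0// andbT; apply: contra zna => /eqP z1.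
    by apply/eqP/esym/rW_inj => //; rewrite r1.
  apply: (kF (f a)) => //; rewrite ?sF ?inE ?aX ?leW_refl//.
  by rewrite ltn_neqAle eq_sym r1 rW_gt0.
have kY y z : y \in Y -> z \in Y -> leW y z -> k (s y) = k (s z).
  move=> yY zY yz; have [->//|yNz] := eqVneq y z.
  apply: (kF z) => //; rewrite ?sF//.
  rewrite (leq_trans (_ : 1 < (rW y).+1))// ?ltnS ?rW_gt0//.
  rewrite ltn_neqAle rW_mono// andbT; apply: contra yNz => /eqP yz'.
  by apply/eqP/rW_inj.
move=> a b aX bX; rewrite ks// (ks b)//.
apply: (conn_const cY (k := fun y => k (s y))) => [y z yY zY||]; rewrite ?fX//.
by case/orP=> ?; [exact: kY|exact/esym/kY].
Qed.

(* Comparability in the mapping cylinder of f, in which a <= f a. *)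
Definition glue_rel : rel (U + W) := fun x y =>
  match x, y with
  | inl a, inl b => cmp leU a b
  | inr y, inr z => cmp leW y z
  | inl a, inr y | inr y, inl a => leW (f a) y
  end.

Lemma glue_refl : reflexive glue_rel.
Proof. by case=> x /=; exact: cmp_refl. Qed.

Lemma glue_sym : symmetric glue_rel.
Proof. by case=> x [] y //=; exact: cmp_sym. Qed.

(* Z is a set of maximal elements of rank two; over these the fibres need not be
   simply connected. *)
Context (Z : {set W}) (Q : {set U + W} -> Prop) (att : {set U + W} -> Prop).
Let Y' := Y :\: Z.
(** One chosen lift per rank-one element of [Y]. Together with [high] these vertices form a copy of
    [Y'], the starting point of the passage to [X]. *)
Let low := inl @: (s @: [set y in Y | rW y == 1%N]) : {set U + W}.
Let high := inr @: [set y in Y' | 1 < rW y] : {set U + W}.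

(** The predicate [att] is the extra demand on links of attached vertices. It will be connectedness
    when [Q] is simple connectivity, and no demand at all when [Q] is freeness. *)
Hypotheses
  (Z2 : forall z, z \in Z -> z \in Y /\ rW z = 2)
  (Zmax : forall z y, z \in Z -> y \in Y -> leW z y -> y = z)
  (Q_attach : forall (A : {set U + W}) x, x \notin A -> trivial_on_link glue_rel A x ->
     att (link glue_rel A x) -> Q A -> Q (x |: A))
  (Q_remove : forall (A : {set U + W}) x, x \notin A -> trivial_on_link glue_rel A x ->
     conn glue_rel (link glue_rel A x) -> Q (x |: A) -> Q A)
  (att_cone : forall (A : {set U + W}) x, x \in A ->
     (forall y, y \in A -> glue_rel x y) -> att A)
  (att_low : forall y, y \in Y -> rW y = 1%N -> att (inr @: above Y' y))
  (att_Z : forall a, a \in X -> f a \in Z ->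
     att (inl @: [set b in X | leU b a & b != a]))
  (fib : forall y, y \in Y' -> 1 < rW y ->
     conn (cmp leU) (fibre y) /\
     (acyclic (cmp leU) (fibre y) \/ above Y' y != set0)).

Let rk (x : U + W) := match x with inl a => rU a | inr y => rW y end.

Let highE y : (inr y \in high) = (y \in Y') && (1 < rW y).
Proof. by rewrite mem_imset ?inE//; exact: inr_inj. Qed.

Let highF a : (inl a \in high) = false.
Proof. by apply/imsetP => -[]. Qed.

Let inlE (A : {set U}) a : ((inl a : U + W) \in inl @: A) = (a \in A).
Proof. by rewrite mem_imset//; exact: inl_inj. Qed.

Let inlF (A : {set U}) y : ((inr y : U + W) \in inl @: A) = false.
Proof. by apply/imsetP => -[]. Qed.

Let inrF (A : {set W}) a : ((inl a : U + W) \in inr @: A) = false.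
Proof. by apply/imsetP => -[]. Qed.

Let inrE (A : {set W}) y : ((inr y : U + W) \in inr @: A) = (y \in A).
Proof. by rewrite mem_imset//; exact: inr_inj. Qed.

Let Y'Y y : y \in Y' -> y \in Y.
Proof. by rewrite inE => /andP[]. Qed.

Let rW_lt y z : y \in Y -> z \in Y -> leW y z -> z != y -> rW y < rW z.
Proof.
move=> yY zY yz zy; rewrite ltn_neqAle rW_mono// andbT.
by apply: contra zy => /eqP rr; apply/eqP/esym/rW_inj.
Qed.

(** Replacing a rank-one [y] by [s y] keeps all comparabilities: above it the relation is read
    through [f (s y) = y], and comparable elements of rank one are equal. *)
Lemma glue_base_acyclic : acyclic (cmp leW) Y' -> acyclic glue_rel (low :|: high).
Proof.
pose j y : U + W := if rW y == 1%N then inl (s y) else inr y.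
pose h (x : U + W) := match x with inl a => f a | inr y => y end.
have high1 y : y \in Y' -> rW y != 1%N -> 1 < rW y.
  by move=> /Y'Y yY y1; rewrite ltn_neqAle eq_sym y1 rW_gt0.
suff <- : j @: Y' = low :|: high.
  apply: (acyclic_imset (h := h)) => [y /Y'Y yY|y z yY' zY'].
    by rewrite /j; case: ifP => //= _; have [_ ->] := sY yY.
  have yY := Y'Y yY'; have zY := Y'Y zY'; have [sy fy] := sY yY.
  have [sz fz] := sY zY; rewrite /j.
  have no u v : u \in Y' -> v \in Y' -> rW u = 1%N -> rW v != 1%N -> leW v u = false.
    move=> uY' vY' u1 v1; apply/negP => /(rW_mono (Y'Y vY') (Y'Y uY')).
    by rewrite u1 leqNgt high1.
  case: eqP => [y1|/eqP y1]; case: eqP => [z1|/eqP z1] //=.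
  - apply/idP/idP; first by case/orP => /f_mono; rewrite fy fz /cmp => ->; rewrite ?orbT.
    case/orP=> yz; last by rewrite (rW_inj zY yY yz) ?y1// cmp_refl.
    by rewrite (rW_inj yY zY yz) ?y1// cmp_refl.
  - by rewrite fy /cmp (no y z)// orbF.
  - by rewrite fz /cmp (no z y).
apply/setP=> -[a|y]; rewrite in_setU ?highF ?highE ?orbF.
  rewrite inlE; apply/imsetP/imsetP => -[y].
    by rewrite /j => yY'; case: eqP => // /eqP y1 [->]; exists y; rewrite // inE Y'Y.
  rewrite inE => /andP[yY y1] ->; exists y; last by rewrite /j y1.
  by rewrite inE yY andbT; apply/negP => /Z2[_ y2]; rewrite y2 in y1.
rewrite inlF; apply/imsetP/andP => [[z zY']|[yY' y1]].
  by rewrite /j; case: eqP => // /eqP z1 [->]; rewrite high1.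
by exists y; rewrite // /j gtn_eqF.
Qed.

(** Each further point of a rank-one fibre sees the same part of [Y'] as the chosen lift.
    Disconnected upper intervals create free generators here. *)
Let attach_low : Q (low :|: high) ->
  Q (inl @: [set a in X | rU a == 1%N] :|: high).
Proof.
pose D := inl @: ([set a in X | rU a == 1%N] :\: s @: [set y in Y | rW y == 1%N])
  : {set U + W}.
have -> : inl @: [set a in X | rU a == 1%N] :|: high = (low :|: high) :|: D.
  apply/setP=> -[a|y]; rewrite !in_setU ?inlE ?highF ?inlF ?orbF//.
  rewrite in_setD; case: imsetP => //= -[y]; rewrite inE => /andP[yY /eqP y1] ->.
  by rewrite inE; have [sX fs] := sY yY; rewrite sX -rf// fs y1 eqxx.
apply: (attach_all (e := glue_rel) (rk := fun=> 0)).
- move=> [a|y]; rewrite !in_setU ?inlE ?highF ?inlF ?orbF//.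
  by rewrite inE => /andP[].
- move=> [a|y] [b|z]; rewrite ?inlE ?inlF// !inE.
  move=> /and3P[_ aX /eqP a1] /and3P[_ bX /eqP b1] /orP[] ab _; congr inl.
    by apply: rU_inj; rewrite ?a1.
  by apply/esym/rU_inj; rewrite ?a1.
move=> [a|y] S; rewrite ?inlF// inlE !inE => /and3P[sa aX /eqP a1] AS SD aS linkE.
have faY := fX aX; have r1 : rW (f a) = 1%N by rewrite rf.
have {}linkE : link glue_rel S (inl a) = inr @: above Y' (f a).
  rewrite linkE; apply/setP=> -[b|y].
    rewrite !inE highF [inl b \in low]inlE ltnn andbF !orbF inrF /=.
    apply/negP => /andP[/imsetP[y]]; rewrite inE => /andP[yY /eqP y1] -> ab.
    have [sX fs] := sY yY; have sr : rU (s y) = 1%N by rewrite -rf// fs.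
    have ay : a = s y.
      by case/orP: ab => ab; [apply: rU_inj|apply/esym/rU_inj]; rewrite ?a1 ?sr.
    by case/negP: sa; rewrite ay imset_f// inE yY y1 eqxx.
  rewrite [LHS]inE !in_setU [inr y \in low]inlF highE inrE [RHS]inE.
  rewrite [inr y \in [set _ in D | _]]inE ltnn andbF orbF /=.
  case yY': (y \in Y') => //=; have yY := Y'Y yY'.
  case ay: (leW (f a) y) => /=; last by rewrite andbF.
  rewrite andbT; have [->|yfa] := eqVneq y (f a); first by rewrite r1.
  by rewrite -r1 rW_lt.
have [sX fs] := sY faY.
(* The chosen lift of [f a] is the cone point in [S] that trivializes cocycles on the link of
   [a]. *)
have saA : inl (s (f a)) \in S.
  apply: (subsetP AS); rewrite in_setU inlE imset_f// inE faY r1 eqxx.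
  by [].
apply: Q_attach => //; last by rewrite linkE; exact: att_low.
apply: (cone_trivial_on_link saA) => -[b|y]; rewrite linkE ?inrF// inrE inE.
by case/and3P=> _ + _ /=; rewrite fs.
Qed.

(** By increasing rank, the link of [a] consists of what lies below [a] in [X] and above [f a] in
    [Y']. If [f a] is present it is a cone point. If it was deleted, maximality leaves nothing
    above, and rank two leaves only incomparable elements of rank one below. *)
Let attach_rest : Q (inl @: [set a in X | rU a == 1%N] :|: high) ->
  Q (inl @: X :|: high).
Proof.
pose D := inl @: [set a in X | rU a != 1%N] : {set U + W}.
have -> : inl @: X :|: high = (inl @: [set a in X | rU a == 1%N] :|: high) :|: D.
  apply/setP=> -[a|y]; rewrite !in_setU ?inlE ?highF ?inlF ?orbF// !inE.
  by case: (a \in X); case: eqP.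
apply: (attach_all (e := glue_rel) (rk := rk)).
- move=> [a|y]; rewrite !in_setU ?inlE ?highF ?inlF ?orbF// !inE.
  by case/andP=> _ /negbTE->; rewrite andbF.
- move=> [a|y] [b|z]; rewrite ?inlE ?inlF// !inE.
  move=> /andP[aX _] /andP[bX _] /orP[] ab /= rab; congr inl.
    exact: rU_inj.
  exact/esym/rU_inj.
move=> [a|y] S; rewrite ?inlF// inlE inE => /andP[aX a1] AS SD aS linkE.
have faY := fX aX; have r2 : 1 < rW (f a).
  by rewrite ltn_neqAle eq_sym rf// a1 -rf// rW_gt0.
have linkl b : inl b \in link glue_rel S (inl a) -> [/\ b \in X, leU b a & b != a].
  rewrite linkE inE => /andP[]; rewrite !inE !inlE highF orbF !inE /=.
  move=> h ab; have bX : b \in X by case/orP: h => /andP[]// /andP[].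
  have rba : rU b < rU a.
    case/orP: h => /andP[]; last by [].
    by move=> _ /eqP->; rewrite -rf.
  split=> //; last by apply: contraTneq rba => ->; rewrite ltnn.
  case/orP: ab => // ab; have := rU_mono aX bX ab.
  by rewrite leqNgt rba.
have linkr y : (inr y \in link glue_rel S (inl a)) =
    [&& y \in Y', 1 < rW y & leW (f a) y].
  by rewrite linkE !inE inlF highE !inE inlF orbF /= -andbA.
have [faZ|faZ] := boolP (f a \in Z).
  have {linkr}linkr y : inr y \notin link glue_rel S (inl a).
    rewrite linkr; apply/and3P => -[yY' _ ay].
    have yZ := Zmax faZ (Y'Y yY') ay.
    by move: yY'; rewrite yZ inE faZ.
  apply: Q_attach => //.
    apply: discrete_trivial_on_link; first exact: glue_refl.
    move=> [b|y] [c|z]; try by rewrite (negbTE (linkr _)).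
    move=> /linkl[bX ba bna] /linkl[cX ca cna].
    have r_a : rU a = 2 by rewrite -rf// (Z2 faZ).2.
    have r1 b' : b' \in X -> leU b' a -> b' != a -> rU b' = 1%N.
      move=> b'X b'a b'na; apply/eqP; rewrite eqn_leq -{2}rf// rW_gt0 ?fX// andbT.
      rewrite -ltnS -r_a ltn_neqAle rU_mono// andbT.
      by apply: contra b'na => /eqP rr; apply/eqP/rU_inj.
    by case/orP=> bc; congr inl; [|apply/esym]; apply: rU_inj; rewrite ?r1.
  have -> : link glue_rel S (inl a) = inl @: [set b in X | leU b a & b != a].
    apply/setP=> -[b|y]; last by rewrite inlF; exact/negbTE/linkr.
    rewrite inlE inE; apply/idP/idP => [/linkl[-> -> ->]//|/and3P[bX ba bna]].
    rewrite linkE !inE !inlE !inE highF bX /= /cmp ba orbT andbT.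
    rewrite orbF; case: (rU b == 1%N) => //=.
    rewrite ltn_neqAle rU_mono// andbT.
    by apply: contra bna => /eqP rr; apply/eqP/rU_inj.
  exact: att_Z.
have faY' : f a \in Y' by rewrite inE faZ.
have faL : inr (f a) \in link glue_rel S (inl a) by rewrite linkr faY' r2 leW_refl.
have coneP x : x \in link glue_rel S (inl a) -> glue_rel (inr (f a)) x.
  case: x => [b /linkl[bX ba _] /=|y]; first exact: f_mono.
  by rewrite linkr => /and3P[_ _ ay]; rewrite /= /cmp ay.
apply: Q_attach => //.
  exact/acyclic_trivial_on_link/(cone_acyclic faL coneP).
exact: att_cone faL coneP.
Qed.

(** Deleting by increasing rank strips the lower part in [Y'] from the link of [y], which becomes
    the join of the fibre with the elements strictly above. With nothing above, the fibre itself
    must be acyclic; otherwise its connectedness suffices. *)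
Let remove_high : Q (inl @: X :|: high) -> Q (inl @: X).
Proof.
apply: (remove_all (e := glue_rel) (rk := rk)).
- by move=> [a|y]; rewrite ?highF// inlF.
- move=> [a|y] [b|z]; rewrite ?highF// !highE.
  move=> /andP[/Y'Y yY _] /andP[/Y'Y zY _] /orP[] yz /= ryz; congr inr.
    exact: rW_inj.
  exact/esym/rW_inj.
move=> [a|y] S; rewrite ?highF// highE => /andP[yY' y1] AS SD yS linkE.
have yY := Y'Y yY'.
have {}linkE : link glue_rel S (inr y) = inl @: fibre y :|: inr @: above Y' y.
  rewrite linkE; apply/setP=> -[b|z].
    by rewrite !inE !inlE highF /= inrF !orbF inE.
  rewrite [LHS]inE [RHS]in_setU in_setU !inlF [inr z \in [set _ in high | _]]inE.
  rewrite highE inrE [z \in above Y' y]inE /=.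
  case zY': (z \in Y') => //=; have zY := Y'Y zY'.
  have [->|zy] /= := eqVneq z y; first by rewrite ltnn !andbF.
  rewrite andbT; apply/andP/idP => [[/andP[_ ryz]]|yz].
    by case/orP=> // zy'; have := rW_mono zY yY zy'; rewrite leqNgt ryz.
  rewrite /cmp yz rW_lt// andbT; split=> //.
  by rewrite (leq_trans y1)// ltnW// rW_lt.
have [cF aF] := fib yY' y1.
have cF' : conn glue_rel (inl @: fibre y).
  by apply: conn_imset cF.
have aF' : acyclic (cmp leU) (fibre y) -> acyclic glue_rel (inl @: fibre y).
  apply: (acyclic_imset (h := fun x => if x is inl a then a else s y)).
    by move=> a.
  by move=> a b.
have join (x z : U + W) : x \in inl @: fibre y -> z \in inr @: above Y' y ->
    glue_rel x z.
  case/imsetP=> a + ->; rewrite inE => /andP[aX ay].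
  by case/imsetP=> z' + ->; rewrite inE => /and3P[_ yz _]; exact: leW_trans yz.
have [sX fs] := sY yY.
have sF : (inl (s y) : U + W) \in inl @: fibre y by rewrite inlE inE sX fs leW_refl.
apply: Q_remove => //.
- apply: acyclic_trivial_on_link; rewrite linkE.
  have [ab0|/set0Pn[z zab]] := eqVneq (above Y' y) set0.
    rewrite ab0 imset0 setU0; apply: aF'.
    by case: aF => //; rewrite ab0 eqxx.
  apply: (join_acyclic glue_refl glue_sym sF (b := inr z)) => //.
  by rewrite inrE.
rewrite linkE; have [ab0|/set0Pn[z zab]] := eqVneq (above Y' y) set0.
  by rewrite ab0 imset0 setU0.
apply: (join_conn glue_sym sF (b := inr z)) => //.
by rewrite inrE.
Qed.

Lemma fibration_transfer : Q (low :|: high) -> Q (inl @: X).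
Proof. by move=> Q0; exact/remove_high/attach_rest/attach_low. Qed.

End Fibration.

End PosetMap.

(** * Geometric realization *)

Section Realization.
Import Order.TTheory GRing.Theory Num.Theory.
Import numFieldTopology.Exports numFieldNormedType.Exports.
Local Open Scope classical_set_scope.
Local Open Scope ring_scope.
Context (R : realType) (d : Order.disp_t) (P : finPOrderType d).
Local Notation X := (poset_space R P).
Local Notation I := (unit_interval R).
Implicit Types (a b : X) (v w : P) (t : I).

Definition compar : rel P := fun v w => (v >=< w)%O.

Lemma compar_refl : reflexive compar.
Proof. by move=> v; exact: comparablexx. Qed.

Lemma compar_sym : symmetric compar.
Proof. by move=> v w; exact: comparable_sym. Qed.

Definition coord a v : R := (\val a : {ptws P -> R}) v.

Lemma coordP a : realization R P (order_complex P) (\val a).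
Proof. exact: set_mem (valP a). Qed.

Lemma coord_ge0 a v : 0 <= coord a v.
Proof. by have [] := coordP a. Qed.

Lemma coord_sum a : \sum_v coord a v = 1.
Proof. by have [] := coordP a. Qed.

Lemma coord_compar a v w : coord a v != 0 -> coord a w != 0 -> compar v w.
Proof.
move=> av aw; have [_ _] := coordP a; rewrite inE => /andP[_].
move=> /forallP/(_ v); rewrite inE => /implyP/(_ av)/forallP/(_ w).
by rewrite inE => /implyP/(_ aw).
Qed.

Lemma coord_support a : exists v, coord a v != 0.
Proof.
apply/existsP; apply: contraT; rewrite negb_exists => /forallP a0.
have := coord_sum a; rewrite big1 => [/eqP|v _]; first by rewrite eq_sym oner_eq0.
by apply/eqP; have := a0 v; rewrite negbK.
Qed.

Lemma coord_inj a b : (forall v, coord a v = coord b v) -> a = b.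
Proof. by move=> ab; apply: val_inj; apply: funext. Qed.

Lemma realizationI (f : P -> R) : (forall v, 0 <= f v) -> \sum_v f v = 1 ->
  (forall v w, f v != 0 -> f w != 0 -> compar v w) ->
  (f : {ptws P -> R}) \in realization R P (order_complex P).
Proof.
move=> f0 f1 fc; apply: mem_set; split=> //.
rewrite inE; apply/andP; split; last first.
  apply/forallP=> v; apply/implyP; rewrite inE => fv.
  by apply/forallP=> w; apply/implyP; rewrite inE => fw; exact: fc.
apply/negP => /eqP/setP f_eq0; have /eqP := f1; rewrite big1 => [|v _].
  by rewrite eq_sym oner_eq0.
by apply/eqP; have := f_eq0 v; rewrite !inE => /negbFE.
Qed.

Lemma coord_continuous v : continuous (fun a : X => coord a v).
Proof.
move=> a; apply: (@continuous_comp _ _ _ (fun a : X => \val a : {ptws P -> R})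
  (fun f : {ptws P -> R} => f v)).
  exact: initial_continuous.
exact: (@proj_continuous _ (fun=> R) v).
Qed.

Lemma into_continuous (Y : topologicalType) (f : Y -> X) :
  (forall v, continuous (fun y => coord (f y) v)) -> continuous f.
Proof.
move=> cf; apply/continuous_comp_initial => y; apply/cvg_sup => v.
move=> U [B [[W oW <-] /= Wy] /filterS]; apply.
by apply: (cf v y); exact: open_nbhs_nbhs.
Qed.

Lemma coord_path_continuous (Y : topologicalType) (f : Y -> X) v :
  continuous f -> continuous (fun y => coord (f y) v).
Proof.
move=> cf y; apply: (@continuous_comp _ _ _ f (fun a => coord a v)).
  exact: cf.
exact: coord_continuous.
Qed.

(** Contiguity: both supports lie in a common simplex, so the straight segment stays in the
    realization. *)
Definition carried (f g : P -> R) :=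
  forall v w, (f v != 0) || (g v != 0) -> (f w != 0) || (g w != 0) -> compar v w.

Lemma carriedP a b : (forall v, coord b v != 0 -> coord a v != 0) ->
  carried (coord a) (coord b).
Proof.
move=> ba v w av aw; apply: (@coord_compar a).
  by case/orP: av => // /ba.
by case/orP: aw => // /ba.
Qed.

Definition mix (f g : P -> R) (s : R) v : R := (1 - s) * f v + s * g v.

Lemma mix_in a b s : carried (coord a) (coord b) -> 0 <= s <= 1 ->
  (mix (coord a) (coord b) s : {ptws P -> R})
    \in realization R P (order_complex P).
Proof.
move=> ab /andP[s0 s1]; apply: realizationI.
- by move=> v; rewrite addr_ge0// mulr_ge0// ?coord_ge0// subr_ge0.
- by rewrite big_split/= -!mulr_sumr !coord_sum; lra.
have mix0 v : mix (coord a) (coord b) s v != 0 ->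
    (coord a v != 0) || (coord b v != 0).
  by rewrite -negb_and; apply: contra => /andP[/eqP av /eqP bv];
    rewrite /mix av bv !mulr0 addr0.
by move=> v w /mix0 av /mix0 aw; exact: ab.
Qed.

Lemma path_homotopic_carried a b (p q : {path I from a to b in X}) :
  (forall t, carried (coord (p t)) (coord (q t))) -> path_homotopic p q.
Proof.
move=> pq; exists (fun z : I * I => SigSub (mix_in (pq z.1) (uval_itv z.2)) : X).
have cst_mix (x : X) (s : R) v : mix (coord x) (coord x) s v = coord x v.
  by rewrite /mix; ring.
split=> [|t|t|s|s].
- apply: into_continuous => v.
  rewrite (_ : (fun y => _) = fun z : I * I => (1 - uval z.2) * coord (p z.1) v +
    uval z.2 * coord (q z.1) v)//.
  have cp : continuous (fun t => coord (p t) v).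
    by apply: coord_path_continuous; exact: (@cts_fun _ _ p).
  have cq : continuous (fun t => coord (q t) v).
    by apply: coord_path_continuous; exact: (@cts_fun _ _ q).
  real_continuity.
    by apply: (real_comp_continuous cp) => z; exact: cvg_fst.
  by apply: (real_comp_continuous cq) => z; exact: cvg_fst.
- by apply: coord_inj => v; rewrite /coord/= /mix uval0; ring.
- by apply: coord_inj => v; rewrite /coord/= /mix uval1; ring.
- by apply: coord_inj => v; rewrite {1}/coord/= !path_zero cst_mix.
- by apply: coord_inj => v; rewrite {1}/coord/= !path_one cst_mix.
Qed.

Section Segment.
Context a b (ab : carried (coord a) (coord b)).

Definition seg_fun t : X := SigSub (mix_in ab (uval_itv t)).

Lemma seg_continuous : continuous seg_fun.
Proof.
apply: into_continuous => v.
rewrite (_ : (fun y => _) = fun t => (1 - uval t) * coord a v +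
  uval t * coord b v)//.
by real_continuity.
Qed.

Lemma seg_zero : seg_fun zero = a.
Proof. by apply: coord_inj => v; rewrite /coord/= /mix uval0 -/(coord _ _); ring. Qed.

Lemma seg_one : seg_fun one = b.
Proof. by apply: coord_inj => v; rewrite /coord/= /mix uval1 -/(coord _ _); ring. Qed.

Definition segment : {path I from a to b in X} :=
  mk_path seg_continuous seg_zero seg_one.

End Segment.

Lemma vertex_in v : ((fun w => (w == v)%:R) : {ptws P -> R})
  \in realization R P (order_complex P).
Proof.
apply: realizationI => [w||w u]; first by rewrite ler0n.
  by rewrite (bigD1 v)//= eqxx big1 ?addr0// => w /negbTE->.
case: (eqVneq w v) => [->|]; last by rewrite eqxx.
by case: (eqVneq u v) => [->|]; rewrite ?eqxx// => _ _; exact: compar_refl.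
Qed.

Definition vertex v : X := SigSub (vertex_in v).

Lemma coord_vertex v w : coord (vertex v) w = (w == v)%:R.
Proof. by []. Qed.

Lemma coord_vertex_neq0 v w : (coord (vertex v) w != 0) = (w == v).
Proof. by rewrite coord_vertex pnatr_eq0 eqb0 negbK. Qed.

Lemma edge_carried v w : compar v w ->
  carried (coord (vertex v)) (coord (vertex w)).
Proof.
move=> vw u u'; rewrite !coord_vertex_neq0.
by move=> /orP[]/eqP-> /orP[]/eqP->; rewrite ?compar_refl// compar_sym.
Qed.

Definition edge v w (vw : compar v w) : {path I from vertex v to vertex w in X} :=
  segment (edge_carried vw).

(* The support condition says that the i-th label is the centre of an open star
   containing the piece of the curve over the i-th of N subintervals and its
   two neighbours. *)
Definition labels (N : nat) (l : nat -> P) (f : I -> X) := forall t i,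
  (i <= N)%N -> `|N%:R * uval t - i%:R| < 1 -> coord (f t) (l i) != 0.

Lemma labels_zero N l f v : labels N l f -> f zero = vertex v -> l 0%N = v.
Proof.
move=> lf f0; apply/eqP; rewrite -coord_vertex_neq0 -f0; apply: lf => //.
by rewrite uval0 mulr0 subr0 normr0.
Qed.

Lemma labels_one N l f v : labels N l f -> f one = vertex v -> l N = v.
Proof.
move=> lf f0; apply/eqP; rewrite -coord_vertex_neq0 -f0; apply: lf => //.
by rewrite uval1 mulr1 subrr normr0.
Qed.

(** For [i = k * M + j] with [j < M], the [i]-th window of the finer grid lies inside the [k]-th
    window of the coarser one. *)
Lemma labels_refine N M l f : (0 < M)%N -> labels N l f ->
  labels (N * M) (fun i => l (i %/ M)%N) f.
Proof.
move=> M0 lf t i iNM h; apply: lf.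
  by rewrite -(mulnK N M0) leq_div2r.
have M0' : 0 < M%:R :> R by rewrite ltr0n.
move: h; rewrite {1}(divn_eq i M) natrM natrD natrM.
have jM : (i %% M)%:R + 1 <= M%:R :> R by rewrite natr1 ler_nat ltn_mod.
have j0 : 0 <= (i %% M)%:R :> R by rewrite ler0n.
set u := N%:R * uval t; set m := M%:R in M0' jM *; set k := (i %/ M)%:R.
set j := (i %% M)%:R in jM j0 *.
rewrite mulrAC -/u !ltr_norml => /andP[h1 h2].
have h3 : 0 < m * (u - k + 1) by nra.
have h4 : m * (u - k - 1) < 0 by nra.
by rewrite pmulr_rgt0// in h3; rewrite pmulr_rlt0// in h4; lra.
Qed.

End Realization.

(** * Holonomy of labelled curves and its homotopy invariance *)

Section Holonomy.
Import Order.TTheory GRing.Theory Num.Theory.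
Import numFieldTopology.Exports numFieldNormedType.Exports.
Local Open Scope classical_set_scope.
Local Open Scope ring_scope.
Context (R : realType) (d : Order.disp_t) (P : finPOrderType d).
Local Notation X := (poset_space R P).
Local Notation I := (unit_interval R).
Implicit Types (a b : X) (v w : P) (t : I).

Lemma compact_square : compact [set: I * I].
Proof.
have cI : compact [set: I].
  rewrite (_ : [set: I] = (@clamp R) @` `[0, 1]).
    apply: continuous_compact; last exact: segment_compact.
    by apply: continuous_subspaceT; exact: clamp_continuous.
  apply/seteqP; split=> // t _; exists (uval t); last exact: uvalK.
  by rewrite /= in_itv /= uval_itv.
by rewrite -setXTT; exact: compact_setX.
Qed.

(** A Lebesgue number argument for the cover of the square by preimages of open stars of
    vertices. *)
Lemma labels_square (F : I * I -> X) : continuous F ->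
  exists2 N0, (0 < N0)%N & forall n, (N0 <= n)%N ->
    exists w : nat -> nat -> P, forall t s i j, (i <= n)%N -> (j <= n)%N ->
      `|n%:R * uval t - i%:R| < 1 -> `|n%:R * uval s - j%:R| < 1 ->
      coord (F (t, s)) (w i j) != 0.
Proof.
move=> cF.
pose Pr (n : nat) (z : I * I) := exists v, forall z' : I * I,
  n%:R * `|uval z'.1 - uval z.1| < 1 -> n%:R * `|uval z'.2 - uval z.2| < 1 ->
  coord (F z') v != 0.
have nbhs_uval (t : I) (A : set I) : nbhs t A ->
    exists2 e : R, 0 < e & forall t', `|uval t' - uval t| < e -> A t'.
  case=> _ [[W oW <-] /= Wt WA].
  have /nbhs_ballP[e e0 eW] : nbhs (uval t) W by exact: open_nbhs_nbhs.
  exists e => // t' tt'; apply: WA; apply: eW.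
  by rewrite -ball_normE /= distrC.
have : \forall n \near \oo, [set: I * I] `<=` Pr n.
  move/compact_near_coveringP: compact_square; apply => z _.
  have [v zv] := coord_support (F z).
  have : nbhs z [set z' | coord (F z') v != 0].
    have /(_ [set r | r != 0]) := @coord_path_continuous R d P _ F v cF z; apply.
    by apply: open_nbhs_nbhs; split; [exact: open_neq|].
  case=> -[A1 A2] /= [/nbhs_uval[e1 e10 A1e] /nbhs_uval[e2 e20 A2e]] A12.
  (* Half the radius: a point within [e] of [z], moved by a window of size [1/n <= e], stays in the
     neighbourhood. *)
  pose e := Num.min e1 e2 / 2.
  have e0 : 0 < e by rewrite divr_gt0// lt_min e10.
  have [ee1 ee2] : 2 * e <= e1 /\ 2 * e <= e2.
    rewrite /e mulrC divfK ?pnatr_eq0//.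
    by split; rewrite ge_min lexx ?orbT.
  exists ([set z' | `|uval z'.1 - uval z.1| < e /\ `|uval z'.2 - uval z.2| < e],
    [set n : nat | e^-1 <= n%:R]) => /=.
    split; last exact: nbhs_infty_ger.
    have ball_nbhs (f : I * I -> I) : continuous f ->
        nbhs z [set z' | `|uval (f z') - uval (f z)| < e].
      move=> cf; have : nbhs (uval (f z)) (ball (uval (f z)) e) by exact: nbhsx_ballx.
      have cuf := real_comp_continuous (@uval_continuous R) cf.
      move/(cuf z).
      by apply: (@filterS _ (nbhs z)) => z'; rewrite -ball_normE /= distrC.
    have c1 : continuous (fst : I * I -> I) by move=> ?; exact: cvg_fst.
    have c2 : continuous (snd : I * I -> I) by move=> ?; exact: cvg_snd.
    exact: (filterI (ball_nbhs _ c1) (ball_nbhs _ c2)).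
  move=> [z1 n] /= [[h1 h2] ne]; exists v => z' k1 k2.
  apply: (A12 z'); split.
    apply: A1e; apply: lt_le_trans ee1.
    have : `|uval z'.1 - uval z1.1| < e.
      rewrite -(ltr_pM2l (x := n%:R)); last by rewrite (lt_le_trans _ ne)// invr_gt0.
      by rewrite (lt_le_trans k1)// -ler_pdivrMr// div1r.
    have := ler_distD (uval z1.1) (uval z'.1) (uval z.1); lra.
  apply: A2e; apply: lt_le_trans ee2.
  have : `|uval z'.2 - uval z1.2| < e.
    rewrite -(ltr_pM2l (x := n%:R)); last by rewrite (lt_le_trans _ ne)// invr_gt0.
    by rewrite (lt_le_trans k2)// -ler_pdivrMr// div1r.
  have := ler_distD (uval z1.2) (uval z'.2) (uval z.2); lra.
case=> N0 _ N0P; exists N0.+1 => // n N0n.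
have n0 : (0 < n)%N by exact: leq_trans N0n.
have nR : 0 < n%:R :> R by rewrite ltr0n.
pose g (i : nat) : I := clamp (i%:R / n%:R).
have gE i : (i <= n)%N -> uval (g i) = i%:R / n%:R.
  by move=> ni; rewrite clampK// divr_ge0//= ler_pdivrMr// mul1r ler_nat.
have /choice[w wP] : forall ij : nat * nat, exists v, forall z' : I * I,
    n%:R * `|uval z'.1 - uval (g ij.1)| < 1 ->
    n%:R * `|uval z'.2 - uval (g ij.2)| < 1 -> coord (F z') v != 0.
  by move=> ij; apply: (N0P n (ltnW N0n) (g ij.1, g ij.2)).
exists (fun i j => w (i, j)) => t s i j ni nj ti sj.
have E (u : R) k : n%:R * `|u - k%:R / n%:R| = `|n%:R * u - k%:R|.
  by rewrite -{1}(ger0_norm (ltW nR)) -normrM mulrBr mulrCA divff ?mulr1 ?gt_eqF.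
by apply: wP; rewrite /= gE// E.
Qed.

Section WithCocycle.
Context (H : groupType) (c : P -> P -> H).
Hypothesis cP : cocycle (@compar d P) [set: P] c.

Fixpoint lhol (l : nat -> P) N : H :=
  if N is n.+1 then (lhol l n * c (l n) (l n.+1))%g else 1%g.

Lemma cocycle_refl v : c v v = 1%g.
Proof. by apply: cocycle1 cP _; rewrite ?inE//; exact: compar_refl. Qed.

(** Labels that are non-zero at one common point span a simplex, so both triangles of each square
    obey the cocycle rule and the rungs cancel. *)
Lemma ladder l m N : (forall i, (i < N)%N -> exists a : X,
    [/\ coord a (l i) != 0, coord a (l i.+1) != 0, coord a (m i) != 0 &
        coord a (m i.+1) != 0]) ->
  (lhol l N * c (l N) (m N) = c (l 0%N) (m 0%N) * lhol m N)%g.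
Proof.
elim: N => [|N IH] lm /=; first by rewrite mul1g mulg1.
have [a [lN lSN mN mSN]] := lm N (leqnn _).
rewrite -mulgA cP ?inE ?(coord_compar lN)// ?(coord_compar lSN)//.
rewrite -(@cP (l N) (m N)) ?inE ?(coord_compar lN)// ?(coord_compar mN)//.
by rewrite !mulgA IH// => i iN; apply: lm; exact: leqW.
Qed.

(** Each label is repeated [M] times, and a repetition contributes [c v v = 1]. *)
Lemma lhol_refine l N M : (0 < M)%N ->
  lhol (fun i => l (i %/ M)%N) (N * M) = lhol l N.
Proof.
move=> M0; elim: N => [|N IH] //.
have step k : (k < M)%N ->
    lhol (fun i => l (i %/ M)%N) (N * M + k) = lhol l N.
  elim: k => [|k IHk] kM; first by rewrite addn0.
  rewrite addnS /= IHk ?(ltnW kM)// -addnS !divnMDl// !divn_small ?(ltnW kM)//.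
  by rewrite cocycle_refl mulg1.
have E : (N.+1 * M = (N * M + M.-1).+1)%N by rewrite mulSn addnC -addnS prednK.
rewrite E /= step ?prednK// -addnS prednK//.
by rewrite !divnMDl// divnn M0 divn_small ?prednK// addn0 addn1.
Qed.

(** All labellings are brought to one grid size [n], a common multiple of [N] and [M] and at least
    the Lebesgue bound [K]. Ladders then lead from the given bottom labels through the rows of the
    square to the top. *)
Lemma labels_homotopic (F : I * I -> X) v w N l M m :
  continuous F ->
  (forall s, F (zero, s) = vertex R v) -> (forall s, F (one, s) = vertex R w) ->
  (0 < N)%N -> labels N l (fun t => F (t, zero)) ->
  (0 < M)%N -> labels M m (fun t => F (t, one)) ->
  lhol l N = lhol m M.
Proof.
move=> cF F0 F1 N0 lN M0 mM.
have [K K0 /(_ (N * M * K)%N)[]] := labels_square cF.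
  by rewrite leq_pmull// muln_gt0 N0.
set n := (N * M * K)%N => z zP.
have n0 : (0 < n)%N by rewrite !muln_gt0 N0 M0.
have MK0 : (0 < M * K)%N by rewrite muln_gt0 M0.
have NK0 : (0 < N * K)%N by rewrite muln_gt0 N0.
have nN : n = (N * (M * K))%N by rewrite /n mulnA.
have nM : n = (M * (N * K))%N by rewrite /n mulnCA mulnA.
have nR : 0 < n%:R :> R by rewrite ltr0n.
rewrite -(lhol_refine l N MK0) -(lhol_refine m M NK0) -nN -nM.
have := labels_refine MK0 lN; rewrite -nN.
have := labels_refine NK0 mM; rewrite -nM.
set m' := fun i => m _; set l' := fun i => l _ => m'P l'P.
(* The midpoint of a subinterval lies in the windows of both its ends, so it witnesses the simplex
   needed by [ladder]. *)
pose mid (i : nat) : I := clamp ((i%:R + 2^-1) / n%:R).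
have midE i : (i < n)%N -> n%:R * uval (mid i) = i%:R + 2^-1.
  move=> ni; have : i%:R + 1 <= n%:R :> R by rewrite natr1 ler_nat.
  have i0 : 0 <= i%:R :> R by [].
  move=> h; rewrite clampK; first by rewrite mulrC divfK ?gt_eqF.
  apply/andP; split; last by rewrite ler_pdivrMr// mul1r; lra.
  by apply: divr_ge0; lra.
have mid1 i : (i < n)%N -> `|n%:R * uval (mid i) - i%:R| < 1.
  by move=> ni; rewrite midE// addrC addKr ger0_norm; lra.
have mid2 i : (i < n)%N -> `|n%:R * uval (mid i) - i.+1%:R| < 1.
  move=> ni; rewrite midE// -(natr1 i).
  have -> : i%:R + 2^-1 - (i%:R + 1) = - 2^-1 :> R by lra.
  by rewrite normrN ger0_norm; lra.
have n00 : `|n%:R * uval (zero : I) - 0%:R| < 1 :> R.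
  by rewrite uval0 mulr0 subr0 normr0.
have nn1 : `|n%:R * uval (one : I) - n%:R| < 1 :> R.
  by rewrite uval1 mulr1 subrr normr0.
have clampn i : (i <= n)%N -> n%:R * uval (clamp (i%:R / n%:R) : I) = i%:R.
  move=> ni; rewrite clampK; first by rewrite mulrC divfK ?gt_eqF.
  by rewrite divr_ge0//= ler_pdivrMr// mul1r ler_nat.
(* On the vertical sides the homotopy sits at a vertex, whose only possible label is that vertex;
   the end rungs are therefore trivial. *)
have z0 j : (j <= n)%N -> z 0%N j = v.
  move=> jn; apply/eqP; rewrite -(coord_vertex_neq0 R) -(F0 (clamp (j%:R / n%:R))).
  by apply: zP => //; rewrite clampn// subrr normr0.
have zn j : (j <= n)%N -> z n j = w.
  move=> jn; apply/eqP; rewrite -(coord_vertex_neq0 R) -(F1 (clamp (j%:R / n%:R))).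
  by apply: zP => //; rewrite clampn// subrr normr0.
have l'0 : l' 0%N = v by apply: (labels_zero l'P); rewrite F0.
have l'n : l' n = w by apply: (labels_one l'P); rewrite F1.
have m'0 : m' 0%N = v by apply: (labels_zero m'P); rewrite F0.
have m'n : m' n = w by apply: (labels_one m'P); rewrite F1.
have rung k k' : (forall i, (i < n)%N -> exists a : X,
    [/\ coord a (k i) != 0, coord a (k i.+1) != 0, coord a (k' i) != 0 &
        coord a (k' i.+1) != 0]) -> k 0%N = k' 0%N -> k n = k' n ->
    lhol k n = lhol k' n.
  by move=> /ladder + k0 kn; rewrite k0 kn !cocycle_refl mul1g mulg1.
have E0 : lhol l' n = lhol (z ^~ 0%N) n.
  apply: rung => [i ni||]; rewrite ?l'0 ?z0 ?l'n ?zn//.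
  exists (F (mid i, zero)); split.
  - by apply: l'P; [exact: ltnW|exact: mid1].
  - by apply: l'P; [|exact: mid2].
  - by apply: zP => //; [exact: ltnW|exact: mid1].
  - by apply: zP => //; exact: mid2.
have E1 : lhol (z ^~ n) n = lhol m' n.
  apply: rung => [i ni||]; rewrite ?m'0 ?z0 ?m'n ?zn//.
  exists (F (mid i, one)); split.
  - by apply: zP => //; [exact: ltnW|exact: mid1].
  - by apply: zP => //; exact: mid2.
  - by apply: m'P; [exact: ltnW|exact: mid1].
  - by apply: m'P; [|exact: mid2].
have Ej j : (j <= n)%N -> lhol (z ^~ 0%N) n = lhol (z ^~ j) n.
  elim: j => // j IH jn; have jn' := ltnW jn; rewrite IH//.
  apply: rung => [i ni||]; rewrite ?z0 ?zn//.
  have ni' := ltnW ni.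
  exists (F (mid i, mid j)).
  by split; apply: zP => //; by [exact: mid1|exact: mid2].
by rewrite E0 (Ej n)// E1.
Qed.

Lemma labels_exist (f : I -> X) : continuous f ->
  exists N l, (0 < N)%N /\ labels N l f.
Proof.
move=> cf; have cF : continuous (fun z : I * I => f z.1).
  by move=> z; apply: (@continuous_comp _ _ _ fst f); [exact: cvg_fst|exact: cf].
have [N N0 /(_ N (leqnn N))[w wP]] := labels_square cF.
exists N, (w ^~ 0%N); split=> // t i iN ti.
by apply: (wP t zero) => //; rewrite uval0 mulr0 subr0 normr0.
Qed.

End WithCocycle.
End Holonomy.

(** * Homotopy calculus for concatenated and conjugated paths *)

Section PathAlgebra.
Import Order.TTheory GRing.Theory Num.Theory.
Local Open Scope ring_scope.
Context (R : realType) (T : topologicalType).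
Local Notation I := (unit_interval R).
Local Notation rev_path := Defs.rev_path.
Local Notation "p ~ q" := (path_homotopic p q) (at level 70).
Local Notation "p ** q" := (concat_path p q) (at level 40, left associativity).
Implicit Types (x y z w : T).

Lemma path_homotopic_concatl x y z (p p' : {path I from x to y in T})
    (q : {path I from y to z in T}) : p ~ p' -> p ** q ~ p' ** q.
Proof. by move=> pp'; apply: path_homotopic_concat => //; exact: path_homotopic_refl. Qed.

Lemma path_homotopic_concatr x y z (p : {path I from x to y in T})
    (q q' : {path I from y to z in T}) : q ~ q' -> p ** q ~ p ** q'.
Proof. by move=> qq'; apply: path_homotopic_concat => //; exact: path_homotopic_refl. Qed.

Lemma path_homotopic_concatK x y z (p : {path I from y to x in T})
    (q : {path I from y to z in T}) : p ** (rev_path p ** q) ~ q.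
Proof.
apply: path_homotopic_trans (path_homotopic_concatA _ _ _) _.
apply: path_homotopic_trans (path_homotopic_concat1p _).
exact/path_homotopic_concatl/path_homotopic_concatpV.
Qed.

Lemma path_homotopic_concatKV x y z (p : {path I from y to x in T})
    (q : {path I from x to z in T}) : rev_path p ** (p ** q) ~ q.
Proof.
apply: path_homotopic_trans (path_homotopic_concatA _ _ _) _.
apply: path_homotopic_trans (path_homotopic_concat1p _).
exact/path_homotopic_concatl/path_homotopic_concatVp.
Qed.

Definition conj_path a x y (s : {path I from a to x in T})
  (p : {path I from x to y in T}) (t : {path I from a to y in T}) :
  {path I from a to a in T} := s ** (p ** rev_path t).

Lemma conj_path_homotopic a x y (s : {path I from a to x in T})
  (p q : {path I from x to y in T}) (t : {path I from a to y in T}) :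
  p ~ q -> conj_path s p t ~ conj_path s q t.
Proof. by move=> pq; exact/path_homotopic_concatr/path_homotopic_concatl. Qed.

Lemma conj_path_concat a x y z (s : {path I from a to x in T})
  (p : {path I from x to y in T}) (t : {path I from a to y in T})
  (q : {path I from y to z in T}) (u : {path I from a to z in T}) :
  conj_path s p t ** conj_path t q u ~ conj_path s (p ** q) u.
Proof.
apply: path_homotopic_trans (path_homotopic_sym (path_homotopic_concatA _ _ _)) _.
apply: path_homotopic_concatr.
apply: path_homotopic_trans (path_homotopic_sym (path_homotopic_concatA _ _ _)) _.
apply: path_homotopic_trans (path_homotopic_concatA _ _ _).
apply: path_homotopic_concatr.
exact: path_homotopic_concatKV.
Qed.

Lemma conj_path_inj a x y (s : {path I from a to x in T})
  (p q : {path I from x to y in T}) (t : {path I from a to y in T}) :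
  conj_path s p t ~ conj_path s q t -> p ~ q.
Proof.
have cK r : rev_path s ** (conj_path s r t) ** t ~ r.
  apply: path_homotopic_trans (path_homotopic_concatl _ (path_homotopic_concatKV _ _)) _.
  apply: path_homotopic_trans (path_homotopic_sym (path_homotopic_concatA _ _ _)) _.
  apply: path_homotopic_trans (path_homotopic_concatr _ (path_homotopic_concatVp _)) _.
  exact: path_homotopic_concatp1.
move=> pq; apply: path_homotopic_trans (path_homotopic_sym (cK p)) _.
apply: path_homotopic_trans (cK q).
exact/path_homotopic_concatl/path_homotopic_concatr.
Qed.

Lemma conj_path_surj a x y (s : {path I from a to x in T})
  (r : {path I from a to a in T}) (t : {path I from a to y in T}) :
  conj_path s (rev_path s ** (r ** t)) t ~ r.
Proof.
apply: path_homotopic_trans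
  (path_homotopic_concatr _ (path_homotopic_sym (path_homotopic_concatA _ _ _))) _.
apply: path_homotopic_trans (path_homotopic_concatK _ _) _.
apply: path_homotopic_trans (path_homotopic_sym (path_homotopic_concatA _ _ _)) _.
apply: path_homotopic_trans (path_homotopic_concatr _ (path_homotopic_concatpV _)) _.
exact: path_homotopic_concatp1.
Qed.

Lemma conj_path_self a x (s : {path I from a to x in T}) :
  conj_path s (const_path R x) s ~ const_path R a.
Proof.
apply: path_homotopic_trans (path_homotopic_concatr _ (path_homotopic_concat1p _)) _.
exact: path_homotopic_concatpV.
Qed.

End PathAlgebra.

Section FreeGroups.
Local Open Scope group_scope.

Lemma group_hom1 (F H : groupType) (phi : F -> H) : group_hom phi -> phi 1 = 1.
Proof. by move=> hphi; apply: (mulgI (phi 1)); rewrite -hphi !mulg1. Qed.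

(** Passes from an indexed basis to a subset: a function on the range is pulled back to the indices,
    hence is constant on indices with equal image. *)
Lemma free_group_family (F : groupType) (B : Type) (l : B -> F) :
  (forall (H : groupType) (f : B -> H), exists phi : F -> H,
     group_hom phi /\ forall b, phi (l b) = f b) ->
  (forall (H : groupType) (phi psi : F -> H), group_hom phi -> group_hom psi ->
     (forall b, phi (l b) = psi (l b)) -> phi =1 psi) ->
  is_free_group F.
Proof.
move=> lE lU; exists (range l) => H f.
have rl b : l b \in range l by apply: mem_set; exists b.
have [phi [hphi phil]] := lE H (fun b => f (SigSub (rl b))).
exists phi; split=> [|psi [hpsi psil]].
  split=> // -[b bB]; have /set_mem[i _ ib] := bB.
  by rewrite /= -{1}ib phil; congr (f _); apply: val_inj.
apply/funext; apply: lU => // b.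
by rewrite phil -(psil (SigSub (rl b))).
Qed.

Lemma free_group_iso (F F' : groupType) (phi : F -> F') :
  group_hom phi -> injective phi -> (forall b, exists a, phi a = b) ->
  is_free_group F' -> is_free_group F.
Proof.
move=> hphi iphi sphi [B' B'P].
have /choice[psi psiP] := sphi.
have psiK a : psi (phi a) = a by apply: iphi; rewrite psiP.
have hpsi : group_hom psi by move=> a b; apply: iphi; rewrite hphi !psiP.
apply: (@free_group_family _ B' (fun b => psi (val b))) => [H f|H f g hf hg fg a].
  have [g [[hg gf] _]] := B'P H f; exists (fun a => g (phi a)); split.
    by move=> a b; rewrite hphi hg.
  by move=> b; rewrite psiP gf.
have [k [_ kU]] := B'P H (fun b => f (psi (val b))).
have kf : k = f \o psi by apply: kU; split=> // a1 a2 /=; rewrite hpsi hf.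
have kg : k = g \o psi.
  by apply: kU; split=> [a1 a2 /=|b]; rewrite ?hpsi ?hg// fg.
by rewrite -(psiK a) -[f _]/((f \o psi) _) -kf kg.
Qed.

End FreeGroups.

(** * Change of base point *)

Section FundamentalGroup.
Local Open Scope quotient_scope.
Local Notation rev_path := Defs.rev_path.
Context (R : realType) (T : topologicalType).
Local Notation I := (unit_interval R).

Lemma pi1_eq_homotopic x (p q : {path I from x to x in T}) :
  path_homotopic p q -> \pi_(pi1 R x) (p : loop R x) = \pi_(pi1 R x) (q : loop R x).
Proof. by move/pi1_eqP. Qed.

Lemma is_free_pi1_base x a (t : {path I from a to x in T}) :
  is_free_group (pi1 R a) -> is_free_group (pi1 R x).
Proof.
pose cl y (p : {path I from y to y in T}) : pi1 R y := \pi_(pi1 R y) (p : loop R y).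
pose phi (z : pi1 R x) : pi1 R a := cl a (conj_path t (repr z) t).
have phiE p : phi (cl x p) = cl a (conj_path t p t).
  by apply/pi1_eqP/conj_path_homotopic/pi1_eqP; rewrite reprK.
apply: (@free_group_iso _ _ phi).
- elim/quotW=> p; elim/quotW=> q.
  rewrite -[(_ * _)%g]/(pi1_mul _ _) pi1_mulE [phi _]phiE.
  rewrite -[\pi_(pi1 R x) p]/(cl x p) phiE phiE.
  rewrite -[RHS]/(pi1_mul _ _) pi1_mulE; apply/pi1_eqP/path_homotopic_sym.
  exact: conj_path_concat.
- elim/quotW=> p; elim/quotW=> q; rewrite phiE phiE => /pi1_eqP/conj_path_inj.
  exact: pi1_eq_homotopic.
- elim/quotW=> p; exists (cl x (concat_path (rev_path t) (concat_path p t))).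
  by rewrite phiE; apply/pi1_eqP/conj_path_surj.
Qed.

End FundamentalGroup.

(** * Edge paths and simplicial approximation of continuous paths *)

Section EdgePaths.
Import Order.TTheory GRing.Theory Num.Theory.
Import numFieldTopology.Exports numFieldNormedType.Exports.
Local Open Scope classical_set_scope.
Local Open Scope ring_scope.
Context (R : realType) (d : Order.disp_t) (P : finPOrderType d).
Local Notation X := (poset_space R P).
Local Notation I := (unit_interval R).
Local Notation vertex := (vertex R).
Local Notation compar := (@compar d P).
Implicit Types (a b : X) (v w : P) (t : I).

(** The edge path of a vertex sequence, bracketed to the right and ended by a constant path. A
    relation avoids computing a path whose type depends on the last vertex. *)
Inductive chained : forall x y, seq P -> {path I from vertex x to vertex y in X} -> Prop :=
| chained_nil x : @chained x x [::] (const_path R (vertex x))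
| chained_cons x y z s (xy : compar x y) (p : {path I from vertex y to vertex z in X}) :
    chained s p -> @chained x z (y :: s) (concat_path (edge R xy) p).

Lemma exists_chained x y s : path compar x s -> last x s = y ->
  exists p : {path I from vertex x to vertex y in X}, chained s p.
Proof.
elim: s x => [|z s IH] x /=; first move=> _ <-.
  by exists (const_path R (vertex x)); exact: chained_nil.
move=> /andP[xz /IH + ls] => /(_ ls)[p ps].
by exists (concat_path (edge R xz) p); exact: chained_cons.
Qed.

(* The curve running through the vertices l 0, ..., l N, spending one unit of
   time on each edge. *)
Fixpoint unit_speed N (l : nat -> P) (u : R) : P -> R :=
  if N is n.+1 then
    (if u <= 1 then mix (fun w => (w == l 0%N)%:R) (fun w => (w == l 1%N)%:R) u
     else unit_speed n (fun i => l i.+1) (u - 1))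
  else fun w => (w == l 0%N)%:R.

Lemma unit_speed0 N l : unit_speed N l 0 = fun w => (w == l 0%N)%:R.
Proof. by case: N => //= n; rewrite ler01; apply/funext => w; rewrite /mix; ring. Qed.

Lemma unit_speedN N l : unit_speed N l N%:R = fun w => (w == l N)%:R.
Proof.
elim: N l => //= -[|n] IH l.
  by rewrite lexx; apply/funext => w; rewrite /mix; ring.
rewrite ifF; last by apply/negbTE; rewrite -ltNge ltr1n.
by rewrite -(natr1 n.+1) addrK IH.
Qed.

Lemma unit_speed_continuous N l w : continuous (fun u => unit_speed N l u w).
Proof.
elim: N l => [|n IH] l /=; first by move=> u; exact: cvg_cst.
rewrite (_ : (fun u => _) = fun u => if u <= 1 then
    mix (fun w => (w == l 0%N)%:R) (fun w => (w == l 1%N)%:R) u w else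
    unit_speed n (fun i => l i.+1) (u - 1) w); last first.
  by apply/funext => u; case: ifP.
apply: (@paste_continuous R R R (fun u => u) 1).
- by move=> u; exact: cvg_id.
- rewrite /mix; have cid : continuous (fun u : R => u) by move=> u; exact: cvg_id.
  by real_continuity.
- move=> u; apply: (@continuous_comp R R R (fun u : R => u - 1)
    (fun u : R => unit_speed n (fun i => l i.+1) u w)); last exact: IH.
  by apply: cvgB; [exact: cvg_id|exact: cvg_cst].
- by move=> u ->; rewrite subrr unit_speed0 /mix; ring.
Qed.

(** The bound on [i] is the window condition of [labels], so a labelled curve has in its support
    every vertex that carries the unit-speed curve at the same time. *)
Lemma unit_speed_support N l u w : 0 <= u <= N%:R -> unit_speed N l u w != 0 ->
  exists2 i, (i <= N)%N & l i = w /\ `|u - i%:R| < 1.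
Proof.
elim: N l u => [|n IH] l u /=.
  case/andP=> u0 u1; rewrite pnatr_eq0 eqb0 negbK => /eqP->; exists 0%N => //.
  by rewrite ltr_norml; split=> //; lra.
case/andP=> u0 un; case: ifPn => [u1|]; last first.
  rewrite -ltNge => u1 /IH[|i ni [lw ui]]; first by rewrite -natr1 in un; lra.
  by exists i.+1 => //; split=> //; rewrite -natr1 opprD addrA addrAC.
have [l0w|wl0] := eqVneq (l 0%N) w; rewrite /mix.
  rewrite l0w eqxx; have [uE|uE] := eqVneq u 1.
    rewrite uE subrr mul0r add0r mul1r pnatr_eq0 eqb0 negbK => /eqP wl1.
    by exists 1%N => //; split=> //; rewrite subrr normr0.
  have u1' : u < 1 by rewrite lt_neqAle uE.
  by move=> _; exists 0%N => //; split=> //; rewrite ltr_norml; lra.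
rewrite [w == l 0%N]eq_sym (negbTE wl0) mulr0 add0r mulf_eq0 negb_or => /andP[uN0].
rewrite pnatr_eq0 eqb0 negbK => /eqP->; exists 1%N => //; split=> //.
have u0' : 0 < u by rewrite lt_def uN0.
by rewrite ltr_norml; lra.
Qed.

Lemma unit_speed_ge0 N l u w : 0 <= u -> 0 <= unit_speed N l u w.
Proof.
elim: N l u => [|n IH] l u u0 /=; first by rewrite ler0n.
case: ifPn => [u1|]; last by rewrite -ltNge => u1; apply: IH; lra.
by rewrite /mix addr_ge0// mulr_ge0// ?ler0n//; lra.
Qed.

Lemma sum_delta v : \sum_w (w == v)%:R = 1 :> R.
Proof. exact: (coord_sum (vertex v)). Qed.

Lemma unit_speed_sum N l u : \sum_w unit_speed N l u w = 1.
Proof.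
elim: N l u => [|n IH] l u /=; first exact: sum_delta.
case: ifPn => _; last exact: IH.
by rewrite big_split/= -!mulr_sumr !sum_delta; ring.
Qed.

Definition edges N (l : nat -> P) := forall i, (i < N)%N -> compar (l i) (l i.+1).

(** Two indices at distance less than one from the same time are equal or consecutive, so the
    support is a vertex or an edge. *)
Lemma unit_speed_in N l t : edges N l ->
  (unit_speed N l (N%:R * uval t) : {ptws P -> R}) \in
    realization R P (order_complex P).
Proof.
move=> lN; have /andP[t0 t1] := uval_itv t.
have N0 : 0 <= N%:R :> R by rewrite ler0n.
have u0 : 0 <= N%:R * uval t by rewrite mulr_ge0.
have uN : 0 <= N%:R * uval t <= N%:R by rewrite u0/=; nra.
apply: realizationI => [w||v w]; [exact: unit_speed_ge0|exact: unit_speed_sum|].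
move=> /(unit_speed_support uN)[i iN [<- hi]] /(unit_speed_support uN)[j jN [<- hj]].
set u := N%:R * uval t in hi hj.
wlog ij : i j iN jN hi hj / (i <= j)%N.
  move=> h; have [ij|ji] := leqP i j; first exact: h.
  by rewrite compar_sym; apply: h => //; exact: ltnW.
move: ij; rewrite leq_eqVlt => /orP[/eqP->|ij]; first exact: compar_refl.
suff -> : j = i.+1 by apply: lN; exact: leq_trans ij jN.
apply/eqP; rewrite eqn_leq ij andbT -ltnS -(ltr_nat R) -!natr1.
by move: hi hj; rewrite !ltr_norml; lra.
Qed.

Section UnitSpeedPath.
Context N (l : nat -> P) (lN : edges N l).

Definition unit_speed_fun t : X := SigSub (unit_speed_in t lN).

Lemma unit_speed_fun_continuous : continuous unit_speed_fun.
Proof.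
apply: into_continuous => v t.
have cu : continuous (fun t : I => N%:R * uval t) by real_continuity.
apply: (@continuous_comp I R R _ (fun u : R => unit_speed N l u v) _ (cu t)).
exact: unit_speed_continuous.
Qed.

Lemma unit_speed_fun0 : unit_speed_fun zero = vertex (l 0%N).
Proof. by apply: coord_inj => v; rewrite /coord/= uval0 mulr0 unit_speed0. Qed.

Lemma unit_speed_fun1 : unit_speed_fun one = vertex (l N).
Proof. by apply: coord_inj => v; rewrite /coord/= uval1 mulr1 unit_speedN. Qed.

Definition unit_speed_path : {path I from vertex (l 0%N) to vertex (l N) in X} :=
  mk_path unit_speed_fun_continuous unit_speed_fun0 unit_speed_fun1.

End UnitSpeedPath.

Lemma coord_unit_speed N l (lN : edges N l) t w :
  coord (unit_speed_path lN t) w = unit_speed N l (N%:R * uval t) w.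
Proof. by []. Qed.

Lemma coord_edge v w (vw : compar v w) t u :
  coord (edge R vw t) u = mix (fun u => (u == v)%:R) (fun u => (u == w)%:R) (uval t) u.
Proof. by []. Qed.

Lemma unit_speed_concat n l (lN : edges n.+2 l) (l0 : compar (l 0%N) (l 1%N))
    (lS : edges n.+1 (fun i => l i.+1)) :
  path_homotopic (concat_path (edge R l0) (unit_speed_path lS)) (unit_speed_path lN).
Proof.
have n0 : 0 <= n%:R :> R by rewrite ler0n.
have n2 : 0 < n.+2%:R :> R by rewrite ltr0n.
have n1E : n.+1%:R = n%:R + 1 :> R by rewrite natr1.
have n2E : n.+2%:R = n%:R + 2 :> R by rewrite -(natr1 n.+1) n1E; ring.
(* The concatenation spends half the time on the first edge and half on the other [n.+1]. On the
   clock of [unit_speed] this is [2t], then [1 + (2t - 1)(n + 1)]; the second line is at least as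
   steep and meets the first at [t = 1/2], so the maximum picks the right branch. *)
apply: (@path_homotopic_reparam _ _ _ _ _ _ (unit_speed_path lN)
  (fun t => Num.max (2 * uval t) (1 + (2 * uval t - 1) * n.+1%:R) / n.+2%:R)
  (@uval R)).
- exact: (@cts_fun _ _ (unit_speed_path lN)).
- by real_continuity.
- by real_continuity.
- by rewrite uval0 n1E !mulr0 max_l ?mul0r//; lra.
- rewrite uval1 n1E max_r; last lra.
  by rewrite (_ : 1 + _ = n.+2%:R) ?divff ?gt_eqF// n2E; ring.
- move=> t; have /andP[t0 t1] := uval_itv t; apply: coord_inj => w.
  rewrite coord_unit_speed clampK; last first.
    rewrite divr_ge0 ?ler0n//=; last by rewrite le_max; apply/orP; left; lra.
    by rewrite ler_pdivrMr// mul1r ge_max n1E n2E; apply/andP; split; nra.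
  rewrite [_%:R * _]mulrC divfK ?gt_eqF//.
  rewrite -[concat_path _ _ t]/(concat_fun _ _ t) /concat_fun.
  case: (leP (uval t) 2^-1) => t2.
    rewrite max_l; last by rewrite n1E; nra.
    rewrite coord_edge clampK; last lra.
    by rewrite [unit_speed n.+2 _ _ _]/= ifT//; lra.
  rewrite max_r; last by rewrite n1E; nra.
  rewrite [unit_speed n.+2 _ _ _]/= ifF; last by apply/negbTE; rewrite -ltNge n1E; nra.
  rewrite coord_unit_speed clampK; last lra.
  congr (unit_speed n.+1 _ _ w).
  by rewrite n1E; ring.
- by move=> t; rewrite uvalK.
Qed.

Lemma unit_speed_chained N l (lN : edges N l) : (0 < N)%N ->
  exists s (p : {path I from vertex (l 0%N) to vertex (l N) in X}),
    [/\ path compar (l 0%N) s, last (l 0%N) s = l N, chained s p &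
        path_homotopic (unit_speed_path lN) p].
Proof.
case: N lN => // n; elim: n l => [|n IH] l lN _.
  have l0 := lN 0%N isT.
  exists [:: l 1%N], (concat_path (edge R l0) (const_path R (vertex (l 1%N)))).
  split=> //=; first by rewrite l0.
    by apply: chained_cons; exact: chained_nil.
  apply: path_homotopic_trans (path_homotopic_sym (path_homotopic_concatp1 _)).
  rewrite (_ : unit_speed_path lN = edge R l0); first exact: path_homotopic_refl.
  apply/path_eqP => t; apply: coord_inj => w.
  have /andP[t0 t1] := uval_itv t.
  by rewrite coord_unit_speed coord_edge mul1r /= t1.
have l0 := lN 0%N isT.
have lS : edges n.+1 (fun i => l i.+1) by move=> i iN; exact: lN.
have [s [p [ps ls sp hp]]] := IH _ lS isT.
exists (l 1%N :: s), (concat_path (edge R l0) p); split=> //=; first by rewrite l0.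
  exact: chained_cons.
apply: path_homotopic_trans (path_homotopic_sym (unit_speed_concat lN l0 lS)) _.
exact: path_homotopic_concatr.
Qed.

Lemma labels_edges N l (f : I -> X) : labels N l f -> edges N l.
Proof.
move=> lf i iN; have N0 : 0 < N%:R :> R by rewrite ltr0n (leq_trans _ iN).
have iN' : i%:R + 1 <= N%:R :> R by rewrite natr1 ler_nat.
have i0 : 0 <= i%:R :> R by rewrite ler0n.
pose t : I := clamp ((i%:R + 2^-1) / N%:R).
have tE : N%:R * uval t = i%:R + 2^-1.
  rewrite clampK; first by rewrite mulrC divfK ?gt_eqF.
  apply/andP; split; last by rewrite ler_pdivrMr// mul1r; lra.
  by apply: divr_ge0; lra.
apply: (@coord_compar _ _ _ (f t)); apply: lf; rewrite ?(ltnW iN)// tE.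
  by rewrite ltr_norml; lra.
by rewrite -(natr1 i) ltr_norml; lra.
Qed.

(** Simplicial approximation: the unit-speed curve through the labels of [p] is contiguous to [p],
    hence homotopic to it by straight lines. *)
Lemma homotopic_chained v w (p : {path I from vertex v to vertex w in X}) :
  exists s (q : {path I from vertex v to vertex w in X}),
    [/\ path compar v s, last v s = w, chained s q & path_homotopic p q].
Proof.
have [N [l [N0 lp]]] := labels_exist (@cts_fun _ _ p).
have l0 : l 0%N = v by apply: (labels_zero lp); exact: path_zero.
have lN : l N = w by apply: (labels_one lp); exact: path_one.
case: v / l0 p lp => p lp; case: w / lN p lp => p lp.
have lE := labels_edges lp.
have [s [q [ps ls sq hq]]] := unit_speed_chained lE N0.
exists s, q; split=> //; apply: path_homotopic_trans hq.
apply: path_homotopic_carried => t; apply: carriedP => u.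
have /andP[t0 t1] := uval_itv t.
rewrite coord_unit_speed => /unit_speed_support[|i iN [<- hi]]; last exact: lp.
have : 0 <= N%:R :> R by rewrite ler0n.
by move=> ?; apply/andP; split; nra.
Qed.

End EdgePaths.

(** * Holonomy of continuous paths with respect to a cocycle *)

Section PathHolonomy.
Import Order.TTheory GRing.Theory Num.Theory.
Import numFieldTopology.Exports numFieldNormedType.Exports.
Local Open Scope classical_set_scope.
Local Open Scope ring_scope.
Context (R : realType) (d : Order.disp_t) (P : finPOrderType d).
Local Notation X := (poset_space R P).
Local Notation I := (unit_interval R).
Local Notation vertex := (vertex R).
Local Notation compar := (@compar d P).
Implicit Types (v w x y : P) (t : I).
Context (H : groupType) (c : P -> P -> H).
Hypothesis cP : cocycle compar [set: P]%SET c.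

(** A choice of labelling is hidden here; for paths between vertices the value is independent of it
    by [labels_homotopic], and the default 1 is never reached because labellings exist. *)
Definition path_hol (f : I -> X) : H :=
  xget 1%g [set h | exists N l, [/\ (0 < N)%N, labels N l f & h = lhol c l N]].

Lemma path_hol_labels v w (p q : {path I from vertex v to vertex w in X}) N l :
  path_homotopic p q -> (0 < N)%N -> labels N l q -> path_hol p = lhol c l N.
Proof.
move=> [F [cF F0 F1 Fv Fw]] N0 lq; rewrite /path_hol.
case: xgetP => [h -> [M [m [M0 mp ->]]]|no].
  have -> : lhol c m M = lhol c l N.
    apply: (labels_homotopic cP cF Fv Fw M0 _ N0).
      by move=> t i; rewrite F0; exact: mp.
    by move=> t i; rewrite F1; exact: lq.
  by [].
have [M [m [M0 mp]]] := labels_exist (@cts_fun _ _ p).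
by case: (no (lhol c m M)); exists M, m.
Qed.

Lemma path_holE v w (p : {path I from vertex v to vertex w in X}) N l :
  (0 < N)%N -> labels N l p -> path_hol p = lhol c l N.
Proof. exact/path_hol_labels/path_homotopic_refl. Qed.

Lemma path_hol_homotopic v w (p q : {path I from vertex v to vertex w in X}) :
  path_homotopic p q -> path_hol p = path_hol q.
Proof.
move=> pq; have [M [m [M0 mq]]] := labels_exist (@cts_fun _ _ q).
by rewrite (path_hol_labels pq M0 mq) (path_holE M0 mq).
Qed.

Lemma lhol_cat (l : nat -> P) N M :
  lhol c l (N + M) = (lhol c l N * lhol c (fun i => l (N + i)%N) M)%g.
Proof.
elim: M => [|M IH] /=; first by rewrite addn0 mulg1.
by rewrite !addnS /= IH mulgA.
Qed.

Lemma eq_lhol (l m : nat -> P) N : (forall i, (i <= N)%N -> l i = m i) ->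
  lhol c l N = lhol c m N.
Proof.
by elim: N => //= N IH lm; rewrite IH ?lm// => i iN; apply: lm; exact: leqW.
Qed.

(** Both labellings are refined to the same number [K] of steps, so that the two halves of the
    concatenation form one uniform grid of [K + K] steps. At the junction both prescribe the vertex
    [y]. *)
Lemma path_hol_concat x y z (p : {path I from vertex x to vertex y in X})
    (q : {path I from vertex y to vertex z in X}) :
  path_hol (concat_path p q) = (path_hol p * path_hol q)%g.
Proof.
have [N [l [N0 lp]]] := labels_exist (@cts_fun _ _ p).
have [M [m [M0 mq]]] := labels_exist (@cts_fun _ _ q).
rewrite (path_holE N0 lp) (path_holE M0 mq).
rewrite -(lhol_refine cP l N M0) -(lhol_refine cP m M N0).
have := labels_refine M0 lp; have := labels_refine N0 mq.
rewrite [(M * N)%N]mulnC; set K := (N * M)%N.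
set l' := fun i => l _; set m' := fun i => m _ => m'q l'p.
have K0 : (0 < K)%N by rewrite muln_gt0 N0.
have lm : l' K = m' 0%N.
  by rewrite (labels_one l'p path_one) (labels_zero m'q path_zero).
pose k i := if (i <= K)%N then l' i else m' (i - K)%N.
have kr i : k (K + i)%N = m' i.
  rewrite /k; case: ifPn => [|_]; last by rewrite addKn.
  by rewrite -{2}(addn0 K) leq_add2l leqn0 => /eqP->; rewrite addn0.
have kl i : (i <= K)%N -> k i = l' i by rewrite /k => ->.
have KR : 0 < K%:R :> R by rewrite ltr0n.
rewrite (@path_holE _ _ _ (K + K) k) ?addn_gt0 ?K0//.
  by rewrite lhol_cat (eq_lhol kl) (eq_lhol (fun i _ => kr i)).
move=> t i iKK; rewrite natrD => ti; have /andP[t0 t1] := uval_itv t.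
rewrite -[concat_path _ _ t]/(concat_fun _ _ t) /concat_fun.
case: (leP (uval t) 2^-1) => t2; have [iK|Ki] := leqP i K.
- rewrite kl//; apply: l'p => //; rewrite clampK; last lra.
  by rewrite (_ : K%:R * _ = (K%:R + K%:R) * uval t)//; ring.
- have : K%:R + 1 <= i%:R :> R by rewrite natr1 ler_nat.
  by move: ti; rewrite ltr_norml; nra.
(* In the second half only [i = K] can occur, and that label is also the first one of [q]. *)
- have [iE|iK'] := eqVneq i K.
    have -> : k i = m' 0%N by rewrite iE -(addn0 K) kr.
    apply: m'q => //; rewrite clampK; last lra.
    by move: ti; rewrite iE !ltr_norml => /andP[h1 h2]; apply/andP; split; nra.
  have : i%:R + 1 <= K%:R :> R by rewrite natr1 ler_nat ltn_neqAle iK'.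
  by move: ti; rewrite ltr_norml; nra.
- rewrite -(subnKC (ltnW Ki)) kr; apply: m'q; first by rewrite leq_subLR.
  rewrite clampK; last lra.
  rewrite natrB ?(ltnW Ki)//.
  by rewrite (_ : _ - _ = (K%:R + K%:R) * uval t - i%:R)//; ring.
Qed.

Lemma path_hol_const x : path_hol (const_path R (vertex x)) = 1%g.
Proof.
rewrite (@path_holE _ _ _ 1 (fun=> x))//=; first by rewrite mul1g cocycle_refl.
by move=> t i _ _; rewrite coord_vertex_neq0.
Qed.

Lemma path_hol_edge x y (xy : compar x y) : path_hol (edge R xy) = c x y.
Proof.
rewrite (@path_holE _ _ _ 1 (fun i => if i == 0%N then x else y))//= ?mul1g//.
move=> t [|[|//]] _; have /andP[t0 t1] := uval_itv t.
  rewrite mul1r coord_edge /mix eqxx mulr1 ltr_norml => lt1.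
  have h : 0 <= uval t * (x == y)%:R by rewrite mulr_ge0.
  by rewrite gt_eqF//; lra.
rewrite mul1r coord_edge /mix eqxx mulr1 ltr_norml => lt1.
have h : 0 <= (1 - uval t) * (y == x)%:R by rewrite mulr_ge0//; lra.
by rewrite gt_eqF//; lra.
Qed.

Lemma path_hol_chained x y s (p : {path I from vertex x to vertex y in X}) :
  chained s p -> path_hol p = hol c x s.
Proof.
elim=> {x y s p} [x|x y z s xy p _ IH] /=; first exact: path_hol_const.
by rewrite path_hol_concat path_hol_edge IH.
Qed.

End PathHolonomy.

(** * Homomorphisms from the fundamental group as cocycles *)

Section FreeFundamentalGroup.
Local Open Scope quotient_scope.
Local Open Scope group_scope.
Context (R : realType) (d : Order.disp_t) (P : finPOrderType d).
Local Notation X := (poset_space R P).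
Local Notation I := (unit_interval R).
Local Notation vertex := (vertex R).
Local Notation compar := (@compar d P).
Implicit Types (v w x y : P) (t : I).

Definition path_class (T : topologicalType) (a : T) (p : {path I from a to a in T}) :
  pi1 R a := \pi_(pi1 R a) (p : loop R a).

Lemma path_class_concat (T : topologicalType) (a : T) (p q : {path I from a to a in T}) :
  path_class (concat_path p q) = path_class p * path_class q.
Proof. by rewrite /path_class -[RHS]/(pi1_mul _ _) pi1_mulE. Qed.

Lemma path_class_eq (T : topologicalType) (a : T) (p q : {path I from a to a in T}) :
  path_homotopic p q -> path_class p = path_class q.
Proof. by move/pi1_eqP. Qed.

Lemma edge_concat x y z (xy : compar x y) (yz : compar y z) (xz : compar x z) :
  path_homotopic (concat_path (edge R xy) (edge R yz)) (edge R xz).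
Proof.
have edge_supp u v (uv : compar u v) t w : coord (edge R uv t) w != 0%R ->
    w \in [:: u; v].
  rewrite coord_edge /mix !inE; apply: contraNT.
  by rewrite negb_or => /andP[/negbTE-> /negbTE->]; rewrite !GRing.mulr0 GRing.addr0.
have in3 u v : u \in [:: x; y; z] -> v \in [:: x; y; z] -> compar u v.
  rewrite !inE => /or3P[]/eqP-> /or3P[]/eqP->; rewrite ?compar_refl//;
    by rewrite compar_sym.
have supp t w : (coord (concat_path (edge R xy) (edge R yz) t) w != 0%R) ||
    (coord (edge R xz t) w != 0%R) -> w \in [:: x; y; z].
  case/orP; last by move/edge_supp; rewrite !inE => /orP[]->; rewrite ?orbT.
  rewrite -[concat_path _ _ t]/(concat_fun _ _ t) /concat_fun.
  by case: ifP => _ /edge_supp; rewrite !inE => /orP[]->; rewrite ?orbT.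
by apply: path_homotopic_carried => t u w /supp uS /supp wS; exact: in3.
Qed.

Lemma path_setT v s : path (adj compar [set: P]%SET) v s = path compar v s.
Proof. by apply: eq_path => x y; rewrite /adj !inE. Qed.

Section HomCocycle.
Context (v : P) (H : groupType) (phi : pi1 R (vertex v) -> H).
Hypothesis hphi : group_hom phi.

Let C x := connect compar v x.

Let exT x : C x -> exists p : {path I from vertex v to vertex x in X}, True.
Proof.
by case/connectP=> s ps ls; have [p _] := exists_chained R ps (esym ls); exists p.
Qed.

Let T0 x (Cx : C x) : {path I from vertex v to vertex x in X} := sval (cid (exT Cx)).

(** The prefix makes the path chosen at [v] null-homotopic, so loops at [v] are recovered themselves
    rather than up to conjugation. *)
Let T x (Cx : C x) : {path I from vertex v to vertex x in X} :=
  concat_path (Defs.rev_path (T0 (connect0 compar v))) (T0 Cx).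

Let CS x y : C x -> compar x y -> C y.
Proof. by move=> Cx xy; apply: connect_trans Cx (connect1 xy). Qed.

(** The reflection view supplies the proofs needed to form the edge and the chosen paths. Outside
    the component of [v] the labels are trivial. *)
Let c x y : H :=
  match @andP (C x) (compar x y) with
  | ReflectT xy => phi (path_class
      (conj_path (T (proj1 xy)) (edge R (proj2 xy)) (T (CS (proj1 xy) (proj2 xy)))))
  | ReflectF _ => 1
  end.

Let cE x y (Cx : C x) (xy : compar x y) (Cy : C y) :
  c x y = phi (path_class (conj_path (T Cx) (edge R xy) (T Cy))).
Proof.
rewrite /c; case: andP => [h|[]//].
by rewrite (bool_irrelevance Cx (proj1 h)) (bool_irrelevance xy (proj2 h))
  (bool_irrelevance Cy (CS (proj1 h) (proj2 h))).
Qed.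

Let c_cocycle : cocycle compar [set: P]%SET c.
Proof.
move=> x y z _ _ _ xy yz xz; have [Cx|nCx] := boolP (C x).
  have Cy := CS Cx xy; have Cz := CS Cy yz.
  rewrite (cE Cx xy Cy) (cE Cy yz Cz) (cE Cx xz Cz) -hphi; congr (phi _).
  rewrite -path_class_concat; apply: path_class_eq.
  apply: path_homotopic_trans (conj_path_concat _ _ _ _ _) _.
  exact/conj_path_homotopic/edge_concat.
have out u w : ~~ C u -> c u w = 1.
  by move=> Cu; rewrite /c; case: andP => // -[Cu']; rewrite Cu' in Cu.
rewrite !out ?mulg1//; apply: contra nCx => Cy.
by apply: (CS Cy); rewrite compar_sym.
Qed.

Let c_chained x y s (p : {path I from vertex x to vertex y in X}) :
  chained s p -> forall (Cx : C x) (Cy : C y),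
  hol c x s = phi (path_class (conj_path (T Cx) p (T Cy))).
Proof.
elim=> {x y s p} [x|x y z s xy p _ IH] Cx Cz /=.
  rewrite (bool_irrelevance Cz Cx) -(group_hom1 hphi); congr (phi _).
  exact/esym/path_class_eq/conj_path_self.
have Cy := CS Cx xy; rewrite (IH Cy Cz) (cE Cx xy Cy) -hphi; congr (phi _).
rewrite -path_class_concat; apply: path_class_eq.
exact: conj_path_concat.
Qed.

(** Converse to [path_hol]: along an edge path the chosen paths cancel, so the holonomy is the value
    of the homomorphism. *)
Lemma hom_cocycle : exists2 c : P -> P -> H, cocycle compar [set: P]%SET c &
  forall s (p : {path I from vertex v to vertex v in X}),
    chained s p -> hol c v s = phi (path_class p).
Proof.
exists c; first exact: c_cocycle.
move=> s p sp; pose Cv := connect0 compar v; rewrite (c_chained sp Cv Cv).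
congr (phi _); apply: path_class_eq.
have T1 : path_homotopic (T Cv) (const_path R (vertex v)).
  exact: path_homotopic_concatVp.
apply: path_homotopic_trans (path_homotopic_concatl _ T1) _.
apply: path_homotopic_trans (path_homotopic_concat1p _) _.
apply: path_homotopic_trans (path_homotopic_concatr _ (path_homotopic_rev T1)) _.
rewrite (_ : Defs.rev_path _ = const_path R (vertex v)).
  exact: path_homotopic_concatp1.
exact/path_eqP.
Qed.

End HomCocycle.

(** Existence of homomorphisms comes from [path_hol]; uniqueness comes from [hom_cocycle], since
    every loop is homotopic to an edge loop. The base point is first moved to a vertex of its
    carrier. *)
Lemma is_free_pi1 (x : X) : pi1_free compar [set: P]%SET ->
  is_free_group (pi1 R x).
Proof.
move=> fP; have [v xv] := coord_support x.
have vx : carried (coord x) (coord (vertex v)).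
  by apply: carriedP => w; rewrite coord_vertex_neq0 => /eqP->.
apply: (is_free_pi1_base (Defs.rev_path (segment vx))) => {x xv vx}.
have [B [l [ll lE lU]]] := fP v (in_setT v).
have lp b : path compar v (l b) /\ last v (l b) = v.
  by have /andP[+ /eqP] := ll b; rewrite path_setT.
have /choice[q qP] : forall b, exists p : {path I from vertex v to vertex v in X},
    chained (l b) p.
  by move=> b; have [pb lb] := lp b; exact: exists_chained.
apply: (@free_group_family _ B (fun b => path_class (q b))) => [H f|H phi psi hphi hpsi E].
  have [c [cP cf]] := lE H f.
  pose phi (z : pi1 R (vertex v)) : H :=
    path_hol c (repr z : {path I from vertex v to vertex v in X}).
  have phiE (p : {path I from vertex v to vertex v in X}) :
      phi (path_class p) = path_hol c p.
    by apply: (path_hol_homotopic cP); apply/pi1_eqP; rewrite reprK.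
  exists phi; split=> [|b]; last by rewrite phiE (path_hol_chained cP (qP b)).
  elim/quotW=> p1; elim/quotW=> p2.
  by rewrite -path_class_concat !phiE (path_hol_concat cP).
have [c cP cphi] := hom_cocycle hphi; have [c' c'P cpsi] := hom_cocycle hpsi.
elim/quotW=> p; have [s [p' [ps ls sp' pp']]] := homotopic_chained p.
rewrite -[\pi_(pi1 R (vertex v)) p]/(path_class p) (path_class_eq pp').
rewrite -(cphi _ _ sp') -(cpsi _ _ sp'); apply: lU => // [b|].
  by rewrite (cphi _ _ (qP b)) (cpsi _ _ (qP b)).
by rewrite /edge_loop path_setT ps ls eqxx.
Qed.

End FreeFundamentalGroup.

(** * Elementary abelian subgroups *)

Section Poset.
Local Open Scope group_scope.

Section ElementaryAbelianAbove.
Context (gT : finGroupType) (p : nat).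
Implicit Types (A B D E F K L M N : {group gT}).

Definition gle : rel {group gT} := fun E F => E \subset F.

(** For [D = 1] these are the vertices of [A_p(L)]; for general [D] the same notion describes upper
    intervals. *)
Definition elem_above D L : {set {group gT}} := [set E in 'E_p(L) | D \proper E].

Definition rk D E : nat := logn p #|E| - logn p #|D|.

Lemma gle_refl : reflexive gle. Proof. by move=> E; exact: subxx. Qed.

Lemma gle_trans : transitive gle.
Proof. by move=> F E H EF; exact: subset_trans. Qed.

Lemma elem_aboveP D L E :
  reflect [/\ E \subset L, p.-abelem E & D \proper E] (E \in elem_above D L).
Proof.
rewrite inE; apply: (iffP andP) => [[/pElemP[EL pE] DE]//|[EL pE DE]].
by split=> //; apply/pElemP.
Qed.

Lemma abelem_joing E F : p.-abelem E -> p.-abelem F -> F \subset 'C(E) ->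
  p.-abelem (E <*> F).
Proof.
move=> pE pF cEF; have EF : E \* F = E <*> F by rewrite cprodEY.
by rewrite (cprod_abelem p EF) pE pF.
Qed.

Section Ranks.
Context (D L : {group gT}).
Hypothesis p_pr : prime p.

Lemma elem_above_card E : E \in elem_above D L -> #|E| = (p ^ logn p #|E|)%N.
Proof. by case/elem_aboveP=> _ /abelem_pgroup/card_pgroup. Qed.

Lemma elem_above_logn E : E \in elem_above D L -> logn p #|D| < logn p #|E|.
Proof.
case/elem_aboveP=> _ /abelem_pgroup pE DE.
rewrite -(ltn_exp2l _ _ (prime_gt1 p_pr)) -(card_pgroup pE).
by rewrite -(card_pgroup (pgroupS (proper_sub DE) pE)) proper_card.
Qed.

Lemma rk_gt0 E : E \in elem_above D L -> 0 < rk D E.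
Proof. by move=> EL; rewrite subn_gt0 elem_above_logn. Qed.

Lemma rk_mono E F : E \in elem_above D L -> F \in elem_above D L ->
  gle E F -> rk D E <= rk D F.
Proof.
by move=> EL FL EF; apply: leq_sub2r; rewrite dvdn_leq_log// cardSg.
Qed.

Lemma rk_inj E F : E \in elem_above D L -> F \in elem_above D L ->
  gle E F -> rk D E = rk D F -> E = F.
Proof.
move=> EL FL EF rEF; apply/val_inj/eqP; rewrite /= eqEcard [_ \subset _]EF /=.
rewrite (elem_above_card EL) (elem_above_card FL) leq_exp2l ?prime_gt1//.
rewrite -(subnK (ltnW (elem_above_logn EL))) [X in X + _]rEF.
by rewrite subnK// ltnW// elem_above_logn.
Qed.

End Ranks.

(** Each [E] is linked to [K] through [E <*> K], which is elementary abelian because [K] is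
    central. *)
Lemma cone_elem_conn D L K : K \in elem_above D L -> K \subset 'Z(L) ->
  conn (cmp gle) (elem_above D L).
Proof.
case/elem_aboveP=> KL pK DK KZ.
have KinL : K \in elem_above D L by apply/elem_aboveP.
apply: connI => [|k kP]; first exact: cmp_sym.
suff kK E : E \in elem_above D L -> k E = k K by move=> E F /kK-> /kK->.
move=> EL; have /elem_aboveP[EsL pE DE] := EL.
have EK : (E <*> K)%G \in elem_above D L.
  apply/elem_aboveP; split; first by rewrite join_subG EsL.
    apply: abelem_joing => //; apply: subset_trans KZ _.
    by rewrite subIset// [in X in _ || X]centS ?orbT.
  exact: proper_sub_trans DE (joing_subl _ _).
rewrite (kP E (E <*> K)%G)//; last by rewrite /cmp /gle joing_subl.
by apply: kP => //; rewrite /cmp /gle joing_subr orbT.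
Qed.

(* Quillen's contraction E <= E C >= C <= K with C = C_K(E); the last two
   inclusions are not monotone in E, but they are compatible up to homotopy. *)
Lemma normal_elem_acyclic L K : K <| L -> p.-abelem K -> K :!=: 1 -> prime p ->
  acyclic (cmp gle) (elem_above 1 L).
Proof.
move=> /andP[KL nKL] pK ntK p_pr.
have S1 E : (E \in elem_above 1 L) = [&& E \subset L, p.-abelem E & E :!=: 1].
  by apply/elem_aboveP/and3P; rewrite proper1G => -[].
pose C E := 'C_K(E)%G.
have CK E : C E \subset K by exact: subsetIl.
have CE E : C E \subset 'C(E) by exact: subsetIr.
have CS E F : E \subset F -> C F \subset C E.
  by move=> EF; apply: setIS; exact: centS.
have CI E : E \in elem_above 1 L -> C E \in elem_above 1 L.
  rewrite !S1 => /and3P[EL /abelem_pgroup pE _].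
  rewrite (abelemS (CK E) pK) (subset_trans (CK E) KL)/=.
  have nKE : E \subset 'N(K) by exact: subset_trans EL nKL.
  have pKE : p.-group (K <*> E) by rewrite norm_joinEr// pgroupM (abelem_pgroup pK).
  (* A non-trivial normal subgroup of the [p]-group [K E] meets its centre, and this intersection
     centralizes [E]. *)
  have /(meet_center_nil (pgroup_nil pKE))/(_ ntK) : K <| K <*> E.
    by rewrite /normal joing_subl join_subG normG.
  rewrite -!subG1; apply: contra; apply: subset_trans.
  by rewrite setIS// subIset// centS ?orbT// joing_subr.
pose J E F := (E <*> C F)%G.
have JI E F : E \in elem_above 1 L -> F \in elem_above 1 L -> E \subset F ->
    J E F \in elem_above 1 L.
  move=> ES FS EF; have := CI _ FS; move: ES; rewrite !S1.
  move=> /and3P[EL pE ntE] /and3P[CL pC ntC].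
  rewrite join_subG EL CL abelem_joing//=; last exact: subset_trans (CE F) (centS EF).
  by apply: contra ntE; rewrite -!subG1; apply: subset_trans; exact: joing_subl.
have KI : K \in elem_above 1 L by rewrite S1 KL pK.
move=> H c cP.
(* The contraction from [K] to [E], read as a potential by multiplying the labels along it. *)
pose g E := c K (C E) * c (C E) (J E E) * c (J E E) E.
have cc E F M : E \in elem_above 1 L -> F \in elem_above 1 L ->
    M \in elem_above 1 L -> cmp gle E F -> cmp gle F M -> cmp gle E M ->
    c E F * c F M = c E M by exact: cP.
have up E F : E \subset F -> cmp gle E F by rewrite /cmp /gle => ->.
have dn E F : F \subset E -> cmp gle E F by rewrite /cmp /gle orbC => ->.
have gP E F : E \in elem_above 1 L -> F \in elem_above 1 L -> E \subset F ->
    g F = g E * c E F.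
  (* [W = E C_K(F)] lies in both [E C_K(E)] and [F C_K(F)], so the routes to [E] and to [F] can be
     compared through [C_K(F)] and [W]. *)
  move=> ES FS EF; pose W := J E F.
  have EE : E \subset E by [].
  have FF : F \subset F by [].
  have CES := CI E ES; have CFS := CI F FS.
  have JES := JI E E ES ES EE; have JFS := JI F F FS FS FF.
  have WS : W \in elem_above 1 L := JI E F ES FS EF.
  have CFE := CS _ _ EF.
  have EW : E \subset W by exact: joing_subl.
  have CW : C F \subset W by exact: joing_subr.
  have EJ : E \subset J E E by exact: joing_subl.
  have CJ : C E \subset J E E by exact: joing_subr.
  have FJ : F \subset J F F by exact: joing_subl.
  have CJF : C F \subset J F F by exact: joing_subr.
  have WJ : W \subset J E E by rewrite join_subG EJ (subset_trans CFE).
  have WJF : W \subset J F F by rewrite join_subG CJF (subset_trans EF).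
  have -> : g E = c K (C F) * c (C F) W * c W E.
    rewrite -(cc W (J E E) E WS JES ES (up _ _ WJ) (dn _ _ EJ) (dn _ _ EW)).
    rewrite mulgA -(mulgA (c K (C F))).
    rewrite (cc (C F) W (J E E) CFS WS JES (up _ _ CW) (up _ _ WJ)); last first.
      by apply: up; exact: subset_trans CW WJ.
    rewrite -(cc (C F) (C E) (J E E) CFS CES JES (up _ _ CFE) (up _ _ CJ)); last first.
      by apply: up; exact: subset_trans CW WJ.
    rewrite mulgA.
    by rewrite (cc K (C F) (C E) KI CFS CES (dn _ _ (CK F)) (up _ _ CFE) (dn _ _ (CK E))).
  rewrite -(cc E (J F F) F ES JFS FS (up _ _ (subset_trans EF FJ)) (dn _ _ FJ) (up _ _ EF)).
  rewrite mulgA -(mulgA _ (c W E)).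
  rewrite (cc W E (J F F) WS ES JFS (dn _ _ EW) (up _ _ (subset_trans EF FJ)) (up _ _ WJF)).
  rewrite -(mulgA _ (c (C F) W)).
  by rewrite (cc (C F) W (J F F) CFS WS JFS (up _ _ CW) (up _ _ WJF) (up _ _ CJF)).
exists g => E F ES FS /orP[] EF; first by rewrite (gP E F)// mulKg.
rewrite (gP F E)// invgM mulgKV.
exact: (cocycleV (cmp_refl gle_refl) (@cmp_sym _ gle) cP FS ES (up _ _ EF)).
Qed.

End ElementaryAbelianAbove.

End Poset.

Arguments gle {gT}.

(** * Quotients by p'-groups, complements and the inductions on the order *)

Section Solvable.
Local Open Scope group_scope.

Section Quotient.
Context (gT : finGroupType) (p : nat) (L M D : {group gT}).
Hypotheses (p_pr : prime p) (nML : M <| L) (pM : p^'.-group M).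
Hypotheses (DL : D \subset L) (pD : p.-group D).
Implicit Types (B E F : {group gT}).

Lemma quotient_p'_card E : E \subset L -> p.-group E -> #|E / M| = #|E|.
Proof.
move=> EL pE; apply/esym/card_isog/quotient_isog.
  exact: subset_trans EL (normal_norm nML).
by apply: coprime_TIg; rewrite coprime_sym (pnat_coprime pE).
Qed.

Lemma quotient_rk E : E \in elem_above p D L ->
  rk p (D / M) (E / M) = rk p D E.
Proof.
case/elem_aboveP=> EL pE _; rewrite /rk /= !quotient_p'_card//.
exact: abelem_pgroup pE.
Qed.

Lemma quotient_elem_above E : E \in elem_above p D L ->
  (E / M)%G \in elem_above p (D / M)%G (L / M)%G.
Proof.
case/elem_aboveP=> EL pE DE; apply/elem_aboveP; split=> /=.
- exact: quotientS.
- exact: quotient_abelem.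
rewrite properEcard quotientS ?proper_sub//= !quotient_p'_card ?proper_card//.
exact: abelem_pgroup pE.
Qed.

(** A Sylow subgroup of the preimage of [y] containing [D] maps onto a Sylow subgroup of the
    [p]-group [y], hence onto [y], and isomorphically since [M] is a p'-group. *)
Lemma quotient_elem_above_lift (y : {group coset_of M}) :
  y \in elem_above p (D / M)%G (L / M)%G ->
  exists2 B, B \in elem_above p D L & (B / M)%G = y.
Proof.
case/elem_aboveP=> /= yL py Dy.
pose J := (coset M @*^-1 y)%G.
have JL : J \subset L by rewrite sub_cosetpre_quo.
have DJ : D \subset J.
  rewrite -sub_quotient_pre; first exact: proper_sub.
  exact: subset_trans DL (normal_norm nML).
have [B sylB DB] := Sylow_superset DJ pD.
have BJ := pHall_sub sylB; have BL := subset_trans BJ JL.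
have pB := pHall_pgroup sylB.
have ByE : B / M = y.
  have nMB : B \subset 'N(M) by exact: subset_trans BL (normal_norm nML).
  have := quotient_pHall nMB sylB; rewrite /= cosetpreK => hB.
  by rewrite -(sub_pHall hB (abelem_pgroup py) (pHall_sub hB)).
exists B; last exact/val_inj.
apply/elem_aboveP; split=> //.
  have isoB : B \isog B / M.
    apply: quotient_isog; first exact: subset_trans BL (normal_norm nML).
    by apply: coprime_TIg; rewrite coprime_sym (pnat_coprime pB).
  by rewrite (isog_abelem isoB) /= ByE.
rewrite properEcard DB -(quotient_p'_card DL pD) -(quotient_p'_card BL pB) ByE.
exact: proper_card.
Qed.

(** The fibre is again a poset of the same kind, now for [M <*> B], to which induction on the normal
    p'-subgroup applies. *)
Lemma fibre_quotient B : B \in elem_above p D L ->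
  fibre gle (elem_above p D L) (fun E => (E / M)%G) (B / M)%G =
  elem_above p D (M <*> B)%G.
Proof.
case/elem_aboveP=> BL pB DB; have nMB := subset_trans BL (normal_norm nML).
apply/setP=> E; rewrite inE; apply/andP/elem_aboveP => [[/elem_aboveP[EL pE DE]]|].
  rewrite /gle quotientSK ?(subset_trans EL (normal_norm nML))//= => EMB.
  by split=> //; rewrite /= norm_joinEr.
case=> EMB pE DE; rewrite /= norm_joinEr// in EMB.
have EL : E \subset L by rewrite (subset_trans EMB)// mul_subG// normal_sub.
split; first by apply/elem_aboveP.
by rewrite /gle quotientSK// (subset_trans EL (normal_norm nML)).
Qed.

End Quotient.

Section Complemented.
Context (gT : finGroupType) (p : nat) (L N A D : {group gT}).
Hypotheses (p_pr : prime p) (nNL : N <| L) (pN : p^'.-group N).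
Hypotheses (NA : N * A = L) (pA : p.-abelem A).
Hypotheses (DA : D \subset A) (DZ : D \subset 'Z(L)).
Implicit Types (E F : {group gT}).

Lemma complement_Sylow : p.-Sylow(L) A.
Proof.
have AL : A \subset L by rewrite -NA mulG_subr.
apply/and3P; split=> //; first exact: abelem_pgroup pA.
rewrite -divgS// -NA coprime_cardMg ?mulnK ?cardG_gt0//.
by rewrite coprime_sym (pnat_coprime (abelem_pgroup pA)).
Qed.

(** [A] is a Sylow subgroup, so [E] lies in a conjugate of it; conjugation preserves [N] and the
    central [D]. *)
Lemma elem_above_sub_complement E : E \in elem_above p D L ->
  exists2 F : {group gT}, E \subset F &
    [/\ N * F = L, p.-abelem F, D \subset F & #|F| = #|A|].
Proof.
case/elem_aboveP=> EL pE DE.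
have [x xL ExA] := Sylow_Jsub complement_Sylow EL (abelem_pgroup pE).
exists (A :^ x^-1)%G; first by rewrite /= -sub_conjg.
split; rewrite /= ?abelemJ ?cardJg//.
  have nN : N :^ x^-1 = N.
    by apply: normP; rewrite (subsetP (normal_norm nNL))// groupV.
  by rewrite -{1}nN -conjsMg NA conjGid// groupV.
rewrite -sub_conjg (_ : D :^ x = D)//.
apply: normP; apply: (subsetP (cent_sub _)); apply: (subsetP _ _ xL).
by rewrite centsC (subset_trans DZ)// subsetIr.
Qed.

Lemma above_elem_neq0 E : E \in elem_above p D L -> rk p D E < rk p D A ->
  above gle (elem_above p D L) E != set0.
Proof.
move=> EDL rEA; have [F EF [NF pF DF FA]] := elem_above_sub_complement EDL.
apply/set0Pn; exists F; have /elem_aboveP[EL pE DE] := EDL.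
have FE : F != E.
  by apply: contraTneq rEA => <-; rewrite /rk FA ltnn.
rewrite inE FE /gle EF !andbT; apply/elem_aboveP; split=> //.
  by rewrite -NF mulG_subr.
exact: proper_sub_trans DE EF.
Qed.

End Complemented.

(** As [N] is abelian and [L = N A], it is an irreducible module for [A]; by Schur's lemma an
    abelian group acting faithfully and irreducibly is cyclic. *)
Lemma minnormal_cyclic_quotient (gT : finGroupType) (L N A : {group gT}) :
  N * A = L -> minnormal N L -> is_abelem N -> abelian A ->
  cyclic (A / 'C_A(N)).
Proof.
move=> NA minN /is_abelemP[q q_pr qN] abA.
have /mingroupP[/andP[ntN nNL] minN'] := minN.
have nNA : A \subset 'N(N) by rewrite (subset_trans _ nNL)// -NA mulG_subr.
have minNA : minnormal N A.
  apply/mingroupP; split=> [|K /andP[ntK nKA] KN]; first by rewrite ntN.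
  (* A subgroup of [N] normalized by [A] is centralized by the abelian [N], hence normalized by
     [L]. *)
  apply: minN' => //; rewrite ntK -NA mul_subG//.
  by rewrite cents_norm// (subset_trans (abelem_abelian qN))// centS.
have irr := elimT (abelem_mx_irrP qN ntN nNA) minNA.
have := center_kquo_cyclic irr; rewrite (rker_abelem qN ntN nNA).
by rewrite (center_idP _) ?quotient_abelian.
Qed.

Section CyclicCentralizer.
Context (gT : finGroupType) (p : nat) (L N A D : {group gT}).
Hypotheses (p_pr : prime p) (NA : N * A = L) (pA : p.-abelem A).
Hypotheses (DA : D \subset A) (DZ : D \subset 'Z(L)).
Hypotheses (cycA : cyclic (A / 'C_A(N))) (rA : 1 < rk p D A).

(** The cyclic quotient [A / C_A(N)] is elementary abelian, so of order at most [p]; rank at least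
    two over [D] leaves [C_A(N)] strictly larger than [D]. *)
Lemma centralizer_elem_above :
  'C_A(N)%G \in elem_above p D L /\ 'C_A(N) \subset 'Z(L).
Proof.
have KA : 'C_A(N) \subset A := subsetIl _ _.
have AL : A \subset L by rewrite -NA mulG_subr.
have KZ : 'C_A(N) \subset 'Z(L).
  rewrite subsetI (subset_trans KA AL) -NA centM subsetI subsetIr.
  exact: subset_trans KA (abelem_abelian pA).
split=> //; apply/elem_aboveP; split.
- exact: subset_trans KA AL.
- exact: abelemS pA.
have DK : D \subset 'C_A(N).
  rewrite subsetI DA (subset_trans DZ)// subIset// centS ?orbT//.
  by rewrite -NA mulG_subl.
rewrite properEcard DK /=.
have nKA : A \subset 'N('C_A(N)).
  exact: cents_norm (subset_trans (abelem_abelian pA) (centS KA)).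
have := cycA; rewrite (@abelem_cyclic _ p) ?quotient_abelem//.
rewrite card_quotient// => iA.
have := rA; rewrite /rk -(Lagrange KA) lognM ?cardG_gt0//.
rewrite ltn_subRL => r2; have : logn p #|D| < logn p #|'C_A(N)|.
  by rewrite -(ltn_add2r 1) (leq_trans r2)// leq_add2l.
apply: contraTT; rewrite -!leqNgt => leKD.
have -> : 'C_A(N) = D by apply/esym/eqP; rewrite eqEcard DK leKD.
by [].
Qed.

End CyclicCentralizer.

Section LiftChoice.
Context (gT : finGroupType) (p : nat) (L M D : {group gT}).
Hypotheses (nML : M <| L) (pM : p^'.-group M).
Hypotheses (DL : D \subset L) (pD : p.-group D).

Lemma quotient_lift_choice : exists s : {group coset_of M} -> {group gT},
  forall y, y \in elem_above p (D / M)%G (L / M)%G ->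
    s y \in elem_above p D L /\ (s y / M)%G = y.
Proof.
suff /choice[s sP] : forall y : {group coset_of M}, exists E : {group gT},
    y \in elem_above p (D / M)%G (L / M)%G ->
    E \in elem_above p D L /\ (E / M)%G = y by exists s.
move=> y; case yY: (y \in elem_above p (D / M)%G (L / M)%G).
  by have [E EX Ey] := quotient_elem_above_lift nML pM DL pD yY; exists E.
by exists 1%G.
Qed.

End LiftChoice.

(** Induction on the order of [N]. If [N] is trivial or minimal normal, [C_A(N)] cones the poset;
    otherwise a minimal normal [M] inside [N] reduces to [L / M] and to the fibres over rank at
    least two, with smaller p'-groups [N / M] and [M]. *)
Lemma elem_above_conn n (gT : finGroupType) p (L N A D : {group gT}) :
  #|N| <= n -> prime p -> N <| L -> p^'.-group N -> solvable N -> N * A = L ->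
  p.-abelem A -> D \subset A -> D \subset 'Z(L) -> 1 < rk p D A ->
  conn (cmp gle) (elem_above p D L).
Proof.
elim: n gT L N A D => [|n IH] gT L N A D leN p_pr nNL pN solN NA pA DA DZ rA.
  by rewrite leqNgt cardG_gt0 in leN.
have AL : A \subset L by rewrite -NA mulG_subr.
have DL : D \subset L by exact: subset_trans DA AL.
have pD : p.-group D by exact: pgroupS DA (abelem_pgroup pA).
have base : cyclic (A / 'C_A(N)) -> conn (cmp gle) (elem_above p D L).
  move=> cycA; have [KX KZ] := centralizer_elem_above NA pA DA DZ cycA rA.
  exact: cone_elem_conn KX KZ.
have [N1|ntN] := eqVneq (N : {set gT}) 1.
  apply: base; rewrite N1 cent1T setIT trivg_quotient; exact: cyclic1.
have [M minM MN] := minnormal_exists ntN (normal_norm nNL).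
have [_ ntM abM] := minnormal_solvable minM MN solN.
have [MeN|MneN] := eqVneq M N.
  by apply: base; apply: (minnormal_cyclic_quotient NA _ _ (abelem_abelian pA));
    rewrite -MeN.
have nML : M <| L.
  have /mingroupP[/andP[_ nML] _] := minM.
  by rewrite /normal (subset_trans MN (normal_sub nNL)).
have pM : p^'.-group M by exact: pgroupS MN pN.
have cM : #|M| <= n.
  rewrite -ltnS (leq_trans _ leN)//; apply: proper_card.
  by rewrite properEneq MN andbT; apply: contra MneN => /eqP e; apply/eqP/val_inj.
have [s sP] := quotient_lift_choice nML pM DL pD.
have AX : A \in elem_above p D L.
  apply/elem_aboveP; split=> //; rewrite properEneq DA andbT.
  by apply: contraTneq rA => DeA; rewrite /rk DeA subnn.
have nMA : A \subset 'N(M) by exact: subset_trans AL (normal_norm nML).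
have nNbar : (N / M) <| (L / M) by exact: quotient_normal.
have pNbar : p^'.-group (N / M) by exact: quotient_pgroup.
have solNbar : solvable (N / M) by exact: quotient_sol.
have NAbar : (N / M) * (A / M) = L / M.
  by rewrite -quotientMr// NA.
have pAbar : p.-abelem (A / M) by exact: quotient_abelem.
have DAbar : D / M \subset A / M by exact: quotientS.
have DZbar : D / M \subset 'Z(L / M).
  by apply: subset_trans (quotientS _ DZ) _; exact: quotient_subcent.
have rAbar : 1 < rk p (D / M)%G (A / M)%G by rewrite (quotient_rk nML pM DL pD AX).
have cNbar : #|N / M| <= n.
  by rewrite -ltnS (leq_trans _ leN)// ltn_quotient.
apply: (@fibration_conn _ _ gle gle (@gle_refl _) _
  (elem_above p (D / M)%G (L / M)%G) (fun E => (E / M)%G) (rk p (D / M)%G) s).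
- by move=> E; exact: quotient_elem_above.
- exact: rk_mono.
- exact: rk_inj.
- exact: rk_gt0.
- exact: sP.
- move=> y yY r1; have [BX By] := sP y yY.
  rewrite -By (fibre_quotient nML BX).
  have /elem_aboveP[BL pB DB] := BX.
  have nMB : s y \subset 'N(M) by exact: subset_trans BL (normal_norm nML).
  apply: (IH _ _ M (s y)) => //.
  + by rewrite /normal joing_subl join_subG normG.
  + exact: solvableS solN.
  + by rewrite /= norm_joinEr.
  + exact: proper_sub.
  + rewrite subsetI (subset_trans (proper_sub DB)) ?joing_subr//=.
    rewrite (subset_trans DZ)// subIset// centS ?orbT//.
    by rewrite join_subG (normal_sub nML).
  + by rewrite -(quotient_rk nML pM DL pD BX) By.
- move=> y yY y1.
  by apply: (above_elem_neq0 (N := (N / M)%G) (A := (A / M)%G)); rewrite ?y1.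
exact: (IH _ (L / M)%G (N / M)%G (A / M)%G (D / M)%G).
Qed.

Section QuotientTransfer.
Context (gT : finGroupType) (p : nat) (L M : {group gT}).
Hypotheses (p_pr : prime p) (nML : M <| L) (pM : p^'.-group M).
Local Notation X := (elem_above p 1 L).
Local Notation Y := (elem_above p 1 (L / M)).
Local Notation glue := (glue_rel gle gle (fun E : {group gT} => (E / M)%G)).
Context (Z : {set {group coset_of M}})
  (Q att : {set {group gT} + {group coset_of M}} -> Prop).

(** Specializes the gluing argument to [E] mapped to [E M / M], with fibres rewritten as the posets
    of [M <*> B]. *)
Lemma quotient_transfer :
  (forall z, z \in Z -> z \in Y /\ rk p 1 z = 2) ->
  (forall z y, z \in Z -> y \in Y -> gle z y -> y = z) ->
  (forall (A : {set {group gT} + {group coset_of M}}) x, x \notin A ->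
     trivial_on_link glue A x -> att (link glue A x) -> Q A -> Q (x |: A)) ->
  (forall (A : {set {group gT} + {group coset_of M}}) x, x \notin A ->
     trivial_on_link glue A x -> conn glue (link glue A x) -> Q (x |: A) -> Q A) ->
  (forall (A : {set {group gT} + {group coset_of M}}) x, x \in A ->
     (forall y, y \in A -> glue x y) -> att A) ->
  (forall y, y \in Y -> rk p 1 y = 1%N -> att (inr @: above gle (Y :\: Z) y)) ->
  (forall E, E \in X -> (E / M)%G \in Z ->
     att (inl @: [set F in X | gle F E & F != E])) ->
  (forall B, B \in X -> (B / M)%G \in Y :\: Z -> 1 < rk p 1 B ->
     conn (cmp gle) (elem_above p 1 (M <*> B)) /\
     (acyclic (cmp gle) (elem_above p 1 (M <*> B)) \/
      above gle (Y :\: Z) (B / M)%G != set0)) ->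
  acyclic (cmp gle) (Y :\: Z) ->
  (forall A, acyclic glue A -> Q A) ->
  Q (inl @: X).
Proof.
move=> Z2 Zmax Qa Qr ac al aZ fibB aY QA.
have D1 : (1%G / M)%G = 1%G :> {group coset_of M}.
  by apply: val_inj; rewrite /= quotient1.
have L1 : (1%G : {group gT}) \subset L := sub1G L.
have p1 : p.-group (1%G : {group gT}) := pgroup1 gT p.
have [s sP] := quotient_lift_choice nML pM L1 p1; rewrite D1 in sP.
have fX E : E \in X -> (E / M)%G \in Y.
  by move/(quotient_elem_above nML pM L1 p1); rewrite D1.
have rf E : E \in X -> rk p 1 (E / M)%G = rk p 1 E.
  by move/(quotient_rk nML pM L1 p1); rewrite D1.
have f_mono (E F : {group gT}) : E \in X -> F \in X -> gle E F ->
    gle (E / M)%G (F / M)%G.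
  by move=> _ _; exact: quotientS.
apply: (@fibration_transfer _ _ gle gle (@gle_refl _) (@gle_refl _) (@gle_trans _)
  X Y (fun E => (E / M)%G) (rk p 1) (rk p 1) s fX f_mono rf _ _ _ _ _ _ Z Q att) => //.
- exact: rk_mono.
- exact: rk_inj.
- exact: rk_mono.
- exact: rk_inj.
- exact: rk_gt0.
- move=> y yYZ r1; have yY : y \in Y by move: yYZ; rewrite inE => /andP[].
  have [BX By] := sP y yY; rewrite -{1 2}By (fibre_quotient nML BX) -[in above _ _ _]By.
  by apply: fibB; rewrite // ?By// -rf// By.
apply: QA; apply: (glue_base_acyclic (@gle_refl _) f_mono) => //.
- exact: rk_mono.
- exact: rk_inj.
- exact: rk_gt0.
Qed.

End QuotientTransfer.
(** The interval above [y] is the poset of [C_L(y)] over the central subgroup [y]. A conjugate [F]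
    of [A] containing [y] complements [C_N(y)] there, and its rank over [y] is still at least
    two. *)
Lemma above_elem_conn (gT : finGroupType) p (L N A y : {group gT}) :
  prime p -> N <| L -> p^'.-group N -> solvable N -> N * A = L -> p.-abelem A ->
  2 < rk p 1 A -> y \in elem_above p 1 L -> rk p 1 y = 1%N ->
  conn (cmp gle) (above gle (elem_above p 1 L) y).
Proof.
move=> p_pr nNL pN solN NA pA rA yL y1.
have [F yF [NF pF _ FA]] :=
  elem_above_sub_complement nNL pN NA pA (sub1G _) (sub1G _) yL.
have /elem_aboveP[ysL py _] := yL.
have cyF : F \subset 'C(y) by exact: subset_trans (abelem_abelian pF) (centS yF).
have -> : above gle (elem_above p 1 L) y = elem_above p y 'C_L(y).
  apply/setP=> E; rewrite inE; apply/and3P/elem_aboveP.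
    case=> /elem_aboveP[EL pE _] yE Ey; split=> //.
      by rewrite subsetI EL (subset_trans (abelem_abelian pE))// centS.
    rewrite properEneq [_ \subset _]yE andbT eq_sym.
    by apply: contra Ey => /eqP e; apply/eqP/val_inj.
  case; rewrite subsetI => /andP[EL _] pE yE; split.
  - apply/elem_aboveP; split=> //; apply: sub_proper_trans yE; exact: sub1G.
  - exact: proper_sub.
  - by apply: contraTneq yE => ->; rewrite properxx.
apply: (@elem_above_conn #|'C_N(y)| _ _ _ 'C_N(y)%G F) => //=.
- have -> : 'C_N(y) = 'C_L(y) :&: N by rewrite setIAC (setIidPr (normal_sub nNL)).
  exact: normalGI (subsetIl _ _) nNL.
- exact: pgroupS (subsetIl _ _) pN.
- exact: solvableS (subsetIl _ _) solN.
(* The modular law gives [C_N(y) F = C_L(y)], as [F] centralizes [y]. *)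
- by rewrite setIC group_modr// NF setIC.
- rewrite subsetI; apply/andP; split.
    by rewrite subsetI ysL; exact: abelem_abelian py.
  by rewrite centsC subsetIr.
have : 2 < rk p 1 F by rewrite /rk /= FA.
move: y1; rewrite /rk /= cards1 logn1 !subn0 => -> r3.
by rewrite ltn_subRL.
Qed.

(** The same induction as for connectedness, one dimension higher: the base cases use the
    contraction to a central subgroup. In the step a fibre over rank two is only connected, but as
    [A] has rank at least three there is always something above it to join with. *)
Lemma elem_above_acyclic n (gT : finGroupType) p (L N A : {group gT}) :
  #|N| <= n -> prime p -> N <| L -> p^'.-group N -> solvable N -> N * A = L ->
  p.-abelem A -> 2 < rk p 1 A -> acyclic (cmp gle) (elem_above p 1 L).
Proof.
elim: n gT L N A => [|n IH] gT L N A leN p_pr nNL pN solN NA pA rA.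
  by rewrite leqNgt cardG_gt0 in leN.
have AL : A \subset L by rewrite -NA mulG_subr.
have base : cyclic (A / 'C_A(N)) -> acyclic (cmp gle) (elem_above p 1 L).
  move=> cycA.
  have [/elem_aboveP[KL pK ntK] KZ] :=
    centralizer_elem_above NA pA (sub1G _) (sub1G _) cycA (ltnW rA).
  apply: normal_elem_acyclic (sub_center_normal KZ) pK _ p_pr.
  by rewrite -proper1G.
have [N1|ntN] := eqVneq (N : {set gT}) 1.
  apply: base; rewrite N1 cent1T setIT trivg_quotient; exact: cyclic1.
have [M minM MN] := minnormal_exists ntN (normal_norm nNL).
have [_ ntM abM] := minnormal_solvable minM MN solN.
have [MeN|MneN] := eqVneq M N.
  by apply: base; apply: (minnormal_cyclic_quotient NA _ _ (abelem_abelian pA));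
    rewrite -MeN.
have nML : M <| L.
  have /mingroupP[/andP[_ nML] _] := minM.
  by rewrite /normal (subset_trans MN (normal_sub nNL)).
have pM : p^'.-group M by exact: pgroupS MN pN.
have solM : solvable M by exact: solvableS MN solN.
have cM : #|M| <= n.
  rewrite -ltnS (leq_trans _ leN)//; apply: proper_card.
  by rewrite properEneq MN andbT; apply: contra MneN => /eqP e; apply/eqP/val_inj.
have AX : A \in elem_above p 1 L.
  apply/elem_aboveP; split=> //; rewrite proper1G.
  by apply: contraTneq rA => A1; rewrite /rk /= A1 subnn.
have nNbar : (N / M) <| (L / M) by exact: quotient_normal.
have pNbar : p^'.-group (N / M) by exact: quotient_pgroup.
have solNbar : solvable (N / M) by exact: quotient_sol.
have nMA : A \subset 'N(M) by exact: subset_trans AL (normal_norm nML).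
have NAbar : (N / M) * (A / M) = L / M.
  by rewrite -quotientMr// NA.
have pAbar : p.-abelem (A / M) by exact: quotient_abelem.
have rAbar : 2 < rk p 1 (A / M)%G.
  rewrite /rk /= (quotient_p'_card nML pM AL (abelem_pgroup pA)) cards1.
  by move: rA; rewrite /rk /= cards1.
have cNbar : #|N / M| <= n.
  by rewrite -ltnS (leq_trans _ leN)// ltn_quotient.
pose glue := glue_rel gle gle (fun E : {group gT} => (E / M)%G).
have glr : reflexive glue := glue_refl (@gle_refl _) (@gle_refl _) _.
have gls : symmetric glue := @glue_sym _ _ gle gle _.
suff aX : acyclic glue (inl @: elem_above p 1 L).
  have -> : elem_above p 1 L =
      (fun x : {group gT} + {group coset_of M} => if x is inl E then E else 1%G)
        @: (inl @: elem_above p 1 L).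
    by rewrite -imset_comp; apply/esym; exact: imset_id.
  apply: (acyclic_imset (eU := glue) (h := inl)) aX.
    by move=> _ /imsetP[E _ ->].
  by move=> _ _ /imsetP[E _ ->] /imsetP[F _ ->].
apply: (quotient_transfer p_pr nML pM (Z := finset.set0) (att := conn glue)).
- by move=> z; rewrite inE.
- by move=> z y; rewrite inE.
- by move=> S x xS gS cS aS; exact: acyclic_attach.
- by move=> S x xS gS _; exact: acyclic_remove.
- by move=> S x xS xc; exact: cone_conn xS xc.
- move=> y yY y1; rewrite setD0; apply: (conn_imset (eU := cmp gle)) => //.
  exact: (above_elem_conn p_pr nNbar pNbar solNbar NAbar pAbar rAbar).
- by move=> E _; rewrite inE.
- move=> B BX; rewrite setD0 => BY rB; have /elem_aboveP[BL pB _] := BX.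
  have nMB : B \subset 'N(M) by exact: subset_trans BL (normal_norm nML).
  have nMMB : M <| M <*> B by rewrite /normal joing_subl join_subG normG.
  have MB : M * B = M <*> B by rewrite norm_joinEr.
  split.
    exact: (@elem_above_conn #|M| _ _ _ M B) (leqnn _) p_pr nMMB pM solM MB pB
      (sub1G _) (sub1G _) rB.
  have [r3|r2] := ltnP 2 (rk p 1 B).
    by left; apply: (IH _ (M <*> B)%G M B).
  right; apply: (above_elem_neq0 (N := (N / M)%G) (A := (A / M)%G)) => //.
  - exact: sub1G.
  - exact: sub1G.
  - rewrite (leq_ltn_trans _ rAbar)//; move: r2.
    by rewrite /rk /= (quotient_p'_card nML pM BL (abelem_pgroup pB)) !cards1.
- by rewrite setD0; exact: (IH _ (L / M)%G (N / M)%G (A / M)%G).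
- by [].
Qed.

(** A solvable group has a non-trivial normal elementary abelian [q]-subgroup, and [q = p] because
    the p'-core is trivial. *)
Lemma p'core_free_elem_acyclic (gT : finGroupType) p (G : {group gT}) :
  prime p -> p %| #|G| -> solvable G -> 'O_p^'(G) = 1 ->
  acyclic (cmp gle) (elem_above p 1 G).
Proof.
move=> p_pr pG solG OG.
have ntG : G :!=: 1.
  by apply: contraTneq pG => ->; rewrite cards1 dvdn1 neq_ltn prime_gt1 ?orbT.
have [K [KG nKG ntK /is_abelemP[q q_pr qK]]] :=
  solvable_norm_abelem solG (normal_refl G) ntG.
apply: (normal_elem_acyclic nKG _ ntK p_pr).
have [<-//|qp] := eqVneq q p.
case/negP: ntK; rewrite -subG1 -OG; apply: pcore_max => //.
apply: pi_pgroup (abelem_pgroup qK) _.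
by rewrite inE /= inE.
Qed.

Lemma solvable_pi1_free (gT : finGroupType) p (G : {group gT}) :
  prime p -> p %| #|G| -> solvable G ->
  exists (rT : finGroupType) (f : {group gT} -> {group rT}),
    pi1_free (glue_rel gle gle f) (inl @: elem_above p 1 G).
Proof.
move=> p_pr pG solG; pose M := 'O_p^'(G)%G.
have nMG : M <| G by exact: pcore_normal.
have pM : p^'.-group M by exact: pcore_pgroup.
have solM : solvable M by exact: solvableS (normal_sub nMG) solG.
exists (coset_of M), (fun E => (E / M)%G).
pose Y := elem_above p 1 (G / M).
pose glue := glue_rel gle gle (fun E : {group gT} => (E / M)%G).
have glr : reflexive glue := glue_refl (@gle_refl _) (@gle_refl _) _.
have gls : symmetric glue := @glue_sym _ _ gle gle _.
(* Over these elements the fibre need not be simply connected and nothing lies above to join with,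
   so they could not be removed at the end. *)
pose Z := [set z in Y | (rk p 1 z == 2) && (above gle Y z == finset.set0)].
have ZP z : z \in Z -> [/\ z \in Y, rk p 1 z = 2 & above gle Y z = finset.set0].
  by rewrite inE => /and3P[? /eqP ? /eqP].
have pGM : p %| #|G / M|.
  have pGM : p^'.-nat #|M| by [].
  have := pG; rewrite -(Lagrange (normal_sub nMG)) Euclid_dvdM// -card_quotient ?normal_norm//.
  by case/orP=> // pdM; move: pGM; rewrite p'natE ?pdM.
have aY : acyclic (cmp gle) Y.
  apply: p'core_free_elem_acyclic => //; first exact: quotient_sol.
  exact: trivg_pcore_quotient.
have YZ : (Y :\: Z) :|: Z = Y.
  apply/setP=> y; rewrite in_setU in_setD; case yZ: (y \in Z); last by rewrite orbF.
  by have [->] := ZP y yZ.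
(* Once [Z] is gone, the neighbours of [z] are its subgroups of order [p], which are pairwise
   incomparable. *)
have aYZ : acyclic (cmp gle) (Y :\: Z).
  apply: (remove_all (e := cmp gle) (Q := acyclic (cmp gle)) (rk := fun=> 0) (D := Z)).
  - by move=> z zZ; rewrite inE zZ.
  - move=> y z /ZP[yY y2 _] /ZP[zY z2 _] /orP[] yz _.
      by apply: (rk_inj p_pr yY zY yz); rewrite y2.
    by apply/esym; apply: (rk_inj p_pr zY yY yz); rewrite y2.
  - move=> z S zZ _ _ zS linkE; apply: acyclic_remove => //; first exact: cmp_sym.
    apply: discrete_trivial_on_link; first exact/cmp_refl/gle_refl.
    have [zY z2 z0] := ZP z zZ.
    have r1 y : y \in link (cmp gle) S z -> y \in Y /\ rk p 1 y = 1%N.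
      rewrite linkE inE !in_setU in_setD [y \in [set _ in Z | _]]inE ltnn andbF orbF.
      case/andP=> /andP[yZ yY] zy; split=> //.
      have yz : y != z by apply: contraNneq yZ => ->.
      case/orP: zy => zy.
        by have := in_set0 y; rewrite -z0 inE yY zy yz.
      apply/eqP; rewrite eqn_leq (rk_gt0 p_pr yY) andbT -ltnS -z2 ltn_neqAle.
      rewrite (rk_mono yY zY zy) andbT.
      by apply: contra yz => /eqP e; apply/eqP; exact: rk_inj yY zY zy e.
    move=> y w /r1[yY y1] /r1[wY w1] /orP[] yw.
      by apply: (rk_inj p_pr yY wY yw); rewrite y1.
    by apply/esym; apply: (rk_inj p_pr wY yY yw); rewrite y1.
  - by rewrite YZ.
apply: (quotient_transfer p_pr nMG pM (Z := Z) (att := fun=> True)) => //.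
- by move=> z /ZP[].
- move=> z y /ZP[zY z2 z0] yY zy; apply/eqP; apply: contraT => yz.
  by have := in_set0 y; rewrite -z0 inE yY zy yz.
- by move=> S x xS gS _; exact: pi1_free_attach.
- by move=> S x; exact: pi1_free_remove.
- move=> B BX; rewrite in_setD => /andP[BZ BY] rB; have /elem_aboveP[BG pB _] := BX.
  have nMB : B \subset 'N(M) by exact: subset_trans BG (normal_norm nMG).
  have nMMB : M <| M <*> B by rewrite /normal joing_subl join_subG normG.
  have MB : M * B = M <*> B by rewrite norm_joinEr.
  have rBE : rk p 1 (B / M)%G = rk p 1 B.
    by rewrite /rk /= (quotient_p'_card nMG pM BG (abelem_pgroup pB)) !cards1.
  split.
    exact: (@elem_above_conn #|M| _ _ _ M B) (leqnn _) p_pr nMMB pM solM MB pB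
      (sub1G _) (sub1G _) rB.
  have [r3|r2] := ltnP 2 (rk p 1 B).
    by left; apply: (@elem_above_acyclic #|M| _ _ (M <*> B)%G M B).
  (* A non-maximal element of rank two has some [z] above it; its rank exceeds two, so [z] was not
     deleted. *)
  right; move: BZ; rewrite inE BY rBE eqn_leq r2 rB /= => /set0Pn[z].
  rewrite inE => /and3P[zY Bz zB]; apply/set0Pn; exists z.
  rewrite inE Bz zB in_setD zY !andbT; apply/negP => /ZP[_ z2 _].
  move/eqP: zB; apply; apply/esym; apply: (rk_inj p_pr BY zY Bz).
  by apply/eqP; rewrite z2 rBE eqn_leq r2.
by move=> S aS; exact: acyclic_pi1_free.
Qed.

End Solvable.

Theorem corollary1p2 (R : realType) (gT : finGroupType) (G : {group gT})
    (p : nat) (p_prime : prime p) (p_dvd : p %| #|G|) (G_sol : solvable G)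
    (x : poset_space R (Ap p G)) :
  is_free_group (pi1 R x).
Proof.
apply: is_free_pi1.
have [rT [f fX]] := solvable_pi1_free p_prime p_dvd G_sol.
apply: (@pi1_free_imset _ _ _ (glue_rel gle gle f) (fun E : Ap p G => inl (val E))).
- by move=> E F [/val_inj].
- by move=> E F.
rewrite (_ : _ @: _ = inl @: elem_above p 1 G)//.
apply/setP=> -[E|y]; last by apply/imsetP/imsetP => -[].
rewrite [RHS]mem_imset; last exact: inl_inj.
apply/imsetP/idP => [[F _ [->]]|].
  by rewrite inE proper1G; exact: (valP F).
rewrite inE proper1G => EG.
by exists (Sub E EG : Ap p G) => //; rewrite inE.
Qed.
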